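(* Let $|\mathcal{M}_n^{\mathrm{out}}|$ denote the number of rooted simple outerplanar maps with $n$ vertices, and $|\mathcal{M}_n^{\mathrm{bip}}|$ the number of bipartite rooted simple outerplanar maps with $n$ vertices. Then, as $n\to\infty$, $$|\mathcal{M}_n^{\mathrm{out}}| \sim \frac{8^n n^{-3/2}}{36\sqrt{\pi}} \qquad\text{and}\qquad |\mathcal{M}_n^{\mathrm{bip}}| \sim \frac{(2\sqrt{3}-3)\sqrt{2}}{9\sqrt{\pi(\sqrt{3}-1)}}\,(3\sqrt{3}-5)^{-n}\, n^{-3/2}.$$
   Context: A planar map is a 2-cell embedding of a connected planar multigraph on the sphere, up to orientation-preserving homeomorphism. It is rooted if one edge is distinguished and oriented (the root edge); the face to the right of the root edge is the outer face. The map consisting of a single vertex is also considered rooted. A map is simple if it has no loops and no multiple edges. A simple rooted map is outerplanar if every vertex lies on the boundary of the outer face. $a_n\sim b_n$ means $a_n/b_n\to 1$. *)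

(* Defs.v *)
From HB Require Import structures.
From mathcomp Require Import all_boot all_order all_algebra all_fingroup.
From mathcomp Require Import finmap.
From mathcomp Require Import all_classical all_reals all_analysis.

Set Implicit Arguments.
Unset Strict Implicit.
Unset Printing Implicit Defensive.

Import numFieldNormedType.Exports.

Local Open Scope nat_scope.

(** Combinatorial (rotation-system) encoding of the rooted maps on the sphere
    that have at least one edge.  A dart is an edge together with one of its
    two orientations; [node] turns counterclockwise around the origin of a
    dart, and [edge] reverses a dart.  With this orientation,
    [node (edge d)] is the dart following [d] along the face to the right
    of [d].  The last axiom is Euler's formula V + F = E + 2.
    Maps are only considered up to relabelling of the darts, so the dart set
    is taken to be some ['I_k].
    Note that [(s * t)%g d] is [t (s d)] for permutations. *)
Record edged_map := EdgedMap {
  num_darts : nat;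
  node : {perm 'I_num_darts};
  edge : {perm 'I_num_darts};
  root : 'I_num_darts;
  edge_involutive : involutive edge;
  edge_neq : forall d, edge d != d;
  edged_map_connected : forall d e,
    connect (fun x y => (y == node x) || (y == edge x)) d e;
  edged_map_planar :
    #|porbits node| + #|porbits (edge * node)%g| = #|porbits edge| + 2
}.

Definition dart (m : edged_map) : finType := 'I_(num_darts m).

Definition face (m : edged_map) : {perm dart m} := (edge m * node m)%g.

(** Vertices are the orbits of [node], faces the orbits of [face]. *)
Definition tail (m : edged_map) (d : dart m) : {set dart m} :=
  porbit (node m) d.

Definition head (m : edged_map) (d : dart m) : {set dart m} :=
  tail (edge m d).

Definition outer_face (m : edged_map) : {set dart m} :=
  porbit (face m) (root m).

(** The map with a single vertex has no dart, hence its own constructor. *)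
Inductive rooted_map := VertexMap | EdgedRootedMap of edged_map.

Definition num_vertices (M : rooted_map) : nat :=
  match M with
  | VertexMap => 1
  | EdgedRootedMap m => #|porbits (node m)|
  end.

Definition simple_map (M : rooted_map) : Prop :=
  match M with
  | VertexMap => True
  | EdgedRootedMap m =>
      (forall d : dart m, tail d <> head d) /\
      (forall d e : dart m, tail d = tail e -> head d = head e -> d = e)
  end.

(** A vertex is on the boundary of a face when one of the darts leaving it
    has that face to its right. *)
Definition outerplanar (M : rooted_map) : Prop :=
  simple_map M /\
  match M with
  | VertexMap => True
  | EdgedRootedMap m =>
      forall v : {set dart m}, v \in porbits (node m) ->
        exists2 d, d \in v & d \in outer_face m
  end.

Definition bipartite (M : rooted_map) : Prop :=
  match M with
  | VertexMap => True
  | EdgedRootedMap m =>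
      exists color : {set dart m} -> bool,
        forall d : dart m, color (tail d) <> color (head d)
  end.

(** Commuting with [node] (and not with its inverse) is what makes an
    isomorphism orientation-preserving. *)
Definition map_iso (M M' : rooted_map) : Prop :=
  match M, M' with
  | VertexMap, VertexMap => True
  | EdgedRootedMap m, EdgedRootedMap m' =>
      exists h : dart m -> dart m',
        [/\ bijective h,
            forall d, h (node m d) = node m' (h d),
            forall d, h (edge m d) = edge m' (h d) &
            h (root m) = root m']
  | _, _ => False
  end.

Definition iso_class (M : rooted_map) : set rooted_map :=
  [set M' | map_iso M M']%classic.

(* [fset_set] would be empty on an infinite set of classes. *)
Definition num_iso_classes (P : set rooted_map) : nat :=
  (#|` fset_set [set iso_class M | M in P]%classic |)%fset.

Definition num_outerplanar (n : nat) : nat :=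
  num_iso_classes [set M | outerplanar M /\ num_vertices M = n]%classic.

Definition num_bipartite_outerplanar (n : nat) : nat :=
  num_iso_classes
    [set M | [/\ outerplanar M, bipartite M & num_vertices M = n]]%classic.

Definition asymptotic_to (R : realType) (a b : nat -> R) : Prop :=
  ((fun n => a n / b n)%R @ \oo --> (1 : R)%R)%classic.

(* Main.v *)
(* Number the vertices in the order of their first visit along the outer face.
   A star drawn inside the outer face merges the rotations at the vertices into
   a single cycle, and Euler's formula then says that no two edges cross when the
   vertices are placed on a circle.  So a map is determined by a noncrossing
   graph on {0, ..., n - 1} in which every positive vertex has a smaller
   neighbour.  Adding the vertices one by one, such graphs are counted by walks
   recording how many vertices are still visible from the outside.  The kernel
   method gives the generating function 1 / (1 - D), where X = D (1 - 2 D), resp.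
   X (1 + D) = D - 2 D ^ 3 for bipartite maps.  Both have the form
   G - H sqrt (1 - X / rho) with G and H analytic beyond rho; by Tannery's theorem
   the coefficients are asymptotic to those of the square root multiplied by
   - H(rho), and the latter are given by Wallis' integrals. *)
Require Import Defs.
From HB Require Import structures.
From mathcomp Require Import all_boot all_order all_algebra all_fingroup.
From mathcomp Require Import finmap.
From mathcomp Require Import all_classical all_reals all_analysis.
From mathcomp Require Import fintype finset path fingraph zify ring lra.
Set Implicit Arguments.
Unset Strict Implicit.
Unset Printing Implicit Defensive.
Import Order.TTheory GRing.Theory Num.Theory.
Import numFieldNormedType.Exports.

(** * Cycles of permutations *)

Local Open Scope nat_scope.

(** Planarity is given only as Euler's formula, so crossings must be read off orbit counts: a
    transposition of distinct points changes the number of orbits by one, and a crossing pair of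
    edges costs two orbits that the count cannot spare. Conversely, a noncrossing graph has to be
    shown to give a planar map, and its labels must be recovered from the map alone: read along the
    outer face they form a restricted growth sequence, which is determined by the equalities between
    its entries. On the analytic side, analyticity beyond [rho] is replaced by a bound on a weighted
    l^1 norm at radius [1 / 4]. Such bounds are stable under sums and products, and the auxiliary
    series are fixed points of maps preserving balls of this norm. In the bipartite case [D] is
    reached through another root [e] of its cubic, which is regular at [rho]; [D] then solves the
    remaining quadratic equation, and its singularity is an explicit square root. *)

Section PermCycles.
Variable T : finType.
Implicit Types (s a : {perm T}) (x y : T).

(** Conjugation by [s] moves the transposition to the left, the case treated by
    [porbits_mul_tperm]. *)
Lemma porbits_mulr_tperm s x y :
  #|porbits (s * tperm x y)%g| + (x \notin porbit s y).*2 =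
  #|porbits s| + (x != y).
Proof.
have -> : (s * tperm x y = tperm (s^-1 x) (s^-1 y) * s)%g.
  apply/permP => z; rewrite !permM.
  case: tpermP => [sz | sz | nx ny].
  - by rewrite -sz permK tpermL permKV.
  - by rewrite -sz permK tpermR permKV.
  by rewrite tpermD // -(inj_eq (perm_inj (s:=s))) permKV eq_sym; apply/eqP.
have -> : (x \in porbit s y) = ((s^-1)%g x \in porbit s ((s^-1)%g y)).
  have E z : porbit s z = porbit s ((s^-1)%g z).
    by rewrite -(porbit_perm s 1 (_ z)) expg1 permKV.
  by rewrite -!eq_porbit_mem -!E.
by rewrite porbits_mul_tperm (inj_eq perm_inj).
Qed.

Lemma fpath_mul_tperm s x y u p : x \notin p -> y \notin p ->
  fpath s u p -> fpath (s * tperm x y)%g u p.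
Proof.
elim: p u => //= v p IH u.
rewrite !inE !negb_or => /andP[xv xp] /andP[yv yp] /andP[/eqP suv sp].
by rewrite permM suv tpermD // eqxx IH.
Qed.

Lemma fpath_rcons_mul_tperm s x y u p : x \notin p -> y \notin p ->
  fpath s u (rcons p x) -> fpath (s * tperm x y)%g u (rcons p y).
Proof.
move=> xp yp; rewrite !rcons_path => /andP[sp /eqP last_p].
by rewrite /= permM last_p tpermL eqxx andbT fpath_mul_tperm.
Qed.

Lemma fcycle_tperm_disjoint s x y p : x \notin p -> y \notin p ->
  fcycle s p -> fcycle (s * tperm x y)%g p.
Proof.
by case: p => // z p xp yp; apply: fpath_mul_tperm; rewrite mem_rcons.
Qed.

Lemma fcycle_merge s x p y q : uniq ((x :: p) ++ y :: q) ->
  fcycle s (x :: p) -> fcycle s (y :: q) ->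
  fcycle (s * tperm x y)%g ((x :: p) ++ y :: q).
Proof.
rewrite cat_uniq /= => /and3P[/andP[xp _] /norP[]]; rewrite inE negb_or.
move=> /andP[yx yp] /hasPn dis /andP[yq _] cp cq.
have xq : x \notin q by apply/negP => /dis; rewrite inE eqxx.
rewrite rcons_cat -cat_rcons cat_path; apply/andP; split.
  exact: fpath_rcons_mul_tperm.
by rewrite last_rcons tpermC; apply: fpath_rcons_mul_tperm.
Qed.

Lemma fcycle_split s x p y q : x \notin p -> y \notin p ->
  fcycle s (x :: p ++ y :: q) -> fcycle (s * tperm x y)%g (x :: p).
Proof.
move=> xp yp /=; rewrite rcons_cat cat_path /= => /and3P[sp /eqP lp _].
rewrite tpermC; apply: fpath_rcons_mul_tperm => //.
by rewrite rcons_path sp /= lp eqxx.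
Qed.

(** Each transposition redirects the predecessor of [x] to the head of the next cycle, so the cycles
    are appended one after another while [x] stays in front. *)
Lemma fcycle_merges s x p (qs : seq (seq T)) :
    uniq ((x :: p) ++ flatten qs) -> all (fcycle s) qs -> [::] \notin qs ->
    fcycle s (x :: p) ->
  fcycle (s * \prod_(q <- qs) tperm x (head x q))%g ((x :: p) ++ flatten qs).
Proof.
elim: qs s p => [|[|y q] qs IH] s p //=; first by rewrite big_nil mulg1 cats0.
rewrite inE /= => U /andP[cq cqs] nq cp.
have E : p ++ y :: q ++ flatten qs = (p ++ y :: q) ++ flatten qs by rewrite -catA.
rewrite big_cons mulgA E; rewrite E in U.
have {}U : uniq (((x :: p) ++ y :: q) ++ flatten qs) by [].
apply: (IH _ (p ++ y :: q)) => //.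
  apply/allP => r rqs; apply: fcycle_tperm_disjoint; last exact: (allP cqs).
    apply: contraL U => xr; rewrite 2!cat_cons cons_uniq mem_cat negb_and negbK.
    by rewrite (_ : x \in flatten qs) ?orbT //; apply/flattenP; exists r.
  apply: contraL U => yr; rewrite cat_uniq.
  apply/nandP; right; apply/nandP; left; rewrite negbK; apply/hasP; exists y.
    by apply/flattenP; exists r.
  by rewrite /= inE mem_cat inE eqxx !orbT.
apply: fcycle_merge => //=.
by move: U; rewrite cat_uniq => /andP[].
Qed.

Lemma mem_fcycle_porbit s p x y : fcycle s p -> x \in p -> y \in p ->
  x \in porbit s y.
Proof.
move=> cp xp yp; have : fconnect s y x by rewrite (fconnect_cycle cp).
move/iter_findex => <-; rewrite -permX; exact: mem_porbit.
Qed.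

(** Each transposition cuts off the part of the cycle from position [t] on. As the positions
    decrease, the later ones lie in the part kept, which is still a cycle starting at [x]; so every
    factor adds one orbit. *)
Lemma card_porbits_splits s x p (ts : seq nat) :
    uniq (x :: p) -> fcycle s (x :: p) -> sorted gtn ts ->
    all (fun t => 0 < t < size (x :: p)) ts ->
  #|porbits (s * \prod_(t <- ts) tperm x (nth x (x :: p) t))%g| =
  #|porbits s| + size ts.
Proof.
elim: ts s p => [|t ts IH] s p; first by rewrite big_nil mulg1 addn0.
move=> U cp sts /= /andP[/andP[t0 tp] ats].
rewrite big_cons mulgA.
case: t t0 tp sts => // t _ tp sts.
have [p1 p2 Hsplit] : exists2 p1 : seq T, size p1 = t &
   exists p2, p = p1 ++ nth x p t :: p2.
  exists (take t p); first by rewrite size_takel // -ltnS ltnW.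
  by exists (drop t.+1 p); rewrite -drop_nth // cat_take_drop.
case: Hsplit => p3 def_p.
set y := nth x (x :: p) t.+1.
have yE : nth x p t = y by [].
rewrite yE in def_p.
have [xp1 yp1 xy] : [/\ x \notin p1, y \notin p1 & x != y].
  move: U; rewrite def_p /= mem_cat inE !negb_or cat_uniq /= => /and3P[].
  case/andP => -> /andP[-> _] _ /andP[/norP[-> _] _]; by [].
have Up1 : uniq (x :: p1).
  by move: U; rewrite def_p -cat_cons cat_uniq => /andP[].
have cp1 : fcycle (s * tperm x y)%g (x :: p1).
  by apply: (@fcycle_split _ _ _ _ p3) => //; rewrite -def_p.
have lt_t : all (fun u => u < t.+1) ts.
  by move: sts; rewrite /= path_sortedE; [case/andP|move=> a b c; lia].
have EQ : (\prod_(u <- ts) tperm x (nth x (x :: p) u) =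
          \prod_(u <- ts) tperm x (nth x (x :: p1) u))%g.
  rewrite big_seq [RHS]big_seq; apply: eq_bigr => u uts; congr tperm.
  have := allP lt_t _ uts; case: u uts => // u uts; rewrite ltnS => ut.
  by rewrite /= def_p nth_cat p2 ut.
rewrite EQ IH //; last first.
- apply/allP => u uts; have := allP ats _ uts; have := allP lt_t _ uts.
  by rewrite /= p2 => -> /andP[->].
- exact: path_sorted sts.
have := porbits_mulr_tperm s x y.
rewrite xy (_ : x \in porbit s y) /=.
  by rewrite addn0 => ->; rewrite -addnA add1n.
apply: (mem_fcycle_porbit cp); rewrite ?inE ?eqxx //.
by rewrite def_p mem_cat inE eqxx !orbT.
Qed.

Lemma card_porbits_mul_tperm_le s x y :
  #|porbits (tperm x y * s)%g| <= #|porbits s|.+1.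
Proof.
have /= := porbits_mul_tperm s x y.
move: #|porbits _| #|porbits s| (_ \notin _) => m k [] /=; case: (x != y); lia.
Qed.

(** Such an involution is a product of at most [k] transpositions, each of which adds at most one
    orbit. *)
Lemma card_porbits_involution a s k : involutive a ->
  #|[set x | a x != x]| <= k.*2 -> #|porbits (a * s)%g| <= #|porbits s| + k.
Proof.
elim: k a => [|k IH] a aK.
  rewrite leqn0 cards_eq0 => /eqP a1; rewrite addn0.
  suff -> : a = 1%g by rewrite mul1g.
  apply/permP => x; rewrite perm1; apply/eqP; apply: contraT => ax.
  by move/finset.setP/(_ x): a1; rewrite !inE ax.
move=> card_a.
have [/eqP a1|/finset.set0Pn[x]] := boolP ([set x | a x != x] == finset.set0).
  by rewrite (leq_trans (IH a aK _)) ?a1 ?cards0 // leq_add2l.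
rewrite inE => ax.
pose a' := (tperm x (a x) * a)%g.
have -> : (a = tperm x (a x) * a')%g by rewrite mulgA tperm2 mul1g.
have a'x : a' x = x by rewrite permM tpermL aK.
have a'ax : a' (a x) = a x by rewrite permM tpermR.
have a'E z : z != x -> z != a x -> a' z = a z.
  by move=> zx zax; rewrite permM tpermD // eq_sym.
have a'K : involutive a'.
  move=> z; have [->|zx] := eqVneq z x; first by rewrite !a'x.
  have [->|zax] := eqVneq z (a x); first by rewrite !a'ax.
  rewrite (a'E z) // a'E ?aK //; last by rewrite (inj_eq perm_inj).
  by apply: contra zax => /eqP <-; rewrite aK.
rewrite -mulgA addnS.
apply: (leq_trans (card_porbits_mul_tperm_le _ _ _)).
rewrite ltnS; apply: IH => //.
have sub : [set z | a' z != z] \subset [set z | a z != z] :\ x :\ a x.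
  apply/subsetP => z; rewrite !inE.
  have [->|zx] := eqVneq z x; first by rewrite a'x eqxx.
  have [->|zax] := eqVneq z (a x); first by rewrite a'ax eqxx.
  by rewrite a'E.
have := subset_leq_card sub.
have := cardsD1 x [set z | a z != z]; rewrite inE ax.
have := cardsD1 (a x) ([set z | a z != z] :\ x); rewrite !inE aK ax (eq_sym x) ax.
by move: card_a; lia.
Qed.

Lemma card_porbits_fcycle s p : fcycle s p -> (forall x, x \in p) ->
  (0 < #|T|) -> #|porbits s| = 1.
Proof.
move=> cp allp /card_gt0P[x _].
rewrite -(cards1 (porbit s x)); congr #|pred_of_set _|.
apply/finset.setP => A; rewrite inE; apply/imsetP/eqP => [[y _ ->]|->]; last by exists x.
by apply/eqP; rewrite eq_porbit_mem; apply: (mem_fcycle_porbit cp).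
Qed.

Lemma nth_fcycle s p x0 i : fcycle s p -> i.+1 < size p ->
  s (nth x0 p i) = nth x0 p i.+1.
Proof.
case: p => // x p cp ip; have := pathP x0 cp i; rewrite size_rcons /=.
move=> /(_ (ltnW ip)) /eqP.
by rewrite -rcons_cons !nth_rcons /= (ltnW ip) -ltnS ip.
Qed.

Lemma index_fcycle s p x : fcycle s p -> uniq p -> x \in p ->
  (index x p).+1 < size p -> index (s x) p = (index x p).+1.
Proof.
move=> cp Up xp lt; rewrite -{1}(nth_index x xp) (nth_fcycle _ cp) //.
by rewrite index_uniq.
Qed.

(* A crossing pair of transpositions turns a single cycle back into a single
   cycle, while each of the remaining ones adds at most one cycle. *)
Lemma planar_involution_noncrossing a s p x y :
    involutive a -> (forall z, a z != z) -> fcycle s p -> uniq p ->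
    (forall z, z \in p) -> #|T| < (#|porbits (a * s)%g|).*2 ->
  ~ (index x p < index y p < index (a x) p /\ index (a x) p < index (a y) p).
Proof.
move=> aK aN cp Up allp planar [/andP[xy yax] axay].
have N_xy : x != y by apply: contraTneq xy => ->; rewrite ltnn.
have N_yax : y != a x by apply: contraTneq yax => ->; rewrite ltnn.
have N_axay : a x != a y by apply: contraTneq axay => ->; rewrite ltnn.
have N_xay : x != a y by apply: contra N_yax => /eqP ->; rewrite aK.
(* [a'] is [a] with its two transpositions on the crossing points removed. *)
pose a' := (a * tperm y (a y) * tperm x (a x))%g.
have Ea : (a * s = a' * (tperm x (a x) * (tperm y (a y) * s)))%g.
  rewrite /a' !mulgA -(mulgA _ (tperm x _) (tperm x _)) tperm2 mulg1.
  by rewrite -(mulgA _ (tperm y _) (tperm y _)) tperm2 mulg1.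
have a'E z : z != x -> z != a x -> z != y -> z != a y -> a' z = a z.
  move=> zx zax zy zay; rewrite !permM !(tpermD (x := y)) ?tpermD //.
  - by rewrite eq_sym; apply: contra zax => /eqP <-; rewrite aK.
  - by rewrite eq_sym (inj_eq perm_inj).
  - by rewrite eq_sym; apply: contra zay => /eqP <-; rewrite aK.
  - by rewrite eq_sym (inj_eq perm_inj).
have a'x : a' x = x.
  by rewrite !permM (tpermD (x := y)) ?tpermR // eq_sym // eq_sym.
have a'ax : a' (a x) = a x.
  by rewrite !permM aK (tpermD (x := y)) ?tpermL // eq_sym.
have a'y : a' y = y.
  by rewrite !permM tpermR tpermD // eq_sym.
have a'ay : a' (a y) = a y.
  by rewrite !permM aK tpermL tpermD.
have a'K : involutive a'.
  move=> z; have [->|zx] := eqVneq z x; first by rewrite !a'x.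
  have [->|zax] := eqVneq z (a x); first by rewrite !a'ax.
  have [->|zy] := eqVneq z y; first by rewrite !a'y.
  have [->|zay] := eqVneq z (a y); first by rewrite !a'ay.
  rewrite (a'E z) // a'E ?aK ?(inj_eq perm_inj) //.
    by apply: contra zax => /eqP <-; rewrite aK.
  by apply: contra zay => /eqP <-; rewrite aK.
have lt_idx z : index z p < size p by rewrite index_mem.
have T0 : 0 < #|T| by apply/card_gt0P; exists x.
have c1 := card_porbits_fcycle cp allp T0.
have c2 : #|porbits (tperm y (a y) * s)%g| = 2.
  have := porbits_mul_tperm s y (a y); rewrite /= c1 eq_sym aN.
  by rewrite (mem_fcycle_porbit cp (allp _) (allp _)); lia.
(* After the split at [y] and [a y] this interval of positions is closed. It contains [a x] but not
   [x], so the second transposition merges the two orbits again. *)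
pose I := [pred z | index y p < index z p <= index (a y) p].
have I_closed z : I z -> I ((tperm y (a y) * s)%g z).
  rewrite /= permM => /andP[yz zay].
  have zy : z != y by apply: contraTneq yz => ->; rewrite ltnn.
  case: tpermP => [E|_|_ /eqP zay'].
  - by rewrite E eqxx in zy.
  - rewrite (index_fcycle cp) // ?ltnSn ?(ltn_trans yax) //.
    exact: leq_ltn_trans (lt_idx (a x)).
  have zay2 : index z p < index (a y) p.
    rewrite ltn_neqAle zay andbT; apply: contra zay' => /eqP E.
    by rewrite -(nth_index x (allp z)) E nth_index.
  rewrite (index_fcycle cp) // ?zay2 ?(ltn_trans yz) //.
  exact: leq_ltn_trans (lt_idx (a y)).
have c3 : #|porbits (tperm x (a x) * (tperm y (a y) * s))%g| = 1.
  have := porbits_mul_tperm (tperm y (a y) * s)%g x (a x); rewrite /= c2 eq_sym aN.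
  suff -> : x \notin porbit (tperm y (a y) * s) (a x) by lia.
  apply/negP => /porbitP[i Ei].
  have : I x.
    rewrite Ei; elim: i {Ei} => [|i IH]; last by rewrite expgSr permM I_closed.
    by rewrite expg0 perm1 /= yax ltnW.
  by rewrite /= ltnNge (ltnW xy).
(* Four points are fixed by [a']. Rounding up avoids a parity argument on [#|T|], and twice the
   resulting orbit bound is still below [#|T|]. *)
have card_a' : #|[set z | a' z != z]| <= (#|T|.+1 %/ 2 - 2).*2.
  have sub : [set z | a' z != z] \subset ~: [set x; a x; y; a y].
    apply/subsetP => z; rewrite !inE; apply: contra.
    by move=> /orP[/orP[/orP[]|]|] /eqP ->; rewrite ?a'x ?a'ax ?a'y ?a'ay.
  have := subset_leq_card sub; have := cardsC [set x; a x; y; a y].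
  have -> : #|[set x; a x; y; a y]| = 4.
    rewrite -!finset.setUA !cardsU1 cards1 !inE !negb_or.
    by rewrite N_xy N_xay N_axay (eq_sym x (a x)) (eq_sym (a x) y) (eq_sym y (a y)) !aN N_yax.
  set c := #|~: _|; set c' := #|[set z | _]|; move: c c' #|T| => i j k. lia.
have := card_porbits_involution (tperm x (a x) * (tperm y (a y) * s))%g a'K card_a'.
rewrite -Ea c3.
have : 4 <= #|T|.
  have : index (a y) p < size p by [].
  have -> : #|T| = size p.
    by rewrite -(card_uniqP Up); apply: eq_card => z; rewrite inE allp.
  by move: xy yax axay; lia.
by move: planar; lia.
Qed.

End PermCycles.

(** * Outerplanar maps as drawings of noncrossing graphs *)

Lemma mem_porbit_fconnect (T : finType) (s : {perm T}) x y :
  (y \in porbit s x) = fconnect s x y.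
Proof.
apply/porbitP/idP => [[i ->]|]; first by rewrite permX fconnect_iter.
by move/iter_findex => <-; exists (findex s x y); rewrite permX.
Qed.

Lemma next_map_uniq (T T' : eqType) (h : T -> T') (p : seq T) (x : T) :
  uniq (map h p) -> x \in p -> next (map h p) (h x) = h (next p x).
Proof.
move=> Uhp xp; rewrite !next_nth xp map_f //.
have Eidx : index (h x) (map h p) = index x p.
  have lt_x : index x p < size p by rewrite index_mem.
  rewrite -{1}(nth_index x xp) -(nth_map x (h x)) // index_uniq //.
  by rewrite size_map.
rewrite Eidx; move: (index x p) => i; case: p {xp Uhp Eidx} => // y p /=.
case: (ltnP i (size p)) => le; first by rewrite (nth_map y).
by rewrite !nth_default ?size_map.
Qed.

Lemma index_flatten_gtn (T : eqType) (g : nat -> seq T) (key : T -> nat) us x y :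
    sorted gtn us -> (forall u z, u \in us -> z \in g u -> key z = u) ->
    key x \in us -> key y \in us -> x \in g (key x) -> y \in g (key y) ->
    (key y < key x) || ((key x == key y) && (index x (g (key x)) < index y (g (key x)))) ->
  index x (flatten [seq g u | u <- us]) < index y (flatten [seq g u | u <- us]).
Proof.
elim: us => //= u us IH sus keyE.
have keyE' v z : v \in us -> z \in g v -> key z = v.
  by move=> vus; apply: keyE; rewrite inE vus orbT.
have gt_u v : v \in us -> v < u.
  have : all (gtn u) us.
    by move: sus; rewrite path_sortedE => [/andP[]|a b c /= h1 h2]; last exact: ltn_trans h1.
  by move/allP => h /h.
rewrite !inE => kx ky xg yg lt; rewrite !index_cat.
have [/eqP xu | xu] := boolP (key x == u).
  have xgu : x \in g u by rewrite -xu.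
  rewrite xgu; have [/eqP yu | yu] := boolP (key y == u).
    by move: lt; rewrite -{1}yu xu yu ltnn eqxx -yu yg.
  case: ifP => [ygu | _]; first by rewrite (keyE u y) ?eqxx ?inE ?eqxx in yu.
  by apply: (leq_trans (n := size (g u))); rewrite ?index_mem // leq_addr.
have xus : key x \in us by move: kx; rewrite (negbTE xu).
have yu : key y != u.
  apply: contraTN lt => /eqP ->; rewrite (negbTE xu) orbF -leqNgt.
  exact: ltnW (gt_u _ xus).
have yus : key y \in us by move: ky; rewrite (negbTE yu).
case: ifP => [xgu | _]; first by rewrite (keyE u x) ?eqxx ?inE ?eqxx in xu.
case: ifP => [ygu | _]; first by rewrite (keyE u y) ?eqxx ?inE ?eqxx in yu.
by rewrite ltn_add2l; apply: IH => //; apply: path_sorted sus.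
Qed.

(** The bound for involutions is applied with [s := a], since [a * a = 1] has one orbit per
    point. *)
Lemma card_porbits_ge_half (T : finType) (a : {perm T}) :
  involutive a -> #|T| <= #|porbits a|.*2.+1.
Proof.
move=> aK.
have card1 : #|porbits (1 : {perm T})%g| = #|T|.
  rewrite -cardsT -(card_imset _ (@set1_inj T)); congr #|pred_of_set _|.
  have E : porbit (1 : {perm T})%g =1 set1.
    move=> x; apply/setP => y; rewrite inE.
    apply/porbitP/eqP => [[i ->]|->]; first by rewrite expg1n perm1.
    by exists 0; rewrite expg0 perm1.
  apply/setP => A; apply/imsetP/imsetP => -[x _ ->]; exists x; rewrite ?inE //.
have := @card_porbits_involution T a a (#|T|.+1 %/ 2) aK.
have -> : (a * a = 1)%g by apply/permP => x; rewrite permM aK perm1.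
rewrite card1 => H; have {H} := H _.
have -> : #|[set x | a x != x]| <= (#|T|.+1 %/ 2).*2.
  by apply: leq_trans (max_card _) _; lia.
by move=> /(_ isT); move: #|_| #|_| => i j; lia.
Qed.

Definition nbrs n (e : rel nat) v := [seq w <- iota 0 n | e v w].

(* Drawing the vertices in convex position, in the order of their labels, turns
   such a graph into an outerplanar map; the vertices are then numbered by their
   first visit along the outer face. *)
Record contour_graph n (e : rel nat) : Prop := ContourGraph {
  contour_sym : symmetric e;
  contour_irr : irreflexive e;
  contour_lt : forall i j, e i j -> i < n;
  contour_low : forall i, 0 < i < n -> exists2 j, j < i & e i j;
  contour_noncrossing : forall i j k l,
    i < j -> j < k -> k < l -> e i k -> e j l -> False }.

(* [lab] sends each dart to the label of its origin, [e] being the graph induced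
   on the labels, and [s] runs through the neighbours in cyclic increasing order. *)
Record drawing n (e : rel nat) (T : finType) (s a : {perm T}) (r : T) (lab : T -> nat) : Prop :=
  Drawing {
  drawing_graph : contour_graph n e;
  drawing_invol : involutive a;
  drawing_vertex : forall x y, fconnect s x y = (lab x == lab y);
  drawing_adj : forall x, e (lab x) (lab (a x));
  drawing_onto : forall i j, e i j -> exists2 x, lab x = i & lab (a x) = j;
  drawing_inj : forall x y, lab x = lab y -> lab (a x) = lab (a y) -> x = y;
  drawing_next : forall x, lab (a (s x)) = next (nbrs n e (lab x)) (lab (a x));
  drawing_root : lab r = 0;
  drawing_edge_root : lab (a r) = 1 }.

(** * From an outerplanar map to a noncrossing graph *)

Section OuterLabelling.
Variables (T : finType) (s a : {perm T}) (r : T).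
Hypothesis aK : involutive a.
Hypothesis aN : forall x, a x != x.
Hypothesis planar : #|porbits s| + #|porbits (a * s)%g| = #|porbits a| + 2.
Hypothesis no_loop : forall x, ~~ fconnect s x (a x).
Hypothesis no_multi : forall x y, fconnect s x y -> fconnect s (a x) (a y) -> x = y.
Hypothesis outer : forall x, exists2 d, fconnect s x d & fconnect (a * s)%g r d.

Let phi : {perm T} := (a * s)%g.
Let o j := iter j phi r.
Let L := size (orbit phi r).

(** With [o j] the [j]-th dart along the outer face, these are the times at which the walk meets a
    new vertex. *)
Let ts := [seq j <- iota 0 L | all (fun i => ~~ fconnect s (o j) (o i)) (iota 0 j)].
Let V := size ts.
Let sI : injective s := @perm_inj _ s.
Let sC x y : fconnect s x y = fconnect s y x := fconnect_sym sI x y.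

Definition vertex_label x := find (fun t => fconnect s x (o t)) ts.
Local Notation lab := vertex_label.

Let time x := nth 0 ts (lab x).

Lemma outer_times_sorted : sorted ltn ts.
Proof. by apply: sorted_filter; [exact: ltn_trans|exact: iota_ltn_sorted]. Qed.

Lemma mem_outer_times x : exists2 t, t \in ts & fconnect s x (o t).
Proof.
have ex : exists j, (j < L) && fconnect s x (o j).
  have [d xd rd] := outer x; exists (findex phi r d).
  by rewrite /L size_orbit findex_max //= /o iter_findex.
have [j /andP[jL xj] jmin] := ex_minnP ex.
exists j => //; rewrite mem_filter mem_iota add0n jL /= andbT.
apply/allP => i; rewrite mem_iota add0n /= => ij.
apply/negP => ji; have := jmin i.
by rewrite (connect_trans xj ji) (ltn_trans ij jL) leqNgt ij => /(_ isT).
Qed.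

Lemma outer_times_uniq t t' : t \in ts -> t' \in ts -> fconnect s (o t) (o t') -> t = t'.
Proof.
wlog le_tt' : t t' / t <= t'.
  move=> W tts t'ts c; case/orP: (leq_total t t') => le; first exact: W.
  by apply/esym/W; rewrite // sC.
rewrite !mem_filter => _ /andP[/allP at' _]; rewrite sC => c.
apply/eqP; rewrite eqn_leq le_tt' leqNgt; apply/negP => lt.
by have := at' t; rewrite mem_iota add0n lt c => /(_ isT).
Qed.

Lemma has_label x : has (fun t => fconnect s x (o t)) ts.
Proof. by have [t tts xt] := mem_outer_times x; apply/hasP; exists t. Qed.

Lemma vertex_label_lt x : lab x < V.
Proof. by rewrite -has_find has_label. Qed.

Lemma time_mem x : time x \in ts.
Proof. by apply: mem_nth; apply: vertex_label_lt. Qed.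

Lemma time_connect x : fconnect s x (o (time x)).
Proof. exact: nth_find (has_label x). Qed.

Lemma time_uniq x t : t \in ts -> fconnect s x (o t) -> time x = t.
Proof.
move=> tts xt; apply: outer_times_uniq (time_mem x) tts _.
by apply: connect_trans xt; rewrite sC time_connect.
Qed.

Lemma uniq_times : uniq ts.
Proof. exact: sorted_uniq ltn_trans ltnn _ outer_times_sorted. Qed.

Lemma vertex_labelE x : lab x = index (time x) ts.
Proof. by rewrite index_uniq ?uniq_times // vertex_label_lt. Qed.

Lemma ltn_time x y : (time x < time y) = (lab x < lab y).
Proof.
apply/idP/idP => [lt|lt]; last first.
  by apply: (sorted_ltn_nth ltn_trans) => //; rewrite ?inE ?vertex_label_lt ?outer_times_sorted.
rewrite ltnNge; apply/negP => le; move: lt; apply/negP; rewrite -leqNgt.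
have := sorted_leq_nth leq_trans leqnn 0 (sub_sorted (fun i j => @ltnW i j) outer_times_sorted).
by apply; rewrite ?inE ?vertex_label_lt.
Qed.

Lemma vertex_label_eq x y : (lab x == lab y) = fconnect s x y.
Proof.
apply/eqP/idP => [E | c].
  apply: connect_trans (time_connect x) _.
  by rewrite /time E sC time_connect.
by apply: eq_find => t; apply: (same_connect (fconnect_sym sI)).
Qed.

Lemma vertex_label_surj i : i < V -> exists2 t, t \in ts & lab (o t) = i.
Proof.
move=> iV; exists (nth 0 ts i); first exact: mem_nth.
rewrite vertex_labelE (@time_uniq _ (nth 0 ts i)) ?mem_nth // ?connect0 //.
by rewrite index_uniq ?uniq_times.
Qed.

Lemma L_gt0 : 0 < L.
Proof. by rewrite /L size_orbit order_gt0. Qed.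

Lemma mem0_times : 0 \in ts.
Proof. by rewrite mem_filter mem_iota L_gt0. Qed.

Lemma times_cons : ts = 0 :: behead ts.
Proof.
have := mem0_times; have := outer_times_sorted.
case: ts => //= t us; rewrite path_sortedE; last exact: ltn_trans.
by move=> /andP[/allP h _]; rewrite inE => /orP[/eqP -> // | /h].
Qed.

Lemma vertex_label_root : lab r = 0.
Proof. by rewrite vertex_labelE (@time_uniq _ 0) ?mem0_times ?connect0 // times_cons. Qed.

Lemma time_outer j : j < L -> time (o j) <= j.
Proof.
elim/ltn_ind: j => j IH jL.
have [jts|] := boolP (j \in ts); first by rewrite (@time_uniq _ j) ?connect0.
rewrite mem_filter mem_iota add0n jL /= andbT -has_predC => /hasP[i].
rewrite mem_iota add0n /= negbK => ij c.
rewrite (@time_uniq _ (time (o i))) ?time_mem //; last first.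
  exact: connect_trans c (time_connect _).
by apply: leq_trans (IH i ij (ltn_trans ij jL)) (ltnW ij).
Qed.

Lemma V_card : V = #|porbits s|.
Proof.
have Um : uniq [seq porbit s (o t) | t <- ts].
  rewrite map_inj_in_uniq ?uniq_times // => t t' tts t'ts E.
  apply: outer_times_uniq => //.
  by rewrite -mem_porbit_fconnect E porbit_id.
rewrite /V -(size_map (fun t => porbit s (o t))) -(card_uniqP Um); apply: eq_card => A.
apply/mapP/imsetP => [[t _ ->]|[x _ ->]]; first by exists (o t).
exists (time x); first exact: time_mem.
by apply/eqP; rewrite eq_porbit_mem mem_porbit_fconnect sC time_connect.
Qed.

Let tr t := orbit s (o t).
(** Up to rotation, the cycle produced by the star. The vertices come in decreasing order because
    the same product of transpositions must also split the outer face, and [card_porbits_splits]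
    cuts at decreasing positions. *)
Let lst := flatten [seq tr t | t <- rev ts].

Lemma tr_head t : tr t = o t :: behead (tr t).
Proof. by rewrite /tr /orbit -orderSpred. Qed.

Lemma mem_tr t x : t \in ts -> (x \in tr t) = (time x == t).
Proof.
move=> tts; rewrite /tr -fconnect_orbit; apply/idP/eqP => [c|<-].
  by rewrite (@time_uniq _ t) // sC.
by rewrite sC time_connect.
Qed.

Lemma mem_lst x : x \in lst.
Proof.
apply/flattenP; exists (tr (time x)); last by rewrite mem_tr ?time_mem.
by apply: map_f; rewrite mem_rev time_mem.
Qed.

Lemma uniq_flatten_tr us : uniq us -> {subset us <= ts} ->
  uniq (flatten [seq tr t | t <- us]).
Proof.
elim: us => //= t us IH /andP[tus Uus] sub.
rewrite cat_uniq orbit_uniq IH // => [|u uus]; last by rewrite sub // inE uus orbT.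
rewrite andbT; apply/hasPn => x /flattenP[q /mapP[u uus ->]].
rewrite !mem_tr ?sub ?inE ?uus ?eqxx ?orbT // => /eqP ->.
by apply: contra tus => /eqP <-.
Qed.

Let us := rev (behead ts).

Lemma us_sub : {subset us <= ts}.
Proof. by move=> t; rewrite mem_rev => /mem_behead. Qed.

(* The star joining [r] to every other vertex inside the outer face merges the
   rotations at the vertices into one cycle, and each of its edges cuts off a
   new face. *)
Lemma star_cycle_planar :
  exists p : {perm T}, fcycle p lst /\ #|T| < (#|porbits (a * p)%g|).*2.
Proof.
pose c := (\prod_(t <- us) tperm r (o t))%g.
have Uus : uniq us by rewrite rev_uniq; move: uniq_times; rewrite times_cons => /andP[].
exists (s * c)%g; split.
  have -> : lst = rot (size (tr 0)) (tr 0 ++ flatten [seq tr t | t <- us]).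
    rewrite /lst [in rev ts]times_cons rev_cons -/us map_rcons flatten_rcons.
    by rewrite rot_size_cat.
  rewrite rot_cycle.
  have := @fcycle_merges T s r (behead (tr 0)) [seq tr t | t <- us].
  rewrite big_map -[r]/(o 0) -tr_head => H.
  have -> : c = (\prod_(j <- us) tperm (o 0) (head (o 0) (tr j)))%g.
    by apply: eq_bigr => t _; rewrite tr_head.
  apply: H.
  - rewrite cat_uniq orbit_uniq uniq_flatten_tr ?andbT //; last exact: us_sub.
    apply/hasPn => x /flattenP[q /mapP[u uus ->]].
    rewrite !mem_tr ?mem0_times ?us_sub // => /eqP ->.
    apply: contraTneq uus => ->; rewrite mem_rev.
    by move: uniq_times; rewrite times_cons => /andP[].
  - by apply/allP => q /mapP[u _ ->]; apply: cycle_orbit.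
  - by apply/mapP => -[u _]; rewrite tr_head.
  - exact: cycle_orbit.
have Eo : orbit phi r = r :: behead (orbit phi r) by rewrite /orbit -orderSpred.
have := @card_porbits_splits T phi r (behead (orbit phi r)) us.
rewrite -Eo => H.
have Ec : c = (\prod_(t <- us) tperm r (nth r (orbit phi r) t))%g.
  apply: eq_big_seq => t /us_sub; rewrite mem_filter mem_iota => /andP[_ /andP[_ tL]].
  by rewrite /orbit nth_traject // -size_orbit.
rewrite mulgA Ec H ?orbit_uniq //; last first.
- apply/allP => t tus; have := us_sub tus; rewrite mem_filter mem_iota => /andP[_ /andP[_ ->]].
  rewrite andbT lt0n; apply: contraTneq tus => ->; rewrite mem_rev.
  by move: uniq_times; rewrite times_cons => /andP[].
- rewrite rev_sorted; move: outer_times_sorted; rewrite times_cons => /path_sorted.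
  by apply: sub_sorted.
- exact: cycle_orbit (@perm_inj _ phi) _.
(* With [E] edges and [F] faces, Euler's formula gives [F + (V - 1) = E + 1], while there are at
   most [2 * E + 1] darts. *)
have := card_porbits_ge_half aK; have := V_card.
have : #|porbits s| + #|porbits phi| = #|porbits a| + 2 by exact: planar.
rewrite /us size_rev size_behead -/V.
have : 0 < V by rewrite /V times_cons.
move: #|T| #|porbits s| #|porbits a| #|porbits phi| (V) => ? ? ? ? ?.
clear; lia.
Qed.

Lemma outer_noncrossing x y :
  ~ [/\ index x lst < index y lst, index y lst < index (a x) lst &
        index (a x) lst < index (a y) lst].
Proof.
have [p [cp pp]] := star_cycle_planar.
move=> [h1 h2 h3].
apply: (@planar_involution_noncrossing T a p lst x y aK aN cp _ mem_lst pp).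
  by apply: uniq_flatten_tr; rewrite ?rev_uniq ?uniq_times // => t; rewrite mem_rev.
by rewrite h1 h2 h3.
Qed.

Lemma index_lst x y :
    (lab y < lab x) || (fconnect s x y && (index x (tr (time x)) < index y (tr (time x)))) ->
  index x lst < index y lst.
Proof.
move=> H; apply: (@index_flatten_gtn _ tr time).
- rewrite rev_sorted; exact: sub_sorted outer_times_sorted.
- by move=> t z; rewrite mem_rev => tts; rewrite mem_tr // => /eqP.
- by rewrite mem_rev time_mem.
- by rewrite mem_rev time_mem.
- by rewrite mem_tr ?time_mem.
- by rewrite mem_tr ?time_mem.
rewrite ltn_time; move: H; rewrite -vertex_label_eq; case: ltngtP => //= E.
by rewrite /time E eqxx.
Qed.

Definition label_adj : rel nat := fun i j => [exists x, (lab x == i) && (lab (a x) == j)].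

Lemma label_adjP i j : reflect (exists x, lab x = i /\ lab (a x) = j) (label_adj i j).
Proof.
apply: (iffP existsP) => [[x /andP[/eqP <- /eqP <-]]|[x [<- <-]]]; exists x => //.
by rewrite !eqxx.
Qed.

Lemma index_lst_label x y : lab y < lab x -> index x lst < index y lst.
Proof. by move=> lt; apply: index_lst; rewrite lt. Qed.

Lemma lab_neq x : lab x != lab (a x).
Proof. by rewrite vertex_label_eq no_loop. Qed.

(** The dart just before a first visit leaves a vertex met earlier and ends at the new one, which
    gives the smaller neighbour. Crossing labels would give crossing positions in [lst], where the
    order of the labels is reversed, hence the passage to [a y] and [a x]. *)
Lemma label_adj_contour : contour_graph V label_adj.
Proof.
split.
- have E i j : label_adj i j -> label_adj j i.
    by move/label_adjP => [x [<- <-]]; apply/label_adjP; exists (a x); rewrite aK.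
  by move=> i j; apply/idP/idP; apply: E.
- move=> i; apply/label_adjP => -[x [<- /eqP]].
  by rewrite eq_sym (negbTE (lab_neq x)).
- by move=> i j /label_adjP[x [<- _]]; apply: vertex_label_lt.
- move=> i /andP[i0 iV]; have [[|t] tts E] := vertex_label_surj iV.
    by move: i0; rewrite -E vertex_label_root.
  exists (lab (o t)).
    rewrite -E -ltn_time (@time_uniq (o t.+1) t.+1) ?connect0 // ltnS.
    apply: time_outer; move: tts; rewrite mem_filter mem_iota add0n => /andP[_ /andP[_]].
    exact: ltnW.
  apply/label_adjP; exists (a (o t)); rewrite aK; split => //; rewrite -E.
  apply/eqP; rewrite vertex_label_eq /o iterS permM; exact: fconnect1.
move=> i j k l ij jk kl /label_adjP[x [Ei Ek]] /label_adjP[y [Ej El]].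
apply: (@outer_noncrossing (a y) (a x)); rewrite !aK; split; apply: index_lst_label; lia.
Qed.

Lemma label_pair_inj x y : lab x = lab y -> lab (a x) = lab (a y) -> x = y.
Proof.
by move=> /eqP + /eqP; rewrite !vertex_label_eq; apply: no_multi.
Qed.

(** In the rotation at [v], started at the dart of its first visit, the larger neighbours precede
    the smaller ones and each group increases, since any other order produces a crossing in [lst].
    The result is a rotation of the sorted list of neighbours, and [next] is insensitive to
    rotation. *)
Lemma label_next x :
  lab (a (s x)) = next (nbrs V label_adj (lab x)) (lab (a x)).
Proof.
set v := lab x; pose h y := lab (a y); pose p := tr (time x).
have xp : x \in p by rewrite mem_tr ?time_mem.
have mem_p y : (y \in p) = (lab y == v).
  rewrite mem_tr ?time_mem //.
  by apply/eqP/eqP => E; [rewrite /v !vertex_labelE E | rewrite /time E].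
have lt_idx y z : y \in p -> z \in p -> index y p < index z p -> index y lst < index z lst.
  move=> yp zp lt; apply: index_lst; rewrite -(vertex_label_eq y z).
  move: yp zp; rewrite !mem_p => /eqP Ey /eqP Ez; rewrite Ey Ez eqxx ltnn /=.
  by rewrite /time Ey -/v -/(time x).
(* [key] unrolls the cyclic order of the labels from just after [v]; [B1], [B2] and [B3] exclude the
   three ways in which it could fail to increase. *)
pose key w := if v < w then w else w + V.
have key_lt y z : y \in p -> z \in p -> index y p < index z p -> key (h y) < key (h z).
  move=> yp zp lt; have iyz := lt_idx _ _ yp zp lt.
  have := lab_neq y; have := lab_neq z.
  move: (yp) (zp); rewrite !mem_p => /eqP Ey /eqP Ez; rewrite Ey Ez => hz hy.
  have hyz : h y != h z.
    apply: contraTneq lt => E; rewrite (_ : y = z) ?ltnn //.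
    by apply: label_pair_inj; rewrite ?Ey ?Ez.
  have hyV : h y < V := vertex_label_lt _.
  have hzV : h z < V := vertex_label_lt _.
  have B1 : h z < h y -> v < h z -> False.
    move=> h1 h2; apply: (@outer_noncrossing (a y) (a z)); rewrite !aK.
    by split=> //; apply: index_lst_label; rewrite ?Ey.
  have B2 : h z < h y -> h y < v -> False.
    move=> h1 h2; apply: (@outer_noncrossing y z).
    by split=> //; apply: index_lst_label; rewrite ?Ez.
  have B3 : h y < v -> v < h z -> False.
    move=> h1 h2; apply: (@outer_noncrossing (a z) y); rewrite !aK.
    by split=> //; apply: index_lst_label; rewrite ?Ez ?Ey.
  move: B1 B2 B3 hz hy hyz hyV hzV; rewrite /key -/(h y) -/(h z).
  clear; move: (h y) (h z) v (V) => i j k n.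
  case: (ltngtP k i) => ki; case: (ltngtP k j) => kj //; case: (ltngtP i j) => ij //=;
    move=> B1 B2 B3 _ _ _ iV jV;
    by [ case: (B1 _ _) | case: (B2 _ _) | case: (B3 _ _) | lia ].
have sorted_p : sorted (relpre key ltn) (map h p).
  rewrite sorted_map sorted_pairwise; last by move=> ? ? ?; apply: ltn_trans.
  have Up : uniq p := orbit_uniq _ _.
  apply/(pairwiseP x) => i j; rewrite !inE => ip jp ij.
  by apply: key_lt; rewrite ?mem_nth ?index_uniq.
pose q := [seq w <- iota 0 V | label_adj v w & w < v] ++
          [seq w <- iota 0 V | label_adj v w & v < w].
have nbrsE : nbrs V label_adj v = q.
  apply: (irr_sorted_eq ltn_trans ltnn).
  - by apply: sorted_filter; [exact: ltn_trans|exact: iota_ltn_sorted].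
  - rewrite sorted_pairwise ?pairwise_cat; last exact: ltn_trans.
    rewrite -!sorted_pairwise; try exact: ltn_trans.
    rewrite !sorted_filter ?iota_ltn_sorted //; try exact: ltn_trans.
    rewrite !andbT; apply/allrelP => i j; rewrite !mem_filter.
    move=> /andP[/andP[_ h1] _] /andP[/andP[_ h2] _]; exact: ltn_trans h1 h2.
  move=> w; rewrite mem_cat !mem_filter -andb_orl -andb_orr -neq_ltn.
  case: (label_adjP v w) => // -[y [Ey Ew]] /=.
  by have := lab_neq y; rewrite Ey Ew eq_sym => ->.
have hpE : map h p = rot (size [seq w <- iota 0 V | label_adj v w & w < v]) q.
  rewrite rot_size_cat.
  apply: (@irr_sorted_eq _ (relpre key ltn)) => //.
  - by move=> ? ? ?; apply: ltn_trans.
  - by move=> ?; apply: ltnn.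
  - have tr' : transitive (relpre key ltn) by move=> ? ? ?; apply: ltn_trans.
    rewrite sorted_pairwise // pairwise_cat; apply/and3P; split.
    + apply/allrelP => i j; rewrite !mem_filter /key mem_iota.
      move=> /andP[/andP[_ h1] h1'] /andP[/andP[_ h2] _].
      by rewrite /= h1 [v < j]ltnNge (ltnW h2) /= ltn_addl //; case/andP: h1'.
    + apply: (sub_in_pairwise (P := [pred w | v < w]) (r := ltn)).
      * by move=> i j; rewrite !inE /key /= => -> ->.
      * by apply/allP => w; rewrite mem_filter => /andP[/andP[]].
      rewrite -sorted_pairwise; last exact: ltn_trans.
      by rewrite sorted_filter ?iota_ltn_sorted //; exact: ltn_trans.
    apply: (sub_in_pairwise (P := [pred w | w < v]) (r := ltn)).
    + by move=> i j; rewrite !inE /key /= => h1 h2; rewrite !ltnNge !(ltnW h1) (ltnW h2) /= -!ltnNge ltn_add2r.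
    + by apply/allP => w; rewrite mem_filter => /andP[/andP[]].
    rewrite -sorted_pairwise; last exact: ltn_trans.
    by rewrite sorted_filter ?iota_ltn_sorted //; exact: ltn_trans.
  move=> w; rewrite mem_cat !mem_filter -andb_orl -andb_orr orbC -neq_ltn.
  apply/mapP/idP => [[y yp ->]|].
    rewrite mem_iota vertex_label_lt /= andbT.
    move: yp; rewrite mem_p => /eqP Ey; rewrite -[X in _ && (_ != X)]Ey eq_sym lab_neq andbT.
    by apply/label_adjP; exists y.
  move=> /andP[/andP[/label_adjP[y [Ey Ew]] _] _]; exists y => //.
  by rewrite mem_p Ey.
have Uhp : uniq (map h p).
  by apply: (sorted_uniq _ _ sorted_p) => [? ? ?|?]; [apply: ltn_trans|rewrite /= ltnn].
have Uq : uniq q by move: Uhp; rewrite hpE rot_uniq.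
rewrite nbrsE -(next_rot (size [seq w <- iota 0 V | label_adj v w & w < v]) Uq) -hpE.
by rewrite (next_map_uniq Uhp xp) /h (nextE (cycle_orbit sI _) xp).
Qed.

Lemma label_edge_root : lab (a r) = 1.
Proof.
have o1 : o 1 = s (a r) by rewrite /o /= permM.
have c1 : fconnect s (a r) (o 1) by rewrite o1 fconnect1.
have nc : ~~ fconnect s (o 1) r.
  by apply: contra (no_loop r) => c; rewrite sC (connect_trans c1).
have L1 : 1 < L.
  rewrite ltnNge; apply: contra nc => L1.
  have /eqP E : L == 1 by rewrite eqn_leq L1 L_gt0.
  have := cycle_orbit (@perm_inj _ phi) r; move: E; rewrite /L /orbit size_traject => ->.
  by rewrite /= andbT => /eqP E; rewrite /o /= E connect0.
have ts1 : 1 \in ts by rewrite mem_filter mem_iota L1 /= nc.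
rewrite vertex_labelE (@time_uniq _ 1) //.
move: outer_times_sorted ts1; rewrite times_cons; case: (behead ts) => //= t us'.
rewrite inE /= path_sortedE => [|? ? ?]; last exact: ltn_trans.
move=> /and3P[t0 /allP all_t _]; rewrite inE => /orP[/eqP <- //|].
by move/all_t => /=; case: t t0 {all_t} => [|[]].
Qed.

Theorem outer_drawing : drawing #|porbits s| label_adj s a r vertex_label.
Proof.
rewrite -V_card; split.
- exact: label_adj_contour.
- exact: aK.
- by move=> x y; rewrite vertex_label_eq.
- by move=> x; apply/label_adjP; exists x.
- by move=> i j /label_adjP[x [<- <-]]; exists x.
- exact: label_pair_inj.
- exact: label_next.
- exact: vertex_label_root.
- exact: label_edge_root.
Qed.

End OuterLabelling.

(** * Faces in the convex drawing of a noncrossing graph *)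

Section ConvexDrawing.
Variables (n : nat) (e : rel nat).
Hypothesis G : contour_graph n e.

Let eS : symmetric e := contour_sym G.
Let eI i : e i i = false := contour_irr G i.
Let eX := contour_noncrossing G.
Let eL i j (h : e i j) : i < n := contour_lt G h.

Lemma adj_ltr i j : e i j -> j < n.
Proof. by rewrite eS; apply: eL. Qed.

Local Notation nbr := (nbrs n e).
Local Notation nxt v u := (next (nbr v) u).

Lemma mem_nbrs v u : (u \in nbr v) = e v u.
Proof.
rewrite mem_filter mem_iota add0n /=.
by case H: (e v u) => //; rewrite (adj_ltr H).
Qed.

Lemma uniq_nbrs v : uniq (nbr v).
Proof. exact: filter_uniq (iota_uniq _ _). Qed.

Lemma sorted_nbrs v : sorted ltn (nbr v).
Proof. by apply: sorted_filter; [exact: ltn_trans|exact: iota_ltn_sorted]. Qed.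

Lemma adj_next v u : e v u -> e v (nxt v u).
Proof. by rewrite -!mem_nbrs mem_next. Qed.

Lemma next_nbrs_nth v u : e v u ->
  nxt v u = if (index u (nbr v)).+1 < size (nbr v)
            then nth 0 (nbr v) (index u (nbr v)).+1 else nth 0 (nbr v) 0.
Proof.
rewrite -mem_nbrs next_nth => uv; rewrite uv; move: (index u _) => i.
case: (nbr v) uv => //= y p _; rewrite ltnS; case: ltnP => le.
  by apply: set_nth_default.
by rewrite nth_default.
Qed.

Lemma nth_nbrs_mono v i j : j < size (nbr v) -> i <= j ->
  nth 0 (nbr v) i <= nth 0 (nbr v) j.
Proof.
move=> jn ij; have := sorted_leq_nth leq_trans leqnn 0 (sub_sorted (fun i j => @ltnW i j) (sorted_nbrs v)).
by apply; rewrite ?inE // (leq_ltn_trans ij).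
Qed.

Lemma nth_nbrs_smono v i j : j < size (nbr v) -> i < j ->
  nth 0 (nbr v) i < nth 0 (nbr v) j.
Proof.
move=> jn ij; have := sorted_ltn_nth ltn_trans 0 (sorted_nbrs v).
by apply; rewrite ?inE // (ltn_trans ij).
Qed.

Lemma next_larger v u w : e v u -> e v w -> u < w -> u < nxt v u <= w.
Proof.
move=> eu ew uw; rewrite next_nbrs_nth //.
have iu := nth_index 0 (etrans (mem_nbrs v u) eu).
have iw := nth_index 0 (etrans (mem_nbrs v w) ew).
have lu : index u (nbr v) < size (nbr v) by rewrite index_mem mem_nbrs.
have lw : index w (nbr v) < size (nbr v) by rewrite index_mem mem_nbrs.
have lt : index u (nbr v) < index w (nbr v).
  rewrite ltnNge; apply/negP => /(nth_nbrs_mono lu).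
  by rewrite iu iw leqNgt uw.
have lt' := leq_ltn_trans lt lw.
rewrite lt'; have := nth_nbrs_smono lt' (ltnSn _); rewrite iu => -> /=.
by have := nth_nbrs_mono lw lt; rewrite iw.
Qed.

Lemma next_largest v u : e v u -> (forall w, e v w -> w <= u) ->
  forall w, e v w -> nxt v u <= w.
Proof.
move=> eu maxu w ew; rewrite next_nbrs_nth //.
have lu : index u (nbr v) < size (nbr v) by rewrite index_mem mem_nbrs.
have iu := nth_index 0 (etrans (mem_nbrs v u) eu).
have iw := nth_index 0 (etrans (mem_nbrs v w) ew).
case: ifP => [lt|_].
  have := nth_nbrs_smono lt (ltnSn _); rewrite iu ltnNge maxu //.
  by rewrite -mem_nbrs mem_nth.
by rewrite -[leqRHS]iw nth_nbrs_mono // index_mem mem_nbrs.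
Qed.

(** The face permutation, seen on pairs made of the labels of the origin and of the end of a
    dart. *)
Definition face_step (d : nat * nat) := (d.2, nxt d.2 d.1).

(** These ascents, one for each positive [w], turn out to be those lying on the outer face. *)
Definition max_low u w := [/\ u < w, e u w & forall z, u < z < w -> ~~ e w z].

Let descents_to k (d d' : nat * nat) :=
  iter k face_step d = d' /\ forall i, i < k -> (iter i face_step d).2 < (iter i face_step d).1 <= d.1.

Lemma descents_toS k d d' : d.2 < d.1 -> descents_to k (face_step d) d' ->
  descents_to k.+1 d d'.
Proof.
move=> lt [H1 H2]; split; first by rewrite iterSr.
case=> [_|i]; first by rewrite /= lt leqnn.
rewrite ltnS iterSr => /H2/andP[-> /= h]; apply: leq_trans h _; exact: ltnW lt.
Qed.

(** Serves to count the inner faces by their ascents. After [w] the face only descends until it is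
    back at [u]: a vertex met on the way has no neighbour beyond the previous one, by the
    noncrossing condition, so its next neighbour is its least one. *)
Lemma inner_face u w : u < w -> e u w -> ~ max_low u w ->
  exists k, descents_to k (face_step (u, w)) (u, w).
Proof.
move=> uw euw nmax.
have [z /andP[uz zw] ewz] : exists2 z, u < z < w & e w z.
  case: (pickP (fun z : 'I_w => (u < z) && e w z)) => [z /andP[uz ez]|none].
    by exists z; rewrite ?uz ?ltn_ord.
  case: nmax; split=> // z /andP[uz zw].
  by have := none (Ordinal zw); rewrite /= uz /= => ->.
have ewu : e w u by rewrite eS.
have /andP[lt1 le1] := next_larger ewu ewz uz.
(* Invariant for the current descent from [p] to [q]: no vertex strictly between [u] and [p] is
   joined beyond [p]; [q] is the least neighbour of [p], for [p = w] only among those above [u]; and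
   [u] has no neighbour strictly between [p] and [w]. *)
suff chain q : forall p, e p q -> u <= q -> q < p -> p <= w ->
    (forall x y, u < x < p -> p < y -> ~ e x y) ->
    (forall x, e p x -> (u < x) || (p < w) -> q <= x) ->
    (q = u -> p < w) -> (forall y, e u y -> p < y -> w <= y) ->
    exists k, descents_to k (p, q) (u, w).
  apply: (chain (nxt w u) w) => //.
  - exact: adj_next.
  - exact: ltnW.
  - exact: leq_ltn_trans zw.
  - by move=> x y /andP[ux xw] wy exy; apply: (@eX u x w y).
  - move=> x ewx; rewrite ltnn orbF => ux.
    by case/andP: (next_larger ewu ewx ux).
  - by move=> E; rewrite E ltnn in lt1.
  - by move=> y _ /ltnW.
elim/ltn_ind: q => q IH p epq uq qp pw H2 H3 H4 H5.
have eqp : e q p by rewrite eS.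
move: uq; rewrite leq_eqVlt => /orP[/eqP uq|uq].
  have pw' := H4 (esym uq); rewrite -uq in epq qp eqp *.
  exists 1; split; last by case=> //= _; rewrite qp leqnn.
  rewrite /= /face_step /=; congr pair; apply/eqP; rewrite eqn_leq.
  have /andP[lt2 ->] := next_larger eqp euw pw' => /=.
  by apply: H5 => //; apply: adj_next.
have q_max y : e q y -> y <= p.
  by move=> eqy; rewrite leqNgt; apply/negP => py; apply: (H2 q y); rewrite ?uq.
have qw : q < w := leq_trans qp pw.
have [l lq eql] : exists2 l, l < q & e q l.
  by apply: (contour_low G); rewrite (leq_ltn_trans _ uq) //= (eL eqp).
have r_min := next_largest eqp q_max.
have eqr := adj_next eqp.
have rq : nxt q p < q by apply: leq_ltn_trans lq; apply: r_min.
have ur : u <= nxt q p.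
  rewrite leqNgt; apply/negP => ru; apply: (@eX (nxt q p) u q w) => //.
  by rewrite eS.
have [k Hk] : exists k, descents_to k (q, nxt q p) (u, w).
  apply: (IH _ rq q eqr ur rq (ltnW qw)).
- move=> x y /andP[ux xq] qy exy.
  have xp : x < p := ltn_trans xq qp.
  case: (ltngtP y p) => yp.
  + exact: (@eX x q y p).
  + by apply: (H2 x y) => //; rewrite ux.
  have := H3 x; rewrite ux -yp eS exy => /(_ isT isT).
  by rewrite leqNgt xq.
- by move=> x eqx _; apply: r_min.
- by [].
- move=> y euy qy; case: (ltngtP y p) => yp.
  + by case: (@eX u q y p).
  + exact: H5.
  rewrite leqNgt; apply/negP => yw.
  have := H3 u; rewrite -yp eS euy yw orbT => /(_ isT isT).
  by rewrite leqNgt uq.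
by exists k.+1; apply: descents_toS.
Qed.

(** The induction step for first visits: from [w] the outer face descends to the first vertex joined
    to [w.+1] and climbs there. The vertices passed on the way have no neighbour beyond [w], and the
    noncrossing condition prevents the walk from climbing earlier. *)
Lemma outer_face_step u w : max_low u w -> w.+1 < n ->
  exists u' k, max_low u' w.+1 /\ descents_to k (face_step (u, w)) (u', w.+1).
Proof.
move=> [uw euw low_w] wn.
have ewu : e w u by rewrite eS.
have [x0 x0w ex0] : exists2 x, x < w.+1 & e w.+1 x by apply: (contour_low G).
have ex0' : e x0 w.+1 by rewrite eS.
case: (pickP (fun y : 'I_n => (w < y) && e w y)) => [y /andP[wy ewy]|none].
  have eww : e w w.+1.
    move: wy; rewrite leq_eqVlt => /orP[/eqP -> //|wy].
    move: x0w; rewrite ltnS leq_eqVlt => /orP[/eqP E|x0w]; first by rewrite -{1}E.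
    by case: (@eX x0 w w.+1 y).
  exists w, 0; split.
    by split=> // z /andP[h1]; rewrite ltnS leqNgt h1.
  split=> //=; congr pair; apply/eqP; rewrite eqn_leq.
  have /andP[h1 ->] := next_larger ewu eww (ltn_trans uw (ltnSn w)).
  rewrite /= ltnNge leq_eqVlt; apply/norP; split.
    by apply: contraTneq (adj_next ewu) => ->; rewrite eI.
  by apply: contraTN (adj_next ewu) => h2; apply: low_w; rewrite h1.
have w_max y : e w y -> y < w.
  move=> ewy; case: (ltngtP y w) => // [wy|E]; last by rewrite E eI in ewy.
  by have := none (Ordinal (adj_ltr ewy)); rewrite /= wy ewy.
have u_max y : e w y -> y <= u.
  move=> ewy; rewrite leqNgt; apply: contraL ewy => uy.
  by apply/negP => ewy; have := low_w y; rewrite uy w_max // ewy => /(_ isT).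
have r_min := next_largest ewu u_max.
(* Invariant for the current descent from [p] to [q]: the vertices from [p] to [w] have no neighbour
   beyond [w], those below [p] have none strictly above [p] and up to [w], and [q] is the least
   neighbour of [p]. *)
suff chain q : forall p, e p q -> q < p -> p <= w ->
    (forall x y, p <= x <= w -> w < y -> ~ e x y) ->
    (forall x y, x < p -> p < y <= w -> ~ e x y) ->
    (forall x, e p x -> q <= x) ->
    exists u' k, max_low u' w.+1 /\ descents_to k (p, q) (u', w.+1).
  apply: (chain (nxt w u) w) => //.
  - exact: adj_next.
  - by apply: leq_ltn_trans uw; apply: r_min.
  - move=> x y; rewrite -eqn_leq => /eqP <- wy /w_max.
    by rewrite ltnNge ltnW.
  - by move=> x y _ /andP[h1]; rewrite leqNgt h1.
elim/ltn_ind: q => q IH p epq qp pw HA HB HC.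
have eqp : e q p by rewrite eS.
have HX x y : q < x < p -> p < y -> ~ e x y.
  by move=> /andP[qx xp] py exy; apply: (@eX q x p y).
case: (pickP (fun y : 'I_n => (w < y) && e q y)) => [y /andP[wy eqy]|none'].
  have eqw : e q w.+1.
    move: wy; rewrite leq_eqVlt => /orP[/eqP -> //|wy].
    have qw : q < w.+1 by apply: leq_trans qp _; apply: ltnW.
    case: (ltngtP x0 q) => [x0q|qx0|E]; last by rewrite -E.
      by case: (@eX x0 q w.+1 y).
    case: (ltnP x0 p) => x0p.
      by case: (HX x0 w.+1); rewrite ?qx0.
    by case: (HA x0 w.+1); rewrite ?x0p.
  exists q, 1; split.
    split; rewrite ?(leq_trans qp (leqW pw)) // => z /andP[qz zw]; apply/negP => ez.
    rewrite eS in ez; case: (ltnP z p) => zp.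
      by apply: (HX z w.+1) ez; rewrite ?qz.
    by apply: (HA z w.+1) ez; rewrite // zp.
  split; last by case=> //= _; rewrite qp leqnn.
  rewrite /= /face_step /=; congr pair; apply/eqP; rewrite eqn_leq.
  have /andP[h1 ->] : p < nxt q p <= w.+1.
    by apply: next_larger.
  rewrite /= ltnNge; apply/negP => h2.
  by apply: (HB q (nxt q p)); rewrite ?h1 ?adj_next.
have q_max y : e q y -> y <= p.
  move=> eqy; rewrite leqNgt; apply/negP => py.
  have := none' (Ordinal (adj_ltr eqy)); rewrite /= eqy andbT ltnNge.
  by case: leqP => // yw _; apply: (HB q y); rewrite // py.
have q_max' y : w < y -> ~ e q y.
  by move=> wy eqy; have := none' (Ordinal (adj_ltr eqy)); rewrite /= eqy wy.
have HA' x y : q <= x <= w -> w < y -> ~ e x y.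
  move=> /andP[qx xw] wy; move: qx; rewrite leq_eqVlt => /orP[/eqP <-|qx].
    exact: q_max'.
  case: (ltnP x p) => xp; last by apply: HA => //; rewrite xp.
  by apply: HX; rewrite ?qx // (leq_ltn_trans pw).
have r_min' := next_largest eqp q_max.
have [l lq eql] : exists2 l, l < q & e q l.
  apply: (contour_low G); rewrite (eL eqp) andbT lt0n; apply/eqP => q0.
  by apply: (HA' x0 w.+1) => //; rewrite q0.
have eqr := adj_next eqp.
have rq : nxt q p < q by apply: leq_ltn_trans lq; apply: r_min'.
have [u' [k [Hm Hk]]] : exists u' k, max_low u' w.+1 /\ descents_to k (q, nxt q p) (u', w.+1).
  apply: (IH _ rq q eqr rq (leq_trans (ltnW qp) pw) HA' _ r_min').
  move=> x y xq /andP[qy yw] exy; case: (ltngtP y p) => yp.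
  + exact: (@eX x q y p).
  + by apply: (HB x y) => //; rewrite ?yp // (ltn_trans xq).
  by have := HC x; rewrite -yp eS exy leqNgt xq => /(_ isT).
by exists u', k.+1; split=> //; apply: descents_toS.
Qed.

End ConvexDrawing.

(** * Drawings are connected, planar and outerplanar *)

Section Drawing.
Variables (n : nat) (e : rel nat) (T : finType) (s a : {perm T}) (r : T) (lab : T -> nat).
Hypothesis D : drawing n e s a r lab.

Let G := drawing_graph D.
Let aK : involutive a := drawing_invol D.
Let phi : {perm T} := (a * s)%g.
Let pr x := (lab x, lab (a x)).
Let eI i : e i i = false := contour_irr G i.

Lemma drawing_lt x : lab x < n.
Proof. by apply: (contour_lt G); apply: (drawing_adj D). Qed.

Lemma drawing_gt1 : 1 < n.
Proof. by rewrite -(drawing_edge_root D) drawing_lt. Qed.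

Lemma drawing_node x : lab (s x) = lab x.
Proof. by apply/esym/eqP; rewrite -(drawing_vertex D) fconnect1. Qed.

Lemma drawing_pair_inj x y : pr x = pr y -> x = y.
Proof. by case; apply: (drawing_inj D). Qed.

Lemma drawing_face x : pr (phi x) = face_step n e (pr x).
Proof. by rewrite /pr /phi permM drawing_node (drawing_next D) aK. Qed.

Lemma drawing_face_tail x : lab (phi x) = lab (a x).
Proof. by case: (drawing_face x). Qed.

Lemma drawing_iter_face k x : pr (iter k phi x) = iter k (face_step n e) (pr x).
Proof. by elim: k => //= k <-; rewrite drawing_face. Qed.

Lemma drawing_first_visit w : 0 < w < n -> exists2 K,
  exists2 u, max_low e u w & pr (iter K phi r) = (u, w) &
  forall i, i <= K -> lab (iter i phi r) < w.
Proof.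
elim: w => // -[_ _|w IH /andP[_ wn]].
  exists 0; last by case=> //; rewrite /= (drawing_root D).
  exists 0; last by rewrite /pr /= (drawing_root D) (drawing_edge_root D).
  split=> //; first by have := drawing_adj D r; rewrite (drawing_root D) (drawing_edge_root D).
  by case=> [|[]].
have [K [u mu EK] HK] := IH (ltnW wn).
have [u' [k [mu' [Ek Hk]]]] := outer_face_step G mu wn.
have E i : iter (i.+1 + K) phi r = iter i phi (phi (iter K phi r)) by rewrite iterD iterSr.
exists (k.+1 + K).
  by exists u' => //; rewrite E drawing_iter_face drawing_face EK.
move=> i; case: (leqP i K) => iK; first by move=> _; apply: ltnW (HK _ iK).
rewrite -(subnK iK) addnS -addSn leq_add2r ltnS => ik.
have /(congr1 fst) /= -> : pr (iter ((i - K.+1).+1 + K) phi r) =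
    iter (i - K.+1) (face_step n e) (face_step n e (u, w.+1)).
  by rewrite E drawing_iter_face drawing_face EK.
move: ik; rewrite leq_eqVlt => /orP[/eqP -> | ik]; first by rewrite Ek; case: mu'.
by have /andP[_] := Hk _ ik; rewrite ltnS.
Qed.

Lemma drawing_outer x : exists2 d, fconnect s x d & fconnect phi r d.
Proof.
case: (posnP (lab x)) => [x0|x0].
  by exists r; rewrite ?connect0 // (drawing_vertex D) x0 (drawing_root D).
have [|K [u _ EK] _] := @drawing_first_visit (lab x); first by rewrite x0 drawing_lt.
exists (iter K.+1 phi r); last exact: fconnect_iter.
by case: EK => _ EK; rewrite (drawing_vertex D) iterS drawing_face_tail EK.
Qed.

(* The labels seen along the outer face form a restricted growth sequence. *)
Lemma drawing_restricted_growth j w : w < lab (iter j phi r) ->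
  exists2 i, i < j & lab (iter i phi r) = w.
Proof.
move=> wj; case: (posnP w) => [w0|w0].
  exists 0; last by rewrite /= (drawing_root D).
  by case: j wj => //=; rewrite (drawing_root D).
have wn : w < n := ltn_trans wj (drawing_lt _).
have [|K [u _ EK] HK] := @drawing_first_visit w; first by rewrite w0.
have EK1 : lab (iter K.+1 phi r) = w.
  by case: EK => _ EK; rewrite iterS drawing_face_tail EK.
exists K.+1 => //; rewrite ltnNge leq_eqVlt; apply/negP => /orP[/eqP E|jK].
  by rewrite E EK1 ltnn in wj.
by have := HK j jK; rewrite ltnNge ltnW.
Qed.

Lemma drawing_connected d d' : connect (fun x y => (y == s x) || (y == a x)) d d'.
Proof.
set g := (fun x y => _).
have sub x y : fconnect s x y -> connect g x y.
  apply: connect_sub => u v /eqP <-; apply: connect1; by rewrite /g eqxx.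
have to_root x : connect g x r /\ connect g r x.
  have [k] := ubnP (lab x); elim: k x => // k IH x; rewrite ltnS => xk.
  case: (posnP (lab x)) => [x0|x0].
    by split; apply: sub; rewrite (drawing_vertex D) x0 (drawing_root D).
  have [|j jx exj] := contour_low G (i := lab x); first by rewrite x0 drawing_lt.
  have [y yx yj] := drawing_onto D exj.
  have [|h1 h2] := IH (a y); first by rewrite yj (leq_trans jx).
  have gy z : connect g z (a z) by apply: connect1; rewrite /g eqxx orbT.
  split.
    apply: connect_trans h1; apply: connect_trans (gy y).
    by apply: sub; rewrite (drawing_vertex D) yx.
  apply: (connect_trans h2); apply: (connect_trans (gy _)); rewrite aK.
  by apply: sub; rewrite (drawing_vertex D) yx.
by apply: connect_trans (proj1 (to_root d)) (proj2 (to_root d')).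
Qed.

Lemma drawing_card_vertices : #|porbits s| = n.
Proof.
have ex i : exists x, i < n -> lab x = i.
  case: (ltnP i n) => iN; last by exists r.
  case: (posnP i) => [->|i0]; first by exists r => _; apply: (drawing_root D).
  have [|j _ /(drawing_onto D)[x xi _]] := contour_low G (i := i); first by rewrite i0.
  by exists x.
pose f (i : 'I_n) := porbit s (sval (cid (ex i))).
have lf (i : 'I_n) : lab (sval (cid (ex i))) = i by case: (cid (ex i)) => x /= ->.
have finj : injective f.
  move=> i j /eqP; rewrite eq_porbit_mem mem_porbit_fconnect (drawing_vertex D) !lf.
  by move/eqP/val_inj.
rewrite -[RHS]card_ord -(card_imset _ finj); apply: eq_card => A.
apply/imsetP/imsetP => [[x _ ->]|[i _ ->]]; last by exists (sval (cid (ex i))).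
exists (Ordinal (drawing_lt x)) => //; apply/eqP.
by rewrite eq_porbit_mem mem_porbit_fconnect (drawing_vertex D) lf.
Qed.

(** One dart per edge. The outer face carries exactly the [n - 1] ascents of [max_low], and every
    other face exactly one ascent. So [i] inner ascents mean [i + n - 1] edges and [i + 1] faces, in
    accordance with Euler's formula for [n] vertices. *)
Let ascents := [set d | lab d < lab (a d)].
Let inner_ascents := [set d in ascents | ~~ `[< max_low e (lab d) (lab (a d)) >]].

Lemma drawing_card_edges : #|porbits a| = #|ascents|.
Proof.
have mem_a x y : (y \in porbit a x) = (y == x) || (y == a x).
  apply/porbitP/orP => [[i ->]|[/eqP->|/eqP->]]; last 2 first.
  - by exists 0; rewrite expg0 perm1.
  - by exists 1; rewrite expg1.
  elim: i => [|i IH]; first by left; rewrite expg0 perm1.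
  rewrite expgSr permM; case: IH => /eqP ->; first by right.
  by left; rewrite aK.
have inj : {in ascents &, injective (porbit a)}.
  move=> x y; rewrite !inE => xa ya /eqP; rewrite eq_porbit_mem mem_a => /orP[/eqP//|/eqP E].
  by move: xa ya; rewrite E aK ltnNge => /negP xa /ltnW.
rewrite -(card_in_imset inj); apply: eq_card => A.
apply/imsetP/imsetP => [[x _ ->]|[x _ ->]]; last by exists x.
have [lt|] := boolP (x \in ascents); first by exists x.
rewrite inE -leqNgt leq_eqVlt => /orP[/eqP E|lt].
  by have := drawing_adj D x; rewrite E eI.
exists (a x); first by rewrite inE aK.
by apply/eqP; rewrite eq_porbit_mem mem_a aK eqxx orbT.
Qed.

Lemma drawing_inner_ascent d y : d \in inner_ascents -> y \in ascents ->
  fconnect phi d y -> y = d.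
Proof.
rewrite !inE => /andP[da /asboolPn nmax] ya.
have [k [Ek Hk]] := inner_face G da (drawing_adj D d) nmax.
have iterE i : pr (iter i.+1 phi d) = iter i (face_step n e) (face_step n e (pr d)).
  by rewrite iterSr drawing_iter_face drawing_face.
have loop : iter k.+1 phi d = d by apply: drawing_pair_inj; rewrite iterE Ek.
have red i : exists2 j, j <= k & iter i phi d = iter j phi d.
  elim: i => [|i [j jk Ej]]; first by exists 0.
  move: jk; rewrite leq_eqVlt => /orP[/eqP jk|jk].
    by exists 0; rewrite // iterS Ej jk -iterS loop.
  by exists j.+1; rewrite // !iterS Ej.
move=> /iter_findex Ey; move: ya; rewrite -Ey.
have [[|j] jk ->] // := red (findex phi d y).
by have /andP[] := Hk _ jk; rewrite -iterE /= => /ltnW; rewrite leqNgt => /negbTE ->.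
Qed.

Lemma drawing_outer_ascent d : d \in ascents -> d \notin inner_ascents -> fconnect phi r d.
Proof.
move=> da; rewrite inE da /= negbK => /asboolP mu.
have [|K [u mu' EK] _] := @drawing_first_visit (lab (a d)).
  by rewrite drawing_lt andbT; case: mu; case: (lab (a d)).
suff -> : d = iter K phi r by apply: fconnect_iter.
apply: drawing_pair_inj; rewrite EK /pr; congr pair.
case: mu mu' => [h1 h2 h3] [h1' h2' h3']; case: (ltngtP (lab d) u) => // lt.
  by have := h3 u; rewrite lt h1' (contour_sym G) h2' => /(_ isT).
by have := h3' (lab d); rewrite lt h1 (contour_sym G) h2 => /(_ isT).
Qed.

Lemma drawing_card_outer_ascents : #|ascents| = #|inner_ascents| + n.-1.
Proof.
have sub : inner_ascents \subset ascents by apply/subsetP => d; rewrite inE => /andP[].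
rewrite -(cardsID inner_ascents ascents) (setIidPr sub); congr addn.
have n0 := ltnW drawing_gt1.
pose f d := inord (lab (a d)) : 'I_n.-1.+1.
have fE d : f d = lab (a d) :> nat by rewrite inordK // prednK // drawing_lt.
have mem_max d : d \in ascents :\: inner_ascents -> max_low e (lab d) (lab (a d)).
  by rewrite inE => /andP[+ da]; rewrite inE da /= negbK => /asboolP.
have inj : {in ascents :\: inner_ascents &, injective f}.
  move=> x y /mem_max [h1 h2 h3] /mem_max [h1' h2' h3'] /(congr1 val) /=.
  rewrite !fE => E; apply: drawing_pair_inj; rewrite /pr E; congr pair.
  case: (ltngtP (lab x) (lab y)) => // lt.
    by have := h3 (lab y); rewrite lt E h1' (contour_sym G) h2' => /(_ isT).
  by have := h3' (lab x); rewrite lt -E h1 (contour_sym G) h2 => /(_ isT).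
suff E : f @: (ascents :\: inner_ascents) = [set~ ord0].
  by rewrite -(card_in_imset inj) E cardsC1 card_ord.
apply/setP => i; rewrite !inE; apply/imsetP/idP => [[x /mem_max [lt _ _] ->]|i0].
  by apply: contraTneq lt => /(congr1 val) /=; rewrite fE => ->; rewrite ltn0.
have [|K [u mu EK] _] := @drawing_first_visit i.
  by have := ltn_ord i; rewrite {2}(prednK n0) => ->; rewrite andbT lt0n.
exists (iter K phi r); last by apply/val_inj; rewrite [RHS]fE; case: EK.
case: EK => E1 E2; rewrite !inE E1 E2; case: (mu) => -> _ _.
by rewrite /= andbT negbK; apply/asboolP.
Qed.

Lemma drawing_card_faces : #|porbits phi| = #|inner_ascents|.+1.
Proof.
have asc x : exists2 d, d \in ascents & fconnect phi x d.
  have [[d /andP[da xd]]|none] := pselect (exists d, (d \in ascents) && fconnect phi x d).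
    by exists d.
  (* Along a face without ascents the labels would decrease forever. *)
  suff dec k : lab (iter k phi x) + k <= lab x.
    have := dec (lab x).+1; rewrite addnS ltnNge leq_addl //.
  elim: k => [|k IH]; first by rewrite addn0.
  apply: leq_trans IH; rewrite addnS -addSn leq_add2r /= drawing_face_tail.
  rewrite ltn_neqAle leqNgt; apply/andP; split.
    by apply: contraTneq (drawing_adj D (iter k phi x)) => ->; rewrite eI.
  apply/negP => lt; apply: none; exists (iter k phi x).
  by rewrite inE lt fconnect_iter.
have inj : {in inner_ascents &, injective (porbit phi)}.
  move=> x y xi yi /eqP; rewrite eq_porbit_mem mem_porbit_fconnect => c.
  by apply: (drawing_inner_ascent yi) => //; move: xi; rewrite inE => /andP[].
have rN : porbit phi r \notin porbit phi @: inner_ascents.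
  apply/imsetP => -[x xi /eqP]; rewrite eq_porbit_mem mem_porbit_fconnect => c.
  have ra : r \in ascents by rewrite inE (drawing_root D) (drawing_edge_root D).
  have E := drawing_inner_ascent xi ra c.
  have := xi; rewrite -E inE ra (drawing_root D) (drawing_edge_root D) /=.
  move=> /asboolPn; case; split=> //.
    by have := drawing_adj D r; rewrite (drawing_root D) (drawing_edge_root D).
  by case=> [|[]].
rewrite -(card_in_imset inj) -add1n -[1]/(true : nat) -rN -cardsU1.
apply: eq_card => A; rewrite !inE; apply/imsetP/orP => [[x _ ->]|].
  have [d da xd] := asc x.
  have -> : porbit phi x = porbit phi d.
    by apply/eqP; rewrite eq_sym eq_porbit_mem mem_porbit_fconnect.
  have [di|di] := boolP (d \in inner_ascents); first by right; apply: imset_f.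
  left; rewrite eq_porbit_mem mem_porbit_fconnect.
  exact: drawing_outer_ascent.
by case=> [/eqP->|/imsetP[x _ ->]]; [exists r|exists x].
Qed.

Lemma drawing_planar : #|porbits s| + #|porbits phi| = #|porbits a| + 2.
Proof.
rewrite drawing_card_vertices drawing_card_faces drawing_card_edges.
rewrite drawing_card_outer_ascents; have := drawing_gt1.
by move: #|inner_ascents| => k; clear; lia.
Qed.

End Drawing.

(** * Existence and uniqueness of the map drawn from a graph *)

Lemma iter_next_surj (T : eqType) (p : seq T) x y :
  uniq p -> x \in p -> y \in p -> exists k, y = iter k (next p) x.
Proof.
move=> Up xp yp; have [i q Eq] := rot_to xp.
have cyc : fcycle (next p) (x :: q) by rewrite -Eq rot_cycle cycle_next.
have /trajectP[k _ ->] : y \in traject (next p) x (size q).+1.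
  move: yp; rewrite -(mem_rot i) Eq; case/fpathP: cyc => m Em.
  suff -> : x :: q = traject (next p) x (size q).+1 by [].
  have Em' := congr1 size Em; rewrite size_rcons size_traject in Em'.
  congr (_ :: _); rewrite -Em' trajectSr in Em.
  by case: (rcons_inj Em).
by exists k.
Qed.

(** The orbits of [s] are automatically the vertices: iterating [next] reaches all neighbours, hence
    by injectivity iterating [s] reaches all darts with the same origin label. *)
Lemma drawing_of_next n (e : rel nat) (T : finType) (s a : {perm T}) (r : T) lab :
    contour_graph n e -> involutive a ->
    (forall x, lab (s x) = lab x) -> (forall x, e (lab x) (lab (a x))) ->
    (forall i j, e i j -> exists2 x, lab x = i & lab (a x) = j) ->
    (forall x y, lab x = lab y -> lab (a x) = lab (a y) -> x = y) ->
    (forall x, lab (a (s x)) = next (nbrs n e (lab x)) (lab (a x))) ->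
    lab r = 0 -> lab (a r) = 1 ->
  drawing n e s a r lab.
Proof.
move=> G aK labs adj onto inj nxt r0 r1; split=> // x y.
have iter_lab k : lab (iter k s x) = lab x by elim: k => //= k; rewrite labs.
apply/idP/eqP => [/iter_findex <-|E]; first by rewrite iter_lab.
have iter_nxt k : lab (a (iter k s x)) = iter k (next (nbrs n e (lab x))) (lab (a x)).
  by elim: k => //= k <-; rewrite nxt iter_lab.
have [k Ek] := iter_next_surj (uniq_nbrs n e (lab x))
  (etrans (mem_nbrs G _ _) (adj x)) (etrans (mem_nbrs G _ _) (etrans (congr1 (e^~ _) E) (adj y))).
suff -> : y = iter k s x by apply: fconnect_iter.
by apply: inj; rewrite ?iter_lab // iter_nxt.
Qed.

(** An [edged_map] has some ['I_k] as its set of darts, whereas drawings are built on pairs of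
    adjacent vertices. *)
Lemma drawing_transport n e (T T' : finType) (s a : {perm T}) (r : T) lab (h : T' -> T) (g : T -> T') :
    cancel g h -> cancel h g -> drawing n e s a r lab ->
  exists s' a' : {perm T'}, drawing n e s' a' (g r) (lab \o h).
Proof.
move=> gh hg D.
have conj_inj (p : {perm T}) : injective (fun x => g (p (h x))).
  by move=> x y /(can_inj gh)/perm_inj/(can_inj hg).
exists (perm (conj_inj s)), (perm (conj_inj a)); apply: drawing_of_next.
- exact: drawing_graph D.
- by move=> x; rewrite !permE gh (drawing_invol D) hg.
- by move=> x; rewrite /= permE gh (drawing_node D).
- by move=> x; rewrite /= permE gh (drawing_adj D).
- move=> i j /(drawing_onto D)[x xi xj]; exists (g x); rewrite /= ?permE !gh //.
- move=> x y /= E; rewrite !permE !gh => E'; apply: (can_inj hg).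
  exact: (drawing_inj D).
- by move=> x; rewrite /= !permE !gh (drawing_next D).
- by rewrite /= gh (drawing_root D).
- by rewrite /= permE !gh (drawing_edge_root D).
Qed.

Lemma edged_map_of_drawing n e (T : finType) (s a : {perm T}) (r : T) lab :
    drawing n e s a r lab ->
  exists (m : edged_map) (lab' : dart m -> nat),
    drawing n e (node m) (edge m) (Defs.root m) lab'.
Proof.
move=> /(drawing_transport (@enum_rankK T) (@enum_valK T)) [s' [a' D]].
have aN x : a' x != x.
  apply: contraTneq (drawing_adj D x) => E.
  by rewrite E (contour_irr (drawing_graph D)).
by exists (@EdgedMap #|T| s' a' (enum_rank r) (drawing_invol D) aN
  (drawing_connected D) (drawing_planar D)); eexists; apply: D.
Qed.

Lemma drawing_exists n e : 1 < n -> contour_graph n e ->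
  exists (T : finType) (s a : {perm T}) (r : T) (lab : T -> nat), drawing n e s a r lab.
Proof.
move=> n1 G.
pose T : finType := {p : 'I_n * 'I_n | e p.1 p.2}.
have mk i j : e i j -> {x : T | (val x).1 = i :> nat & (val x).2 = j :> nat}.
  move=> eij; pose p := (Ordinal (contour_lt G eij), Ordinal (adj_ltr G eij)).
  by exists (exist _ p eij).
pose src (x : T) : nat := (val x).1; pose dst (x : T) : nat := (val x).2.
have adj x : e (src x) (dst x) := valP x.
have inj x y : src x = src y -> dst x = dst y -> x = y.
  move=> E1 E2; apply: val_inj; rewrite [val x]surjective_pairing [val y]surjective_pairing.
  by congr pair; apply: val_inj.
have s_ex x := mk _ _ (adj_next G (adj x)).
have a_ex x : {y : T | (val y).1 = dst x :> nat & (val y).2 = src x :> nat}.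
  by apply: mk; rewrite (contour_sym G).
have s_src x : src (s2val (s_ex x)) = src x by case: (s_ex x).
have s_dst x : dst (s2val (s_ex x)) = next (nbrs n e (src x)) (dst x) by case: (s_ex x).
have a_src x : src (s2val (a_ex x)) = dst x by case: (a_ex x).
have a_dst x : dst (s2val (a_ex x)) = src x by case: (a_ex x).
have s_inj : injective (fun x => s2val (s_ex x)).
  move=> x y E; have := congr1 src E; rewrite /= !s_src => Es.
  apply: (inj _ _ Es); have := congr1 dst E; rewrite /= !s_dst Es.
  exact: (can_inj (prev_next (uniq_nbrs n e (src y)))).
have a_inj : injective (fun x => s2val (a_ex x)).
  by move=> x y E; apply: inj; [rewrite -!a_dst E | rewrite -!a_src E].
have [r r0 r1] : {x : T | (val x).1 = 0 :> nat & (val x).2 = 1 :> nat}.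
  apply: mk; rewrite (contour_sym G).
  suff : exists2 j, j < 1 & e 1 j by case=> -[].
  by apply: (contour_low G); rewrite n1.
exists T, (perm s_inj), (perm a_inj), r, src.
apply: (drawing_of_next G) => //.
- by move=> x; apply: inj; rewrite !permE ?a_src ?a_dst.
- by move=> x; rewrite permE.
- by move=> x; rewrite permE a_src.
- by move=> i j /mk[x xi xj]; exists x; rewrite ?permE ?a_src.
- by move=> x y E; rewrite !permE !a_src; apply: inj.
- by move=> x; rewrite !permE !a_src s_dst.
- by rewrite permE a_src.
Qed.

Lemma drawing_iso n e (T T' : finType) (s a : {perm T}) r lab (s' a' : {perm T'}) r' lab' :
    drawing n e s a r lab -> drawing n e s' a' r' lab' ->
  exists h : T -> T', [/\ bijective h, forall x, h (s x) = s' (h x),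
    forall x, h (a x) = a' (h x) & h r = r'].
Proof.
move=> D D'.
have ex x : exists y, lab' y = lab x /\ lab' (a' y) = lab (a x).
  by have [y] := drawing_onto D' (drawing_adj D x); exists y.
have ex' y : exists x, lab x = lab' y /\ lab (a x) = lab' (a' y).
  by have [x] := drawing_onto D (drawing_adj D' y); exists x.
pose h x := sval (cid (ex x)); pose g y := sval (cid (ex' y)).
have h1 x : lab' (h x) = lab x by rewrite /h; case: (cid _) => ? [].
have h2 x : lab' (a' (h x)) = lab (a x) by rewrite /h; case: (cid _) => ? [].
have g1 x : lab (g x) = lab' x by rewrite /g; case: (cid _) => ? [].
have g2 x : lab (a (g x)) = lab' (a' x) by rewrite /g; case: (cid _) => ? [].
exists h; split.
- exists g => x; first by apply: (drawing_inj D); rewrite ?g1 ?g2 ?h1 ?h2.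
  by apply: (drawing_inj D'); rewrite ?h1 ?h2 ?g1 ?g2.
- move=> x; apply: (drawing_inj D'); first by rewrite h1 !(drawing_node D') h1 (drawing_node D).
  by rewrite h2 (drawing_next D') h1 h2 (drawing_next D).
- move=> x; apply: (drawing_inj D'); first by rewrite h1 h2.
  by rewrite h2 !(drawing_invol D') (drawing_invol D) h1.
- apply: (drawing_inj D').
    by rewrite h1 (drawing_root D) (drawing_root D').
  by rewrite h2 (drawing_edge_root D) (drawing_edge_root D').
Qed.

(** If [f j < g j], then [g] takes the value [f j] at some [i < j], where [f i = g i] by induction;
    now [f i = f j] forces [g i = g j], a contradiction. *)
Lemma restricted_growth_unique (f g : nat -> nat) :
    (forall j w, w < f j -> exists2 i, i < j & f i = w) ->
    (forall j w, w < g j -> exists2 i, i < j & g i = w) ->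
    (forall i j, (f i == f j) = (g i == g j)) -> f =1 g.
Proof.
move=> Hf Hg fg; elim/ltn_ind => j IH.
case: (ltngtP (f j) (g j)) => // lt.
  have [i ij E] := Hg _ _ lt.
  by have := fg i j; rewrite (IH i ij) E eqxx (ltn_eqF lt).
have [i ij E] := Hf _ _ lt.
by have := fg i j; rewrite -(IH i ij) E eqxx (ltn_eqF lt).
Qed.

(** An isomorphism respects the walk along the outer face and the coincidences among its vertices,
    so both label sequences agree there by [restricted_growth_unique]. Every vertex lies on the
    outer face, so all labels agree. *)
Lemma drawing_iso_sub n e n' e' (T T' : finType) (s a : {perm T}) r lab
    (s' a' : {perm T'}) r' lab' (h : T -> T') :
    drawing n e s a r lab -> drawing n' e' s' a' r' lab' -> injective h ->
    (forall x, h (s x) = s' (h x)) -> (forall x, h (a x) = a' (h x)) -> h r = r' ->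
  forall i j, e i j -> e' i j.
Proof.
move=> D D' hI hs ha hr.
have conn x y : fconnect s' (h x) (h y) = fconnect s x y.
  have it k : iter k s' (h x) = h (iter k s x) by elim: k => //= k ->; rewrite hs.
  apply/idP/idP => [/iter_findex E|/iter_findex <-].
    by move: E; rewrite it => /hI <-; apply: fconnect_iter.
  by rewrite -it fconnect_iter.
have face_h k : h (iter k (a * s)%g r) = iter k (a' * s')%g r'.
  by elim: k => //= k <-; rewrite !permM hs ha.
have E : (fun k => lab (iter k (a * s)%g r)) =1 (fun k => lab' (iter k (a' * s')%g r')).
  apply: restricted_growth_unique.
  - exact: drawing_restricted_growth D.
  - exact: drawing_restricted_growth D'.
  by move=> i j; rewrite -(drawing_vertex D) -(drawing_vertex D') -!face_h conn.
have hl x : lab' (h x) = lab x.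
  have [d xd /iter_findex rd] := drawing_outer D x.
  have -> : lab x = lab d by apply/eqP; rewrite -(drawing_vertex D).
  have -> : lab' (h x) = lab' (h d) by apply/eqP; rewrite -(drawing_vertex D') conn.
  by rewrite -rd face_h; apply/esym/E.
move=> i j /(drawing_onto D)[x <- <-].
by rewrite -!hl ha; apply: (drawing_adj D').
Qed.

(** * Counting noncrossing graphs *)

(* In the bipartite case the visible vertices are alternately coloured, so the
   lower neighbours of a new vertex occupy positions of the same parity. *)
Fixpoint choices (b : bool) (st : seq nat) : seq (seq nat) :=
  if st is x :: st' then
    [:: x] :: choices b st' ++
      [seq x :: A | A <- choices b st' & b ==> odd (index (last 0 A) st')]
  else [::].

Definition next_state i st (A : seq nat) := i :: [seq x <- st | x <= last 0 A].

Fixpoint codes b k i st : seq (seq (seq nat)) :=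
  if k is k'.+1 then
    flatten [seq [seq A :: c | c <- codes b k' i.+1 (next_state i st A)] | A <- choices b st]
  else [:: [::]].

(** The number of choices whose lowest neighbour is at position [j]: any subset of the [j] positions
    before it, or of the [j./2] among them with the same parity. *)
Definition weight (b : bool) j := if b then 2 ^ j./2 else 2 ^ j.

(* [L] counts the visible vertices: a new vertex whose lowest neighbour is the
   [j]-th of them hides those before it and becomes visible itself. *)
Fixpoint walks (w : nat -> nat) k L :=
  if k is k'.+1 then \sum_(j < L) w j * walks w k' (L - j).+1 else 1.

Lemma choices_nil b st : [::] \notin choices b st.
Proof.
elim: st => //= x st IH; rewrite inE mem_cat /= negb_or IH /=.
by apply/mapP => -[].
Qed.

Lemma mem_last_nonempty (A : seq nat) : A != [::] -> last 0 A \in A.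
Proof. by case: A => // x A _ /=; rewrite mem_last. Qed.

Lemma choices_sub b st A : A \in choices b st -> subseq A st.
Proof.
elim: st A => //= x st IH A; rewrite inE mem_cat => /or3P[/eqP ->|/IH h|/mapP[A' + ->]].
- by rewrite eqxx sub0seq.
- exact: subseq_trans h (subseq_cons _ _).
by rewrite mem_filter => /andP[_ /IH h]; rewrite eqxx.
Qed.

Lemma choices_last b st A : A \in choices b st -> last 0 A \in A.
Proof.
move=> h; apply: mem_last_nonempty; apply: contraTneq h => ->; exact: choices_nil.
Qed.

Lemma choices_parity st A : uniq st -> A \in choices true st ->
  forall y, y \in A -> odd (index y st) = odd (index (last 0 A) st).
Proof.
elim: st A => //= x st IH A /andP[xst Ust]; rewrite inE mem_cat.
have idx y T : T \in choices true st -> y \in T -> (x == y) = false.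
  move=> /choices_sub/mem_subseq sub yT; apply: contraNF xst => /eqP ->; exact: sub.
case/or3P => [/eqP -> y|h y yS|/mapP[A' + -> y]].
- by rewrite inE => /eqP ->.
- by rewrite (idx y A) // (idx (last 0 A) A) ?(choices_last h) //= (IH A).
rewrite mem_filter => /andP[/= od h].
have -> : last x A' = last 0 A' by case: A' {od} h => //; rewrite (negbTE (choices_nil _ _)).
rewrite inE (idx (last 0 A') A') ?(choices_last h) //= => /orP[/eqP ->|yS].
  by rewrite eqxx od.
by rewrite (idx y A') //= (IH A').
Qed.

Lemma mem_choices (b : bool) st A : uniq st -> A != [::] -> subseq A st ->
  (b -> forall y, y \in A -> odd (index y st) = odd (index (last 0 A) st)) ->
  A \in choices b st.
Proof.
elim: st A => [|x st IH] [|y A] // /andP[xst Ust] _; rewrite [subseq _ _]/=.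
have idx z : z \in st -> (x == z) = false.
  by move=> zst; apply: contraNF xst => /eqP ->.
rewrite /= inE mem_cat; case: eqVneq => [->|yx] sub par; last first.
  apply/orP; right; apply/orP; left; apply: IH => // bt z zS.
  have := par bt z zS; have := mem_subseq sub zS => zst.
  have : last 0 (y :: A) \in st by apply: (mem_subseq sub); rewrite /= mem_last.
  by move=> /= lst; rewrite !idx //= => /negb_inj.
case: A sub par => [|z A] sub par; first by rewrite eqxx.
apply/orP; right; apply/orP; right; apply: map_f; rewrite mem_filter.
have lst : last 0 (z :: A) \in st by apply: (mem_subseq sub); rewrite /= mem_last.
apply/andP; split.
  apply/implyP => bt; have := par bt x (mem_head _ _).
  by rewrite eqxx [last 0 _]/= idx //= => /esym/negbFE.
apply: IH => // bt u uS; have ust := mem_subseq sub uS.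
have := par bt u; rewrite inE uS orbT [last 0 _]/= !idx //= => /(_ isT).
by move/negb_inj.
Qed.

Lemma uniq_choices b st : uniq st -> uniq (choices b st).
Proof.
elim: st => //= x st IH /andP[xst Ust].
have xN A : A \in choices b st -> x \notin A.
  by move=> /choices_sub/mem_subseq sub; apply: contra xst; apply: sub.
rewrite mem_cat negb_or cat_uniq IH //= map_inj_uniq ?filter_uniq ?IH //; last first.
  by move=> A T [].
rewrite andbT; apply/andP; split; first (apply/andP; split).
- by apply/negP => /xN; rewrite inE eqxx.
- by apply/mapP => -[A + [E]]; rewrite -E mem_filter (negbTE (choices_nil _ _)) andbF.
by apply/hasPn => _ /mapP[A _ ->]; apply/negP => /xN; rewrite inE eqxx.
Qed.

(** A new front element may or may not be added to a choice, in the bipartite case only if the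
    parity fits; so [weight b j.+1] is [weight b j] times [1 + (b ==> odd j)]. *)
Lemma sum_choices b st (f : nat -> nat) : uniq st ->
  \sum_(A <- choices b st) f (index (last 0 A) st) = \sum_(j < size st) weight b j * f j.
Proof.
elim: st f => [|x st IH] f; first by rewrite big_nil big_ord0.
move=> /andP[xst Ust]; rewrite [choices _ _]/= big_cons big_cat big_map big_filter.
rewrite [size _]/= big_ord_recl /= eqxx.
have idx A : A \in choices b st -> (x == last 0 A) = false.
  move=> h; apply: contraNF xst => /eqP ->.
  exact: (mem_subseq (choices_sub h) (choices_last h)).
rewrite (eq_big_seq (fun A => f (index (last 0 A) st).+1)); last first.
  by move=> A h; rewrite /= idx.
rewrite [X in _ + (_ + X)](_ : _ = \sum_(A <- choices b st)
   (b ==> odd (index (last 0 A) st)) * f (index (last 0 A) st).+1); last first.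
  rewrite big_mkcond; apply: eq_big_seq => A h.
  case: (b ==> _); rewrite ?mul1n ?mul0n //=.
  have -> : last x A = last 0 A by case: A h => //; rewrite (negbTE (choices_nil _ _)).
  by rewrite idx.
rewrite -big_split /=.
have := IH (fun j => (1 + (b ==> odd j)) * f j.+1) Ust.
under eq_bigr do rewrite mulnDl mul1n.
move=> ->; congr addn; first by rewrite /weight; case: (b); rewrite mul1n.
apply: eq_bigr => j _; rewrite /bump /= mulnA; congr muln.
rewrite /weight; case: (b) => /=; last by rewrite expnS mulnC.
rewrite uphalf_half; case: (odd j); last by rewrite muln1 add0n.
by rewrite add1n expnS mulnC.
Qed.

Lemma filter_leq_drop (st : seq nat) y : sorted gtn st -> y \in st ->
  [seq x <- st | x <= y] = drop (index y st) st.
Proof.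
elim: st => //= x st IH; rewrite path_sortedE => [/andP[/allP gt_x sst]|]; last first.
  by move=> ? ? ? /= h1 h2; apply: ltn_trans h2 h1.
rewrite inE; case: (eqVneq x y) => [<- _|xy]; last first.
  move=> /= yst; have := gt_x _ yst => /= lt.
  by rewrite leqNgt lt /= IH.
rewrite leqnn; congr cons; apply/all_filterP/allP => z /gt_x; exact: ltnW.
Qed.

Lemma size_codes b k i st : sorted gtn st -> all (gtn i) st ->
  size (codes b k i st) = walks (weight b) k (size st).
Proof.
elim: k i st => //= k IH i st sst ai.
have Ust : uniq st.
  by apply: sorted_uniq sst => [? ? ? /= h1 h2|?]; [apply: ltn_trans h2 h1|rewrite /= ltnn].
rewrite size_flatten /shape -map_comp sumnE big_map.
rewrite -(sum_choices b (fun j => walks (weight b) k (size st - j).+1) Ust).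
apply: eq_big_seq => A h; rewrite /= size_map.
have last_st : last 0 A \in st := mem_subseq (choices_sub h) (choices_last h).
rewrite IH /next_state /= ?filter_leq_drop ?size_drop //.
- rewrite path_sortedE => [|? ? ? /= h1 h2]; last exact: ltn_trans h2 h1.
  apply/andP; split; last by rewrite -(filter_leq_drop sst) // sorted_filter // => ? ? ? /= h1 h2; exact: ltn_trans h2 h1.
  by apply/allP => z /mem_drop zst; apply: (allP ai).
- rewrite ltnSn; apply/allP => z /mem_drop zst; rewrite /= ltnS; apply: ltnW.
  exact: (allP ai z zst).
Qed.

Lemma uniq_codes b k i st : sorted gtn st -> all (gtn i) st -> uniq (codes b k i st).
Proof.
elim: k i st => //= k IH i st sst ai.
have trg : transitive gtn by move=> ? ? ? /= h1 h2; apply: ltn_trans h2 h1.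
have Ust : uniq st.
  by apply: sorted_uniq sst => [|?]; [exact: trg|rewrite /= ltnn].
have : all (fun A => uniq (codes b k i.+1 (next_state i st A))) (choices b st).
  apply/allP => A h; apply: IH; rewrite /next_state /=.
    rewrite path_sortedE // sorted_filter // andbT.
    by apply/allP => z; rewrite mem_filter => /andP[_ zst]; apply: (allP ai).
  rewrite ltnSn; apply/allP => z; rewrite mem_filter => /andP[_ zst]; rewrite /= ltnS ltnW //.
  exact: (allP ai).
elim: (choices b st) (uniq_choices b Ust) => //= A As IHA /andP[AN UA] /andP[UcA Uc].
rewrite cat_uniq IHA // map_inj_uniq // => [|? ? []//]; rewrite UcA andbT /=.
apply/hasPn => c /flattenP[_ /mapP[B BA ->] /mapP[c' _ ->]].
by apply/mapP => -[d _ [E _]]; move: AN; rewrite -E BA.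
Qed.

(** * Coding a noncrossing graph by its lists of lower neighbours *)

Definition low (e : rel nat) i := [seq j <- rev (iota 0 i) | e i j].

(* The vertices before [i] that can still be joined to [i] without crossing. *)
Definition visible (e : rel nat) i :=
  [seq x <- rev (iota 0 i) |
    all (fun k => all (fun p => ~~ [&& p < x, x < k & e p k]) (iota 0 i)) (iota 0 i)].

Lemma sorted_rev_iota i : sorted gtn (rev (iota 0 i)).
Proof. by rewrite rev_sorted; apply: iota_ltn_sorted. Qed.

Lemma gtn_trans : transitive gtn.
Proof. by move=> ? ? ? /= h1 h2; apply: ltn_trans h2 h1. Qed.

Lemma sorted_visible e i : sorted gtn (visible e i).
Proof. by apply: sorted_filter; [exact: gtn_trans|exact: sorted_rev_iota]. Qed.

Lemma uniq_visible e i : uniq (visible e i).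
Proof. by rewrite filter_uniq // rev_uniq iota_uniq. Qed.

Lemma visibleP e i x : reflect (x < i /\ forall p k, p < x -> x < k -> k < i -> ~~ e p k)
  (x \in visible e i).
Proof.
rewrite mem_filter mem_rev mem_iota add0n /= andbC; apply: (iffP andP) => -[xi H]; split=> //.
  move=> p k px xk ki; have /allP/(_ k) := H; rewrite mem_iota add0n ki => /(_ isT).
  by move=> /allP/(_ p); rewrite mem_iota add0n (ltn_trans px xi) px xk => /(_ isT).
apply/allP => k; rewrite mem_iota add0n => /= ki; apply/allP => p _.
by apply/and3P => -[px xk epk]; have := H p k px xk ki; rewrite epk.
Qed.

Lemma mem_low e i j : (j \in low e i) = (j < i) && e i j.
Proof. by rewrite mem_filter mem_rev mem_iota add0n /= andbC. Qed.

Lemma last_low e i j : j \in low e i -> last 0 (low e i) <= j.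
Proof.
have : sorted gtn (low e i) by apply: sorted_filter; [exact: gtn_trans|exact: sorted_rev_iota].
elim/last_ind: (low e i) => // A y _; rewrite last_rcons mem_rcons inE.
rewrite sorted_pairwise; last exact: gtn_trans.
rewrite pairwise_rcons => /andP[/allP h _] /orP[/eqP -> //|/h]; exact: ltnW.
Qed.

(** The edge from [i] to its lowest neighbour hides exactly the vertices strictly between its ends,
    and the other lower edges of [i] hide nothing more. *)
Lemma visibleS e i : symmetric e -> low e i != [::] ->
  visible e i.+1 = next_state i (visible e i) (low e i).
Proof.
move=> eS low0; have := mem_last_nonempty low0; rewrite mem_low => /andP[li eil].
apply: (irr_sorted_eq gtn_trans).
- by move=> x; rewrite /= ltnn.
- exact: sorted_visible.
- rewrite /= path_sortedE; last exact: gtn_trans.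
  rewrite sorted_filter ?sorted_visible // ?andbT; last exact: gtn_trans.
  by apply/allP => x; rewrite mem_filter => /andP[_ /visibleP[]].
move=> x; rewrite /next_state inE [X in _ || X]mem_filter; apply/visibleP/orP => [[xi H]|].
  move: xi; rewrite ltnS leq_eqVlt => /orP[/eqP->|xi]; [by left|right].
  apply/andP; split; last first.
    by apply/visibleP; split=> // p k px xk ki; apply: H => //; apply: ltnW.
  rewrite leqNgt; apply/negP => lx.
  by have := H _ _ lx xi (ltnSn i); rewrite eS eil.
case=> [/eqP ->|/andP[xl /visibleP[xi H]]].
  by split=> // p k pi ik; rewrite ltnS leqNgt ik.
split; first exact: ltnW.
move=> p k px xk; rewrite ltnS leq_eqVlt => /orP[/eqP ->|ki]; last exact: H.
rewrite eS; apply/negP => eip; suff : x <= p by rewrite leqNgt px.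
by apply: leq_trans xl _; apply: last_low; rewrite mem_low eip andbT (ltn_trans px).
Qed.

Definition proper_coloring (e : rel nat) (c : nat -> bool) := forall i j, e i j -> c i != c j.

Definition alternating (c : nat -> bool) (st : seq nat) := sorted (fun x y => c x != c y) st.

Lemma alternating_parity c st x : alternating c st -> x \in st ->
  c x = c (head 0 st) (+) odd (index x st).
Proof.
case: st => // y st; rewrite /alternating /=.
elim: st y => [|z st IH] y; first by rewrite inE => _ /eqP ->; rewrite eqxx addbF.
move=> /= /andP[yz alt]; rewrite inE; case: (eqVneq y x) => [->|yx]; first by rewrite addbF.
move=> /(IH z alt) /= ->.
by move: yz; case: (c y); case: (c z) => //= _; rewrite ?addTb ?addFb ?negbK.
Qed.

(** In the new list [i] is followed by its lowest neighbour, of the other colour, and the rest is a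
    suffix of the old list. *)
Lemma alternating_visibleS e c i : symmetric e -> c i != c (last 0 (low e i)) ->
  low e i != [::] -> subseq (low e i) (visible e i) ->
  alternating c (visible e i) -> alternating c (visible e i.+1).
Proof.
move=> eS col low0 sub alt; rewrite visibleS // /next_state.
have last_in := mem_last_nonempty low0.
rewrite filter_leq_drop ?sorted_visible ?(mem_subseq sub) //.
have idx : index (last 0 (low e i)) (visible e i) < size (visible e i).
  by rewrite index_mem (mem_subseq sub).
rewrite (drop_nth 0 idx) nth_index ?(mem_subseq sub) // /alternating /=.
rewrite col /=.
have := drop_nth 0 idx; rewrite nth_index ?(mem_subseq sub) // => E.
by have := drop_sorted (index (last 0 (low e i)) (visible e i)) alt; rewrite E.
Qed.

Lemma low_in_choices (b : bool) e c i : symmetric e -> (b -> proper_coloring e c) ->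
  low e i != [::] -> subseq (low e i) (visible e i) ->
  (b -> alternating c (visible e i)) -> low e i \in choices b (visible e i).
Proof.
move=> eS col low0 sub alt; apply: mem_choices => //; first exact: uniq_visible.
move=> bt y yl; have last_in := mem_last_nonempty low0.
have := alternating_parity (alt bt) (mem_subseq sub yl).
have := alternating_parity (alt bt) (mem_subseq sub last_in).
move: yl last_in; rewrite !mem_low => /andP[_ /(col bt)] + /andP[_ /(col bt)].
case: (c y); case: (c i); case: (c (last _ _)) => //= _ _;
 by case: (c _); case: (odd _); case: (odd _).
Qed.

Definition code_of (e : rel nat) i k := [seq low e j | j <- iota i k].

Lemma visible1 e : visible e 1 = [:: 0].
Proof. by []. Qed.

Lemma contour_low_visible n e i : contour_graph n e -> 0 < i < n ->
  low e i != [::] /\ subseq (low e i) (visible e i).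
Proof.
move=> G iN; split.
  have [j ji eij] := contour_low G iN.
  by apply/eqP => E; have := mem_low e i j; rewrite E ji eij.
have -> : low e i = [seq j <- visible e i | e i j].
  rewrite -filter_predI; apply: eq_in_filter => j; rewrite mem_rev mem_iota add0n => /= ji.
  case eij: (e i j) => //=; apply/esym; have : j \in visible e i.
    apply/visibleP; split=> // p k pj jk ki; apply/negP => epk.
    by apply: (contour_noncrossing G pj jk ki epk); rewrite (contour_sym G).
  by rewrite mem_filter => /andP[].
exact: filter_subseq.
Qed.

Lemma code_of_contour (b : bool) n e c : 1 < n -> contour_graph n e ->
  (b -> proper_coloring e c) -> code_of e 1 n.-1 \in codes b n.-1 1 [:: 0].
Proof.
move=> n1 G col; rewrite -(visible1 e).
suff main k : forall i, 0 < i -> i + k = n -> (b -> alternating c (visible e i)) ->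
    code_of e i k \in codes b k i (visible e i).
  by apply: main; rewrite ?visible1 //; lia.
elim: k => [|k IH] i i0 Ei alt; first by rewrite inE.
have iN : 0 < i < n by lia.
have [low0 sub] := contour_low_visible G iN.
have eS := contour_sym G.
apply/flattenP; exists [seq low e i :: d | d <- codes b k i.+1 (next_state i (visible e i) (low e i))].
  by apply: map_f; apply: (low_in_choices (c := c)).
apply: map_f; rewrite -visibleS //; apply: IH => //; first by lia.
move=> bt; apply: alternating_visibleS => //; last exact: alt.
by apply: (col bt); have := mem_last_nonempty low0; rewrite mem_low => /andP[].
Qed.

(** * From a code back to a noncrossing graph *)

Section GraphOfCode.
Variable code : seq (seq nat).
(** A code begins with the entry of vertex [1]; an empty entry for vertex [0] makes entry [i] belong
    to vertex [i]. *)
Let lows := [::] :: code.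

Definition code_adj : rel nat := fun i j => (j \in nth [::] lows i) || (i \in nth [::] lows j).
Local Notation e := code_adj.

Lemma code_adj_sym : symmetric e.
Proof. by move=> i j; rewrite /code_adj orbC. Qed.

Definition valid_upto b i := forall j, 0 < j < i -> nth [::] lows j \in choices b (visible e j).

Lemma valid_lt b i j x : valid_upto b i -> j < i -> x \in nth [::] lows j -> 0 < j /\ x < j.
Proof.
move=> H ji; case: (posnP j) => [->|j0] //.
have /choices_sub/mem_subseq sub : nth [::] lows j \in choices b (visible e j) by apply: H; rewrite j0.
by move=> /sub/visibleP[].
Qed.

Lemma low_code b i : 0 < i -> valid_upto b i.+1 -> low e i = nth [::] lows i.
Proof.
move=> i0 H; have : nth [::] lows i \in choices b (visible e i) by apply: H; rewrite i0 /=.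
move=> /choices_sub sub.
have sub' : subseq (nth [::] lows i) (rev (iota 0 i)) by apply: subseq_trans sub (filter_subseq _ _).
have Uri : uniq (rev (iota 0 i)) by rewrite rev_uniq iota_uniq.
have E := subseq_uniqP Uri sub'; rewrite [RHS]E.
apply: eq_in_filter => j; rewrite mem_rev mem_iota add0n => /= ji.
rewrite /code_adj; case: (_ \in nth _ _ i) => //=; apply/negP => /(valid_lt H (ltnW ji)) [_].
by rewrite ltnNge ltnW.
Qed.

(** [codes] only carries a state along; the induction identifies that state with the list of visible
    vertices of the graph of the code. *)
Lemma codes_valid b k i : 0 < i -> valid_upto b i ->
  drop i lows \in codes b k i (visible e i) ->
  valid_upto b (i + k) /\ size (drop i lows) = k.
Proof.
elim: k i => [|k IH] i i0 Hi; first by rewrite addn0 inE => /eqP ->.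
move=> /flattenP[_ /mapP[A hA ->] /mapP[d hd Ed]].
have EA : nth [::] lows i = A by rewrite -[i]addn0 -nth_drop Ed.
have Ed' : drop i.+1 lows = d by rewrite -add1n -drop_drop Ed /= drop0.
have Hi1 : valid_upto b i.+1.
  move=> j /andP[j0]; rewrite ltnS leq_eqVlt => /orP[/eqP -> |ji]; first by rewrite EA.
  by apply: Hi; rewrite j0.
have Elow := low_code i0 Hi1.
rewrite -addSnnS Ed /= -Ed'.
have [] // := IH i.+1 isT Hi1; last by move=> ? ->.
rewrite Ed' visibleS //; first by rewrite Elow EA.
  exact: code_adj_sym.
by rewrite Elow EA; apply: contraTneq hA => ->; apply: choices_nil.
Qed.

(** A new vertex gets the colour opposite to that of its lowest neighbour. Its other lower
    neighbours sit at positions of the same parity in an alternating list, so they have the colour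
    of the lowest one. *)
Lemma code_coloring n : valid_upto true n -> forall i, 0 < i <= n ->
  exists2 c, alternating c (visible e i) & forall x y, x < i -> y < i -> e x y -> c x != c y.
Proof.
move=> H; elim=> // -[_ _|i IH /andP[_ iN]].
  by exists xpredT => // -[] // [] // _ _; rewrite /code_adj.
have [c alt col] := IH (ltnW iN).
have Hi : valid_upto true i.+2.
  by move=> j /andP[j0 ji]; apply: H; rewrite j0 (leq_trans ji).
have Elow := low_code (ltn0Sn i) Hi.
have hA : low e i.+1 \in choices true (visible e i.+1) by rewrite Elow; apply: H.
have low0 : low e i.+1 != [::] by apply: contraTneq hA => ->; apply: choices_nil.
have last_in := choices_last hA.
have last_lt : last 0 (low e i.+1) < i.+1 by move: last_in; rewrite mem_low => /andP[].
pose c' x := if x == i.+1 then ~~ c (last 0 (low e i.+1)) else c x.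
have c'E x : x < i.+1 -> c' x = c x by move=> lt; rewrite /c' ltn_eqF.
exists c'.
  apply: alternating_visibleS => //.
  - exact: code_adj_sym.
  - by rewrite (c'E _ last_lt) /c' eqxx; case: (c _).
  - exact: choices_sub hA.
  rewrite /alternating (@eq_in_sorted _ (gtn i.+1) _ (fun x y => c x != c y)) //.
    by move=> x y; rewrite !inE => xi yi; rewrite !c'E.
  by apply/allP => x /visibleP[].
have new y : y < i.+1 -> e i.+1 y -> c' i.+1 != c' y.
  move=> yi ey; have yl : y \in low e i.+1 by rewrite mem_low yi.
  rewrite (c'E _ yi) /c' eqxx.
  have sub := mem_subseq (choices_sub hA).
  rewrite (alternating_parity alt (sub _ yl)) (alternating_parity alt (sub _ last_in)).
  rewrite (choices_parity (uniq_visible _ _) hA yl).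
  by case: (_ (+) _).
move=> x y; rewrite !ltnS leq_eqVlt => /orP[/eqP -> |xi]; rewrite leq_eqVlt => /orP[/eqP -> |yi].
- by rewrite /code_adj orbb => /(valid_lt Hi (ltnSn _))[_]; rewrite ltnn.
- exact: new.
- by rewrite code_adj_sym eq_sym; apply: new.
by rewrite !c'E //; apply: col.
Qed.

End GraphOfCode.

Lemma code_contour b n code : 1 < n -> code \in codes b n.-1 1 [:: 0] ->
  [/\ contour_graph n (code_adj code), code_of (code_adj code) 1 n.-1 = code &
      b -> exists c, proper_coloring (code_adj code) c].
Proof.
move=> n1 h; set e := code_adj code.
have H0 : valid_upto code b 1 by case=> [|[]].
have [] := @codes_valid code b n.-1 1 isT H0; first by rewrite /= drop0 visible1.
rewrite /= drop0 (_ : 1 + n.-1 = n); last by lia.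
move=> Hn size_c.
have mem_lt i j : j \in nth [::] ([::] :: code) i -> [/\ 0 < i, j < i & i < n].
  case: (ltnP i n) => iN.
    by move=> hj; have [? ?] := valid_lt Hn iN hj; split.
  by rewrite nth_default //= size_c; lia.
have G : contour_graph n e.
  split.
  - exact: code_adj_sym.
  - by move=> i; rewrite /e /code_adj orbb; apply/negP => /mem_lt[_]; rewrite ltnn.
  - by move=> i j /orP[/mem_lt[]|/mem_lt[_ ij jn]] //; apply: ltn_trans ij jn.
  - move=> i iN; have := choices_last (Hn i iN); set j := last _ _ => hj.
    by exists j; [case: (mem_lt _ _ hj)|rewrite /e /code_adj hj].
  move=> i j k l ij jk kl eik ejl.
  have jl : j \in nth [::] ([::] :: code) l.
    case/orP: ejl => // /mem_lt[_ lj _]; lia.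
  have [l0 _ ln] := mem_lt _ _ jl.
  have /choices_sub/mem_subseq sub := Hn l (introT andP (conj l0 ln)).
  by have /visibleP[_ /(_ i k ij jk kl)] := sub _ jl; rewrite -/e eik.
split=> //.
  apply: (@eq_from_nth _ [::]); first by rewrite size_map size_iota.
  move=> i; rewrite size_map size_iota => iN.
  rewrite (nth_map 0) ?size_iota // nth_iota //.
  apply: (@low_code code b) => // j /andP[j0 ji]; apply: Hn; rewrite j0; lia.
move=> bt; rewrite bt in Hn.
have [|c _ col] := code_coloring Hn (i := n); first by rewrite leqnn (ltnW n1).
exists c => i j eij; apply: col => //; first by apply: (contour_lt G); apply: eij.
have eji : e j i by rewrite /e code_adj_sym.
by apply: (contour_lt G); apply: eji.
Qed.

Lemma code_adj_of n e i j : contour_graph n e -> code_adj (code_of e 1 n.-1) i j = e i j.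
Proof.
move=> G; have E k : nth [::] ([::] :: code_of e 1 n.-1) k = if k < n then low e k else [::].
  case: k => [|k]; first by case: ifP.
  rewrite /=; case: ifP => kn; last by rewrite nth_default // size_map size_iota; lia.
  by rewrite (nth_map 0) ?size_iota ?nth_iota //; lia.
have main x y : (y \in nth [::] ([::] :: code_of e 1 n.-1) x) = (y < x) && e x y.
  rewrite E; case: ifP => xn; first by rewrite mem_low.
  by apply/esym/negP => /andP[_ /(contour_lt G)]; rewrite xn.
rewrite /code_adj !main; case: (ltngtP j i) => ji //=; rewrite ?orbF //.
  by rewrite (contour_sym G).
by rewrite ji (contour_irr G).
Qed.

(** * Isomorphism classes of rooted maps *)

Lemma map_iso_sym M M' : map_iso M M' -> map_iso M' M.
Proof.
case: M M' => [|m] [|m'] //= [h [[g hg gh] hn he hr]].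
exists g; split; first by exists h.
- by move=> d; rewrite -{1}[d]gh -hn hg.
- by move=> d; rewrite -{1}[d]gh -he hg.
by rewrite -hr hg.
Qed.

Lemma map_iso_trans M M' M'' : map_iso M M' -> map_iso M' M'' -> map_iso M M''.
Proof.
case: M M' M'' => [|m] [|m'] [|m''] //= [h [hb hn he hr]] [k [kb kn ke kr]].
exists (k \o h); split=> [|d|d|] /=; first exact: bij_comp.
- by rewrite hn kn.
- by rewrite he ke.
by rewrite hr.
Qed.

(** The list of representatives shows that the set of classes is finite, so that [fset_set] does
    count it. *)
Lemma num_iso_classes_enum (C : eqType) (s : seq C) (F : C -> rooted_map) (P : set rooted_map) :
    uniq s -> (forall c, c \in s -> P (F c)) ->
    (forall M, P M -> exists2 c, c \in s & map_iso (F c) M) ->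
    {in s &, forall c d, map_iso (F c) (F d) -> c = d} ->
  num_iso_classes P = size s.
Proof.
move=> Us PF onto inj.
have iso_refl c : map_iso (F c) (F c).
  by case: (F c) => //= m; exists id; split=> //; exists id.
have classE M M' : map_iso M M' -> iso_class M = iso_class M'.
  move=> MM'; apply/funext => N; apply/propext; split => h.
    exact: map_iso_trans (map_iso_sym MM') h.
  exact: map_iso_trans MM' h.
have Ul : uniq [seq iso_class (F c) | c <- s].
  rewrite map_inj_in_uniq // => c d cs ds E; apply: inj => //.
  have : iso_class (F d) (F d) := iso_refl d.
  by rewrite -E.
rewrite /num_iso_classes (_ : [set _ | _ in P]%classic =
    [set` [fset x in [seq iso_class (F c) | c <- s]]%fset]%classic).
  by rewrite set_fsetK card_fseq undup_id // size_map.
apply/funext => A; apply/propext; split.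
  move=> [M /onto[c cs iso] <-]; rewrite /= in_fset; apply/mapP; exists c => //.
  exact/esym/classE.
by rewrite /= in_fset => /mapP[c cs ->]; exists (F c) => //; apply: PF.
Qed.

Definition draws n e (M : rooted_map) : Prop :=
  if M is EdgedRootedMap m
  then exists lab, drawing n e (node m) (edge m) (Defs.root m) lab else False.

Lemma tail_eq (m : edged_map) (d d' : dart m) : (tail d = tail d') <-> fconnect (node m) d d'.
Proof.
rewrite /tail -mem_porbit_fconnect porbit_sym -eq_porbit_mem.
by split => [->|/eqP].
Qed.

Lemma draws_outerplanar n e M : draws n e M ->
  [/\ outerplanar M, num_vertices M = n & bipartite M <-> exists c, proper_coloring e c].
Proof.
case: M => // m [lab D]; split.
- split; first split.
  + move=> d /tail_eq; rewrite (drawing_vertex D) => /eqP E.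
    by have := drawing_adj D d; rewrite -E (contour_irr (drawing_graph D)).
  + move=> d d' /tail_eq + /tail_eq; rewrite !(drawing_vertex D) => /eqP E /eqP E'.
    exact: (drawing_inj D).
  move=> v /imsetP[x _ ->]; have [d xd rd] := drawing_outer D x.
  by exists d; rewrite ?mem_porbit_fconnect // /outer_face mem_porbit_fconnect.
- exact: (drawing_card_vertices D).
split=> [[c col]|[c col]].
  have ex i : exists x, forall j, e i j -> lab x = i.
    have [[j eij]|none] := pselect (exists j, e i j); last first.
      by exists (Defs.root m) => j eij; case: none; exists j.
    by have [x xi _] := drawing_onto D eij; exists x.
  pose d i := sval (cid (ex i)).
  have dE i j : e i j -> lab (d i) = i by rewrite /d; case: (cid _) => /= x h /h.
  exists (fun i => c (tail (d i))) => i j eij.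
  have [x xi xj] := drawing_onto D eij.
  have -> : tail (d i) = tail x.
    by apply/tail_eq; rewrite (drawing_vertex D) (dE i j) ?xi.
  have -> : tail (d j) = Defs.head x.
    apply/tail_eq; rewrite (drawing_vertex D) (dE j i) ?xj //.
    by rewrite (contour_sym (drawing_graph D)).
  exact/eqP/col.
pose c' (v : {set dart m}) := if [pick x in v] is Some x then c (lab x) else true.
have c'E x : c' (tail x) = c (lab x).
  rewrite /c'; case: pickP => [y|/(_ x)]; last by rewrite porbit_id.
  by rewrite mem_porbit_fconnect (drawing_vertex D) => /eqP ->.
by exists c' => d; rewrite !c'E; apply/eqP/col/(drawing_adj D).
Qed.

Lemma outerplanar_draws n M : 1 < n -> outerplanar M -> num_vertices M = n ->
  exists e, draws n e M.
Proof.
case: M => [|m] n1; first by move=> _ E; rewrite -E in n1.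
move=> [[no_loop no_multi] outer] En.
exists (label_adj (node m) (edge m) (Defs.root m)); rewrite -En.
exists (vertex_label (node m) (edge m) (Defs.root m)).
apply: outer_drawing.
- exact: edge_involutive.
- exact: edge_neq.
- exact: edged_map_planar.
- by move=> x; apply/negP => /tail_eq; apply: no_loop.
- by move=> x y h1 h2; apply: no_multi; apply/tail_eq.
move=> x; have [d] := outer (tail x) (imset_f _ isT).
by rewrite mem_porbit_fconnect /outer_face mem_porbit_fconnect => h1 h2; exists d.
Qed.

Lemma draws_iso n e M M' : draws n e M -> draws n e M' -> map_iso M M'.
Proof. by case: M M' => // m [|m'] // [lab D] [lab' D']; apply: drawing_iso D D'. Qed.

Lemma draws_inj n e n' e' M M' : draws n e M -> draws n' e' M' -> map_iso M M' -> e =2 e'.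
Proof.
move=> dM dM' iso.
have sub n1 e1 M1 n2 e2 M2 : draws n1 e1 M1 -> draws n2 e2 M2 -> map_iso M1 M2 ->
    forall i j, e1 i j -> e2 i j.
  case: M1 M2 => // m1 [|m2] // [lab1 D1] [lab2 D2] [h [/bij_inj hI hn he hr]].
  exact: drawing_iso_sub D1 D2 hI hn he hr.
move=> i j; apply/idP/idP; first exact: (sub _ _ _ _ _ _ dM dM' iso).
exact: (sub _ _ _ _ _ _ dM' dM (map_iso_sym iso)).
Qed.

Lemma draws_exists n e : 1 < n -> contour_graph n e -> exists M, draws n e M.
Proof.
move=> n1 /(drawing_exists n1)[T [s [a [r [lab /edged_map_of_drawing[m [lab' D]]]]]]].
by exists (EdgedRootedMap m), lab'.
Qed.

(** The condition [b -> bipartite M] treats both counts at once. The walk starts with vertex [0]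
    alone visible and adds the other [n.-1] vertices. *)
Lemma num_iso_classes_walks (b : bool) n : 1 < n ->
  num_iso_classes [set M | [/\ outerplanar M, b -> bipartite M & num_vertices M = n]]%classic =
  walks (weight b) n.-1 1.
Proof.
move=> n1; rewrite -[1]/(size [:: 0]) -(@size_codes b n.-1 1 [:: 0]) //.
(* The default is never reached on a code, whose graph always has a drawing. *)
pose F c := if pselect (exists M, draws n (code_adj c) M) is left h then sval (cid h)
  else VertexMap.
have FP c : c \in codes b n.-1 1 [:: 0] -> draws n (code_adj c) (F c).
  move=> /(code_contour n1)[G _ _]; rewrite /F; case: pselect => [h|]; first by case: cid.
  by case; apply: draws_exists.
apply: (num_iso_classes_enum (F := F)).
- exact: uniq_codes.
- move=> c hc; have [h1 h2 h3] := draws_outerplanar (FP c hc).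
  by split=> // bt; apply/h3; case: (code_contour n1 hc) => _ _; apply.
- move=> M [oM bM nM]; have [e dM] := outerplanar_draws n1 oM nM.
  have [_ _ hb] := draws_outerplanar dM.
  have G : contour_graph n e by case: M dM {oM bM nM hb} => // m [lab]; apply: drawing_graph.
  have [c col] : exists c, b -> proper_coloring e c.
    case: (b) bM => bM; last by exists xpredT.
    by have [c ?] := hb.1 (bM isT); exists c.
  have hc := code_of_contour n1 G col; exists (code_of e 1 n.-1) => //.
  have E : code_adj (code_of e 1 n.-1) = e.
    by apply/funext => i; apply/funext => j; apply: code_adj_of.
  by have := FP _ hc; rewrite E => dF; apply: draws_iso dF dM.
move=> c d hc hd iso; have E := draws_inj (FP c hc) (FP d hd) iso.
have [_ <- _] := code_contour n1 hc; have [_ <- _] := code_contour n1 hd.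
by apply: eq_map => j; apply: eq_filter => k; apply: E.
Qed.

Lemma num_outerplanarE n : 1 < n -> num_outerplanar n = walks (weight false) n.-1 1.
Proof.
move=> n1; rewrite -(num_iso_classes_walks false n1); congr num_iso_classes.
by apply/funext => M; apply/propext; split => [[? ?]|[? ? ?]].
Qed.

Lemma num_bipartite_outerplanarE n :
  1 < n -> num_bipartite_outerplanar n = walks (weight true) n.-1 1.
Proof.
move=> n1; rewrite -(num_iso_classes_walks true n1); congr num_iso_classes.
by apply/funext => M; apply/propext; split => [[? ? ?]|[? b ?]]; split=> //; apply: b.
Qed.

(** * Formal power series *)

Local Open Scope ring_scope.

(** A name of its own, so that the product is the convolution and not the pointwise one. *)
Definition fps (R : Type) : Type := nat -> R.

HB.instance Definition _ (R : Type) := gen_eqMixin (fps R).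
HB.instance Definition _ (R : Type) := gen_choiceMixin (fps R).

Section FpsRing.
Variable R : comNzRingType.
Implicit Types f g h : fps R.

Definition fps_add f g : fps R := fun n => f n + g n.
Definition fps_opp f : fps R := fun n => - f n.
Definition fps_mul f g : fps R := fun n => \sum_(i < n.+1) f i * g (n - i)%N.
Definition fpsC (c : R) : fps R := fun n => c *+ (n == 0%N).

Let tr N f : {poly R} := \poly_(i < N) f i.

(** Lets associativity and commutativity be inherited from polynomials. *)
Lemma fps_mul_coef N f g n : (n < N)%N -> fps_mul f g n = (tr N f * tr N g)`_n.
Proof.
move=> nN; rewrite coefM; apply: eq_bigr => i _; rewrite !coef_poly.
by rewrite (leq_ltn_trans (leq_ord i)) // (leq_ltn_trans (leq_subr _ _)).
Qed.

Lemma fps_mulA : associative fps_mul.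
Proof.
move=> f g h; apply/funext => n.
transitivity ((tr n.+1 f * tr n.+1 g * tr n.+1 h)`_n).
  rewrite -mulrA coefM; apply: eq_bigr => i _.
  by rewrite coef_poly ltn_ord -fps_mul_coef // ltnS leq_subr.
rewrite coefM; apply: eq_bigr => i _.
by rewrite -fps_mul_coef // coef_poly ltnS leq_subr.
Qed.

Lemma fps_mulC : commutative fps_mul.
Proof.
move=> f g; apply/funext => n.
by rewrite !(@fps_mul_coef n.+1) // mulrC.
Qed.

Lemma fps_mul1 : left_id (fpsC 1) fps_mul.
Proof.
move=> f; apply/funext => n; rewrite /fps_mul big_ord_recl /= mul1r subn0.
by rewrite big1 ?addr0 // => i _; rewrite /fpsC /= mul0r.
Qed.

Lemma fps_mulDl : left_distributive fps_mul fps_add.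
Proof.
move=> f g h; apply/funext => n; rewrite /fps_add /fps_mul -big_split.
by apply: eq_bigr => i _; rewrite mulrDl.
Qed.

Lemma fps_addA : associative fps_add.
Proof. by move=> f g h; apply/funext => n; apply: addrA. Qed.
Lemma fps_addC : commutative fps_add.
Proof. by move=> f g; apply/funext => n; apply: addrC. Qed.
Lemma fps_add0 : left_id (fpsC 0) fps_add.
Proof. by move=> f; apply/funext => n; rewrite /fps_add /fpsC mul0rn add0r. Qed.
Lemma fps_addN : left_inverse (fpsC 0) fps_opp fps_add.
Proof. by move=> f; apply/funext => n; rewrite /fps_add /fpsC mul0rn addNr. Qed.

HB.instance Definition _ := GRing.isZmodule.Build (fps R) fps_addA fps_addC fps_add0 fps_addN.

Lemma fps_1neq0 : fpsC 1 != 0 :> fps R.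
Proof. by apply/eqP => /(congr1 (fun f : fps R => f 0%N)) /eqP; rewrite oner_eq0. Qed.

HB.instance Definition _ := GRing.Zmodule_isComNzRing.Build (fps R)
  fps_mulA fps_mulC fps_mul1 fps_mulDl fps_1neq0.

Lemma fpsD f g n : (f + g) n = f n + g n. Proof. by []. Qed.
Lemma fpsN f n : (- f) n = - f n. Proof. by []. Qed.
Lemma fpsB f g n : (f - g) n = f n - g n. Proof. by []. Qed.
Lemma fps0 n : (0 : fps R) n = 0. Proof. exact: mul0rn. Qed.
Lemma fps1 n : (1 : fps R) n = (n == 0%N)%:R. Proof. by []. Qed.
Lemma fpsM f g n : (f * g) n = \sum_(i < n.+1) f i * g (n - i)%N. Proof. by []. Qed.

Lemma fps_sum I (s : seq I) (P : pred I) (F : I -> fps R) n :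
  (\sum_(i <- s | P i) F i) n = \sum_(i <- s | P i) F i n.
Proof. by elim/big_rec2: _ => [|i y1 y2 _ <-]; rewrite ?fps0. Qed.

Lemma fpsC_zmod : zmod_morphism fpsC.
Proof. by move=> x y; apply/funext => n; rewrite fpsB /fpsC mulrnBl. Qed.

Lemma fpsCM c f n : (fpsC c * f) n = c * f n.
Proof.
rewrite fpsM big_ord_recl /= subn0 big1 ?addr0 // => i _.
by rewrite /fpsC /= mul0r.
Qed.

Lemma fpsC_monoid : monoid_morphism fpsC.
Proof.
split=> // x y; apply/funext => n; rewrite fpsCM /fpsC.
by case: n => [|n]; rewrite ?mulr1n ?mulr0n ?mulr0.
Qed.

HB.instance Definition _ := GRing.isZmodMorphism.Build R (fps R) fpsC fpsC_zmod.
HB.instance Definition _ := GRing.isMonoidMorphism.Build R (fps R) fpsC fpsC_monoid.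

Definition fpsX : fps R := fun n => (n == 1%N)%:R.

Lemma fpsXM0 f : (fpsX * f) 0%N = 0.
Proof. by rewrite fpsM big_ord_recl big_ord0 /fpsX mul0r addr0. Qed.

Lemma fpsXMS f n : (fpsX * f) n.+1 = f n.
Proof.
rewrite fpsM big_ord_recl /fpsX mul0r add0r big_ord_recl /= subn1 mul1r.
by rewrite big1 ?addr0 // => i _; rewrite mul0r.
Qed.

Lemma fpsM0 f g : (f * g) 0%N = f 0%N * g 0%N.
Proof. by rewrite fpsM big_ord_recl big_ord0 addr0. Qed.

End FpsRing.

Lemma fps_mul_eq0 (R : idomainType) (u f : fps R) : u 0%N != 0 -> u * f = 0 -> f = 0.
Proof.
move=> u0 uf; apply/funext => n; elim/ltn_ind: n => n IH; apply/eqP.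
have /eqP := congr1 (fun g : fps R => g n) uf; rewrite fpsM big_ord_recl subn0.
rewrite big1 ?addr0 ?fps0 ?mulf_eq0 ?(negbTE u0) // => i _.
rewrite IH ?fps0 ?mulr0 //; have := ltn_ord i; rewrite /= /fintype.bump leq0n add1n; lia.
Qed.

(** Stands in for division: formulas for quotients are verified after multiplication by a
    denominator with nonzero constant term. *)
Lemma fps_mulI (R : idomainType) (u f g : fps R) : u 0%N != 0 -> u * f = u * g -> f = g.
Proof.
move=> u0 E; apply/eqP; rewrite -subr_eq0; apply/eqP; apply: (fps_mul_eq0 u0).
by rewrite mulrBr E subrr.
Qed.

(** [Y L] is divisible by every power of [D], and [D] has no constant term. *)
Lemma fps_infinite_descent (R : comNzRingType) (D : fps R) (Y : nat -> fps R) :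
  D 0%N = 0 -> (forall L, Y L = D * Y L.+1) -> forall L, Y L = 0.
Proof.
move=> D0 HY L; apply/funext => n; elim/ltn_ind: n L => n IH L.
rewrite HY fpsM big_ord_recl D0 mul0r add0r big1 ?fps0 // => i _.
by rewrite IH ?fps0 ?mulr0 //; have := ltn_ord i; rewrite /= /fintype.bump leq0n add1n; lia.
Qed.

(** * The kernel method *)

Section WalkSeries.
Variable R : idomainType.

Definition walk_series (w : nat -> nat) L : fps R := fun n => (walks w n L)%:R.

Lemma walk_seriesE w L : walk_series w L =
  1 + fpsX R * \sum_(j < L) (w j)%:R * walk_series w (L - j).+1.
Proof.
apply/funext => -[|n]; first by rewrite fpsD fpsXM0 addr0.
rewrite fpsD fpsXMS fps1 add0r fps_sum /walk_series /= natr_sum; apply: eq_bigr => j _.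
have -> : ((w j)%:R : fps R) = fpsC (w j)%:R by rewrite rmorph_nat.
by rewrite fpsCM natrM.
Qed.

Lemma walk_series0 w : walk_series w 0 = 1.
Proof. by rewrite walk_seriesE big_ord0 mulr0 addr0. Qed.

(* Kernel method: [D] annihilates the kernel of the recurrence for [F], so that
   [Y], where the second unknown has been eliminated, satisfies [Y L = D * Y L.+1]. *)
Lemma walk_series_outerplanar (D : fps R) : D 0%N = 0 ->
  D * (1 - 2 * D) = fpsX R -> walk_series (weight false) 1 * (1 - D) = 1.
Proof.
move=> D0 HD; set F := walk_series (weight false).
(* The weights double at each step, so the terms with [j > 0] add up to twice the sum for [F L]. *)
have rec L : F L.+1 = 1 + (fpsX R * F L.+2 + 2 * (F L - 1)).
  have EL : F L - 1 = fpsX R * \sum_(j < L) (weight false j)%:R * F (L - j).+1.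
    by rewrite {1}/F walk_seriesE addrC addKr.
  rewrite EL {1}/F walk_seriesE; congr (1 + _); rewrite big_ord_recl subn0 mul1r mulrDr.
  congr (_ + _); rewrite mulrCA; congr (_ * _); rewrite mulr_sumr; apply: eq_bigr => j _.
  by rewrite /weight /= /fintype.bump leq0n /= add1n expnS natrM subSS mulrA.
(* In the shift [z] the recurrence has the characteristic polynomial [X z^2 - z + 2 = (D z - 1) ((1
   - 2 D) z - 2)]. Applying the second factor leaves a sequence governed by the first; [1 - D] and
   [+ 1] absorb the inhomogeneous term. *)
pose Y L := (1 - D) * ((1 - 2 * D) * F L.+1 - 2 * F L) + 1.
have Y0 : Y 0%N = 0.
  apply: (fps_infinite_descent D0) => L.
  have := rec L.+1 => E.
  rewrite /Y.
  have -> : D * ((1 - D) * ((1 - 2 * D) * F L.+2 - 2 * F L.+1) + 1) =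
    (1 - D) * ((D * (1 - 2 * D)) * F L.+2 - 2 * D * F L.+1) + D by ring.
  rewrite HD (rec L); ring.
have u0 : (1 - 2 * D) 0%N != 0.
  by rewrite fpsB fpsM0 D0 mulr0 subr0 fps1 oner_eq0.
apply: (fps_mulI u0); move: Y0; rewrite /Y /F walk_series0 -/F => Y0.
rewrite mulr1 -[RHS]addr0 -Y0; ring.
Qed.

Lemma walk_series_bipartite (D : fps R) : D 0%N = 0 ->
  D - 2 * D ^+ 3 = fpsX R * (1 + D) -> walk_series (weight true) 1 * (1 - D) = 1.
Proof.
move=> D0 HD; set F := walk_series (weight true).
have rec1 : F 1 = 1 + fpsX R * F 2.
  by rewrite {1}/F walk_seriesE big_ord1 subn0 mul1r.
(* Here the weights double every two positions, so two terms are split off before the sum for [F L]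
   appears. *)
have rec L : F L.+2 = 1 + (fpsX R * (F L.+3 + F L.+2) + 2 * (F L - 1)).
  have EL : F L - 1 = fpsX R * \sum_(j < L) (weight true j)%:R * F (L - j).+1.
    by rewrite {1}/F walk_seriesE addrC addKr.
  rewrite EL {1}/F walk_seriesE; congr (1 + _); rewrite 2!big_ord_recl !subn0 !mul1r addrA mulrDr.
  congr (_ + _); rewrite mulrCA; congr (_ * _); rewrite mulr_sumr; apply: eq_bigr => j _.
  by rewrite /weight /= /fintype.bump leq0n /= !add1n expnS natrM !subSS mulrA.
(* The quotient [X / D]. The characteristic polynomial [X z^3 + (X - 1) z^2 + 2] factors as
   [(D z - 1) (a z^2 - 2 D z - 2)]. *)
pose a := 1 - fpsX R - 2 * D ^+ 2.
have aD : D * a = fpsX R.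
  have -> : D * a = D - 2 * D ^+ 3 - fpsX R * D by rewrite /a; ring.
  rewrite HD; ring.
pose Y L := (1 - D) * (a * F L.+2 - 2 * D * F L.+1 - 2 * F L) + 1.
have Y0 : Y 0%N = 0.
  apply: (fps_infinite_descent D0) => L; rewrite /Y.
  have -> : D * ((1 - D) * (a * F L.+3 - 2 * D * F L.+2 - 2 * F L.+1) + 1) =
    (1 - D) * ((D * a) * F L.+3 - 2 * D ^+ 2 * F L.+2 - 2 * D * F L.+1) + D by ring.
  rewrite aD.
  have := rec L; set F3 := F L.+3; set F2 := F L.+2; set F0 := F L => E.
  have E' : F2 - fpsX R * F3 - fpsX R * F2 - 2 * F0 + 1 = 0.
    by rewrite {1}E; ring.
  rewrite -[RHS]addr0 -[X in _ = _ + X](mulr0 (1 - D)) -E' /a; ring.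
have u0 : (1 - 2 * D ^+ 2) 0%N != 0.
  by rewrite fpsB expr2 !fpsM0 D0 !mulr0 subr0 fps1 oner_eq0.
apply: (fps_mulI u0); have : D * Y 0%N = 0 by rewrite Y0 mulr0.
rewrite /Y /F walk_series0 -/F.
have -> : D * ((1 - D) * (a * F 2 - 2 * D * F 1 - 2 * 1) + 1) =
   (1 - D) * ((D * a) * F 2 - 2 * D ^+ 2 * F 1 - 2 * D) + D by ring.
rewrite aD => E; rewrite mulr1 -[RHS](addr0) -E rec1; ring.
Qed.

End WalkSeries.

Local Open Scope classical_set_scope.

(** * Series as fixed points, with bounds in a weighted norm *)

Section Contraction.
Variable R : realType.
Implicit Types f g : fps R.

Definition contractive (Phi : fps R -> fps R) := forall f g n,
  (forall i, (i < n)%N -> f i = g i) -> Phi f n = Phi g n.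

Lemma contractive_mul (c f g : fps R) n : c 0%N = 0 ->
  (forall i, (i < n)%N -> f i = g i) -> (c * f) n = (c * g) n.
Proof.
move=> c0 h; rewrite !fpsM !big_ord_recl c0 !mul0r; congr (_ + _).
apply: eq_bigr => i _; rewrite h //.
by have := ltn_ord i; rewrite /= /fintype.bump leq0n add1n; lia.
Qed.

(** Products of series without constant term involve only lower coefficients, so replacing [f] by
    its tail makes quadratic maps contractive. The fixed points have no constant term, and the tail
    disappears again. *)
Definition fps_tail f : fps R := fun n => if n == 0%N then 0 else f n.

Lemma contractive_tail_mul f g f' g' n :
  (forall i, (i < n)%N -> f i = f' i) -> (forall i, (i < n)%N -> g i = g' i) ->
  (fps_tail f * fps_tail g) n = (fps_tail f' * fps_tail g') n.
Proof.
move=> hf hg; case: n hf hg => [|n] hf hg; first by rewrite !fpsM0 /fps_tail /= !mul0r.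
rewrite !fpsM; apply: eq_bigr => i _; rewrite /fps_tail.
case: (posnP i) => [->|i0]; first by rewrite !mul0r.
case: (eqVneq (n.+1 - i)%N 0%N) => [_|ni]; first by rewrite !mulr0.
rewrite (hg (n.+1 - i)%N); last lia.
by rewrite hf //; lia.
Qed.

Lemma fps_tail_id f : f 0%N = 0 -> fps_tail f = f.
Proof. by move=> f0; apply/funext => -[|n] //; rewrite /fps_tail /= f0. Qed.

End Contraction.

Section WeightedNorm.
Variables (R : realType) (r : R).
Hypothesis r0 : 0 < r.
Implicit Types (f g : fps R) (B C : R).

Definition psum x f n := \sum_(i < n) f i * x ^+ i.
Definition pnorm f n := \sum_(i < n) `|f i| * r ^+ i.
(** A bound on the l^1 norm with weights [r ^+ i], which is submultiplicative; it replaces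
    analyticity in the disc of radius [r]. *)
Definition wbounded B f := forall n, pnorm f n <= B.

Lemma pnorm_ge0 f n : 0 <= pnorm f n.
Proof. by apply: sumr_ge0 => i _; rewrite mulr_ge0 ?exprn_ge0 ?(ltW r0). Qed.

Lemma wbounded_ge0 B f : wbounded B f -> 0 <= B.
Proof. by move=> /(_ 0%N); rewrite /pnorm big_ord0. Qed.

Lemma psum_mul x f g n :
  psum x (f * g) n = \sum_(j < n) (f j * x ^+ j) * psum x g (n - j).
Proof.
elim: n => [|n IH]; first by rewrite /psum !big_ord0.
rewrite {1}/psum big_ord_recr -/(psum x (f * g) n) /= IH big_ord_recr /= subSnn.
rewrite [psum x g 1]/psum big_ord1 expr0 mulr1.
transitivity (\sum_(j < n) f j * x ^+ j * psum x g (n - j) +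
   (\sum_(j < n) f j * x ^+ j * (g (n - j)%N * x ^+ (n - j)) + f n * x ^+ n * g 0%N)).
  congr (_ + _); rewrite fpsM big_ord_recr /= subnn mulrDl mulr_suml; congr (_ + _); last by ring.
  apply: eq_bigr => j _; have jn := ltnW (ltn_ord j).
  have -> : x ^+ n = x ^+ j * x ^+ (n - j) by rewrite -exprD subnKC.
  ring.
rewrite addrA -big_split /=; congr (_ + _); apply: eq_bigr => j _.
rewrite -mulrDr; congr (_ * _); rewrite subSn ?(ltnW (ltn_ord j)) //.
by rewrite /psum big_ord_recr.
Qed.

Lemma pnorm_le f n m : (n <= m)%N -> pnorm f n <= pnorm f m.
Proof.
move=> nm; rewrite -(subnKC nm) /pnorm big_split_ord /= lerDl.
by apply: sumr_ge0 => i _; rewrite mulr_ge0 ?exprn_ge0 ?(ltW r0).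
Qed.

Lemma pnorm_mul f g n : pnorm (f * g) n <= pnorm f n * pnorm g n.
Proof.
pose f' : fps R := fun i => `|f i|; pose g' : fps R := fun i => `|g i|.
apply: (@le_trans _ _ (psum r (f' * g') n)).
  apply: ler_sum => i _; rewrite ler_wpM2r ?exprn_ge0 ?(ltW r0) //.
  rewrite !fpsM; apply: (le_trans (ler_norm_sum _ _ _)).
  by apply: ler_sum => j _; rewrite normrM.
rewrite psum_mul /pnorm mulr_suml; apply: ler_sum => j _.
rewrite ler_wpM2l ?mulr_ge0 ?exprn_ge0 ?(ltW r0) //.
  exact: normr_ge0.
exact: (pnorm_le g (leq_subr j n)).
Qed.

Lemma wboundedM B C f g : wbounded B f -> wbounded C g -> wbounded (B * C) (f * g).
Proof.
move=> hf hg n; apply: le_trans (pnorm_mul _ _ _) _.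
by apply: ler_pM; rewrite ?pnorm_ge0.
Qed.

Lemma wboundedD B C f g : wbounded B f -> wbounded C g -> wbounded (B + C) (f + g).
Proof.
move=> hf hg n; apply: le_trans (lerD (hf n) (hg n)).
rewrite /pnorm -big_split /=; apply: ler_sum => i _.
by rewrite -mulrDl ler_wpM2r ?exprn_ge0 ?(ltW r0) // ler_normD.
Qed.

Lemma wboundedN B f : wbounded B f -> wbounded B (- f).
Proof. by move=> h n; apply: le_trans (h n); apply: ler_sum => i _; rewrite normrN. Qed.

Lemma wboundedB B C f g : wbounded B f -> wbounded C g -> wbounded (B + C) (f - g).
Proof. by move=> hf hg; apply: wboundedD hf (wboundedN hg). Qed.

Lemma wbounded_le B C f : B <= C -> wbounded B f -> wbounded C f.
Proof. by move=> BC h n; apply: le_trans BC. Qed.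

Lemma wboundedC c : wbounded `|c| (fpsC c).
Proof.
case=> [|n]; first by rewrite /pnorm big_ord0.
rewrite /pnorm big_ord_recl /= /fpsC mulr1n expr0 mulr1 big1 ?addr0 //.
by move=> i _; rewrite mulr0n normr0 mul0r.
Qed.

Lemma wboundedX : wbounded r (fpsX R).
Proof.
have r0' := ltW r0.
move=> [|[|n]]; rewrite /pnorm ?big_ord0 // big_ord_recl /fpsX normr0 mul0r add0r.
  by rewrite big_ord0.
rewrite big_ord_recl /= normr1 mul1r expr1 big1 ?addr0 //.
by move=> i _; rewrite normr0 mul0r.
Qed.

(** Coefficient [n] of the iterates from [0] is constant after [n.+1] steps. For the bound, a
    truncation [g] of [f] lies in the ball by induction, and [Phi g] agrees with [f] on one more
    coefficient. *)
Lemma contractive_fixpoint Phi B : contractive Phi -> 0 <= B ->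
  (forall f, wbounded B f -> wbounded B (Phi f)) -> exists2 f, Phi f = f & wbounded B f.
Proof.
move=> cPhi B0 bPhi; pose f : fps R := fun n => iter n.+1 Phi 0 n.
have stab n m : (n < m)%N -> iter m Phi 0 n = f n.
  elim/ltn_ind: n m => n IH [//|m]; rewrite ltnS => nm /=.
  apply: cPhi => i ltin; rewrite (IH i ltin m (leq_trans ltin nm)).
  by rewrite -(IH i ltin n).
have ff : Phi f = f.
  by apply/funext => n; apply: cPhi => i ltin; rewrite -(stab i n).
exists f => //; elim=> [|n IH]; first by rewrite /pnorm big_ord0.
pose g : fps R := fun i => if (i < n)%N then f i else 0.
have gB : wbounded B g.
  move=> m; apply: le_trans IH; rewrite /pnorm.
  case: (leqP m n) => mn.
    apply: le_trans (pnorm_le f mn); apply: ler_sum => i _.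
    by rewrite /g (leq_trans (ltn_ord i)).
  rewrite -(subnKC (ltnW mn)) big_split_ord /= [X in _ + X]big1 ?addr0.
    by apply: ler_sum => i _; rewrite /g /= ltn_ord.
  by move=> i _; rewrite /g /= ltnNge leq_addr /= normr0 mul0r.
apply: le_trans (bPhi _ gB n.+1); apply: ler_sum => i _.
rewrite -{1}ff (cPhi f g) // => j ji.
by rewrite /g (leq_trans ji) // -ltnS.
Qed.

Lemma wbounded_tail B f : wbounded B f -> wbounded B (fps_tail f).
Proof.
move=> h n; apply: le_trans (h n); apply: ler_sum => i _.
rewrite /fps_tail; case: eqP => // _.
by rewrite normr0 mul0r mulr_ge0 ?exprn_ge0 ?(ltW r0).
Qed.

(** Solves [y = (x - y^2) / 2]; the ball of radius [1 / 2] is preserved since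
    [(3 / 4 + 1 / 4) / 2 = 1 / 2]. *)
Lemma fps_sqrt_exists (x : fps R) : x 0%N = 0 -> wbounded (3 / 4) x ->
  exists y : fps R, [/\ y 0%N = 0, wbounded (1 / 2) y & (1 + y) ^+ 2 = 1 + x].
Proof.
move=> x0 xB; pose Phi f := fpsC (1 / 2) * (x - fps_tail f * fps_tail f).
have [|||y Ey yB] := @contractive_fixpoint Phi (1 / 2).
- by move=> f g n fg; rewrite /Phi !fpsCM !fpsB (contractive_tail_mul fg fg).
- by lra.
- move=> f fB; have h := wbounded_tail fB.
  have := wboundedM (wboundedC (1 / 2)) (wboundedB xB (wboundedM h h)).
  by apply: wbounded_le; rewrite ger0_norm; lra.
have y0 : y 0%N = 0.
  by rewrite -Ey /Phi fpsCM fpsB x0 fpsM0 /fps_tail /= mul0r subrr mulr0.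
exists y; split=> //.
rewrite /Phi (fps_tail_id y0) in Ey.
have half : fpsC (1 / 2) * 2 = 1 :> fps R.
  rewrite -(rmorph_nat (@fpsC R) 2) -rmorphM -[RHS](rmorph1 (@fpsC R)).
  by congr fpsC; lra.
have E2 : 2 * y = x - y * y.
  by rewrite -{1}Ey mulrA [2 * _]mulrC half mul1r.
have -> : (1 + y) ^+ 2 = 1 + 2 * y + y * y by ring.
rewrite E2; ring.
Qed.

(** Solves [y = - x - x y] in the unit ball, since [1 / 2 + 1 / 2 = 1]. *)
Lemma fps_inv_exists (x : fps R) : x 0%N = 0 -> wbounded (1 / 2) x ->
  exists y : fps R, [/\ y 0%N = 0, wbounded 1 y & (1 + x) * (1 + y) = 1].
Proof.
move=> x0 xB; pose Phi f := - x - x * f.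
have [|||y Ey yB] := @contractive_fixpoint Phi 1.
- by move=> f g n fg; rewrite /Phi !fpsB (contractive_mul x0 fg).
- by lra.
- move=> f fB; have := wboundedB (wboundedN xB) (wboundedM xB fB).
  by apply: wbounded_le; lra.
exists y; split=> //; first by rewrite -Ey /Phi fpsB fpsN x0 fpsM0 x0 mul0r oppr0 addr0.
have -> : (1 + x) * (1 + y) = 1 + x + x * y + y by ring.
rewrite -[X in _ + X]Ey /Phi; ring.
Qed.

End WeightedNorm.

(** The geometric majorant makes the tails small uniformly in [n], and a fixed initial part
    converges term by term. *)
Lemma tannery (R : realType) (u : nat -> nat -> R) (v : nat -> R) (l C t : R) :
    0 <= t < 1 -> 0 <= C ->
    (forall n k, (0 < n)%N -> (k <= n)%N -> `|u n k| <= C * t ^+ k) ->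
    (forall k, (fun n => u n k) @ \oo --> v k) ->
    (fun n => \sum_(k < n) v k) @ \oo --> l ->
  (fun n => \sum_(k < n.+1) u n k) @ \oo --> l.
Proof.
move=> /andP[t0 t1] C0 uC uv vl; apply/cvgrPdist_le => e e0.
have e3 : 0 < e / 3 by rewrite divr_gt0.
have geo m n : (m <= n)%N -> (0 < n)%N ->
    `|\sum_(k < n.+1) u n k - \sum_(k < m) u n k| <= C / (1 - t) * t ^+ m.
  move=> mn n0; have mn1 : (m <= n.+1)%N := leqW mn.
  have -> : \sum_(k < n.+1) u n k = \sum_(k < m + (n.+1 - m)) u n k by rewrite subnKC.
  rewrite big_split_ord /= addrAC subrr add0r.
  apply: (le_trans (ler_norm_sum _ _ _)).
  apply: (@le_trans _ _ (\sum_(i < n.+1 - m) C * t ^+ m * t ^+ i)).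
    apply: ler_sum => i _; rewrite -mulrA -exprD; apply: uC => //.
    by have := ltn_ord i; lia.
  have -> : C / (1 - t) * t ^+ m = C * t ^+ m * (1 / (1 - t)) by rewrite div1r; ring.
  rewrite -mulr_sumr ler_wpM2l ?mulr_ge0 ?exprn_ge0 //.
  have h : (1 - t) * \sum_(i < n.+1 - m) t ^+ i = 1 - t ^+ (n.+1 - m).
    rewrite -[in RHS](expr1n R (n.+1 - m)%N) subrXX; congr (_ * _).
    by apply: eq_bigr => i _; rewrite expr1n mul1r.
  by rewrite ler_pdivlMr ?subr_gt0 // mulrC h gerBl exprn_ge0.
have cK : (fun n => C / (1 - t) * t ^+ n) @ \oo --> (0 : R).
  by rewrite -[X in _ --> X](mulr0 (C / (1 - t))); apply: cvgMr; apply: cvg_expr; rewrite ger0_norm.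
have [K [hK1 hK2]] : exists K, C / (1 - t) * t ^+ K <= e / 3 /\ `|l - \sum_(k < K) v k| <= e / 3.
  have /cvgr0Pnorm_le/(_ _ e3) h1 := cK; have /cvgrPdist_le/(_ _ e3) h2 := vl.
  have [N _ hN] := filterI h1 h2; exists N; have [? ?] := hN N (leqnn N).
  by split=> //; apply: le_trans (ler_norm _) _.
have cS : (fun n => \sum_(k < K) u n k) @ \oo --> \sum_(k < K) v k.
  elim: K {hK1 hK2} => [|K IH]; first by rewrite big_ord0; under eq_fun do rewrite big_ord0; apply: cvg_cst.
  by rewrite big_ord_recr /=; under eq_fun do rewrite big_ord_recr /=; apply: cvgD.
have /cvgrPdist_le/(_ _ e3) h3 := cS.
have hn : \forall n \near \oo, (K.+1 <= n)%N by exists K.+1.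
apply: filterS (filterI h3 hn) => n [h4 Kn].
have h5 := geo K n (ltnW Kn) (leq_ltn_trans (leq0n K) Kn).
have -> : l - \sum_(k < n.+1) u n k = (l - \sum_(k < K) v k) +
  (\sum_(k < K) v k - \sum_(k < K) u n k) - (\sum_(k < n.+1) u n k - \sum_(k < K) u n k) by ring.
apply: (le_trans (ler_normB _ _)); apply: le_trans (lerD (ler_normD _ _) (le_trans h5 hK1)) _.
apply: le_trans (lerD (lerD hK2 h4) (lexx _)) _.
by rewrite le_eqVlt; apply/orP; left; apply/eqP; field.
Qed.

(** * Values of series at a point inside the disc *)

Section Evaluation.
Variable R : realType.
Implicit Types (f g : fps R).

Definition evals (x : R) f (v : R) := psum x f @ \oo --> v.

Lemma cvg_dist_le (u : nat -> R) (v a c : R) m : u @ \oo --> v ->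
  (forall n, (m <= n)%N -> `|u n - a| <= c) -> `|v - a| <= c.
Proof.
move=> uv H; have : (fun n => `|u n - a|) @ \oo --> `|v - a|.
  by apply: cvg_norm; apply: cvgB uv _; apply: cvg_cst.
move=> /(cvgr_to_le (b := c)); apply.
by near=> n; apply: H; near: n; exists m.
Unshelve. all: end_near. Qed.

Variables (r x : R).
Hypotheses (x0 : 0 <= x) (xr : x < r).
Let r0 : 0 < r := le_lt_trans x0 xr.
Let theta := x / r.

Lemma theta_ge0 : 0 <= theta. Proof. by rewrite divr_ge0 // ltW. Qed.
Lemma theta_lt1 : theta < 1. Proof. by rewrite ltr_pdivrMr // mul1r. Qed.

Lemma theta_exp n : x ^+ n = theta ^+ n * r ^+ n.
Proof. by rewrite -exprMn divfK // gt_eqF. Qed.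

Lemma cvg_theta : (fun n => theta ^+ n) @ \oo --> (0 : R).
Proof. by apply: cvg_expr; rewrite ger0_norm ?theta_ge0 ?theta_lt1. Qed.

Lemma wbounded_term B f n : wbounded r B f -> `|f n * x ^+ n| <= B * theta ^+ n.
Proof.
move=> fB; rewrite normrM (ger0_norm (exprn_ge0 _ x0)) theta_exp mulrCA mulrC.
rewrite ler_wpM2r ?exprn_ge0 ?theta_ge0 //; apply: le_trans (fB n.+1).
by rewrite /pnorm big_ord_recr /= lerDr pnorm_ge0.
Qed.

Lemma psum_tail B f m n : wbounded r B f -> (m <= n)%N ->
  `|psum x f n - psum x f m| <= B * theta ^+ m.
Proof.
move=> fB mn; rewrite -(subnKC mn) /psum big_split_ord /= addrAC subrr add0r.
apply: (le_trans (ler_norm_sum _ _ _)).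
apply: (@le_trans _ _ (theta ^+ m * \sum_(i < n - m) `|f (m + i)%N| * r ^+ (m + i))).
  rewrite mulr_sumr; apply: ler_sum => i _; rewrite normrM mulrCA ler_wpM2l //.
  rewrite (ger0_norm (exprn_ge0 _ x0)) theta_exp ler_wpM2r ?exprn_ge0 ?(ltW r0) //.
  by rewrite exprD ler_piMr ?exprn_ge0 ?theta_ge0 // exprn_ile1 ?theta_ge0 // ltW ?theta_lt1.
rewrite mulrC ler_wpM2r ?exprn_ge0 ?theta_ge0 //; apply: le_trans (fB n).
have -> : pnorm r f n = pnorm r f (m + (n - m)) by rewrite subnKC.
rewrite /pnorm big_split_ord /= lerDr.
exact: (pnorm_ge0 r0 f m).
Qed.

Lemma evals_exists B f : wbounded r B f -> exists2 v, evals x f v & `|v| <= B.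
Proof.
move=> fB; suff /cvg_ex[v fv] : cvgn (psum x f).
  exists v => //; rewrite -[v]subr0.
  apply: (cvg_dist_le (m := 0%N) fv) => n _; rewrite subr0.
  have := psum_tail fB (leq0n n); rewrite expr0 mulr1 [psum x f 0]/psum big_ord0 subr0.
  by [].
have -> : psum x f = series (fun i => f i * x ^+ i).
  by apply/funext => n; rewrite /psum /series /= big_mkord.
apply: normed_cvg; apply: nondecreasing_is_cvgn.
  apply/nondecreasing_seqP => n; rewrite /normed_series_of seriesSr.
  by rewrite lerDl normr_ge0.
exists B => _ [n _ <-]; rewrite /normed_series_of seriesEord /=; apply: le_trans (fB n).
apply: ler_sum => i _; rewrite normrM ler_wpM2l // ger0_norm ?exprn_ge0 //.
by rewrite lerXn2r ?nnegrE ?(ltW r0) ?(ltW xr).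
Qed.

Lemma evals_unique f v w : evals x f v -> evals x f w -> v = w.
Proof. by move=> h1 h2; apply: (cvg_unique _ h1 h2). Qed.

Lemma evalsD f g v w : evals x f v -> evals x g w -> evals x (f + g) (v + w).
Proof.
move=> fv gw; rewrite /evals (_ : psum x (f + g) = psum x f \+ psum x g).
  exact: cvgD.
apply/funext => n; rewrite /psum /= -big_split /=; apply: eq_bigr => i _.
by rewrite -mulrDl.
Qed.

Lemma evalsC c : evals x (fpsC c) c.
Proof.
apply: cvg_near_cst; exists 1%N => // -[//|n] _.
rewrite /psum big_ord_recl /= /fpsC mulr1n expr0 mulr1 big1 ?addr0 //.
by move=> i _; rewrite mulr0n mul0r.
Qed.

Lemma evalsX : evals x (fpsX R) x.
Proof.
apply: cvg_near_cst; exists 2%N => // -[//|[//|n]] _.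
rewrite /psum big_ord_recl big_ord_recl /= /fpsX mul0r add0r mul1r expr1 big1 ?addr0 //.
by move=> i _; rewrite mul0r.
Qed.

(** In [psum_mul] each partial sum of [g] of length [n - j] misses [w] by at most
    [C * theta ^+ (n - j)]. The term of index [j] of [f] supplies the missing factor [theta ^+ j],
    so the total error is at most [B * C * theta ^+ n]. *)
Lemma evalsM B C f g v w : wbounded r B f -> wbounded r C g ->
  evals x f v -> evals x g w -> evals x (f * g) (v * w).
Proof.
move=> fB gC fv gw.
have B0 := wbounded_ge0 fB; have C0 := wbounded_ge0 gC.
have tail m : `|psum x g m - w| <= C * theta ^+ m.
  rewrite distrC; apply: (cvg_dist_le (m := m) gw) => n mn.
  exact: psum_tail gC mn.
have E n : `|psum x (f * g) n - psum x f n * w| <= B * C * theta ^+ n.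
  rewrite psum_mul [psum x f n]/psum mulr_suml -sumrB.
  apply: (le_trans (ler_norm_sum _ _ _)).
  apply: (@le_trans _ _ (\sum_(j < n) C * theta ^+ n * (`|f j| * r ^+ j))); last first.
    have -> : B * C * theta ^+ n = C * theta ^+ n * B by ring.
    rewrite -mulr_sumr; apply: ler_wpM2l; last exact: fB.
    by rewrite mulr_ge0 // exprn_ge0 // theta_ge0.
  apply: ler_sum => j _; rewrite -mulrBr normrM.
  apply: (@le_trans _ _ (`|f j * x ^+ j| * (C * theta ^+ (n - j)))).
    by rewrite ler_wpM2l.
  have -> : theta ^+ n = theta ^+ j * theta ^+ (n - j) by rewrite -exprD subnKC // ltnW.
  rewrite normrM (ger0_norm (exprn_ge0 _ x0)) theta_exp.
  by rewrite le_eqVlt; apply/orP; left; apply/eqP; ring.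
have Efg : psum x (f * g) = (fun n => psum x f n * w) \+ (fun n => psum x (f * g) n - psum x f n * w).
  by apply/funext => n /=; rewrite addrC subrK.
rewrite /evals Efg -[v * w]addr0; apply: cvgD; first exact: cvgMl.
apply/cvgr0Pnorm_le => e e0.
have : (fun n => B * C * theta ^+ n) @ \oo --> B * C * 0 by apply: cvgMr; apply: cvg_theta.
rewrite mulr0 => /cvgr0Pnorm_le/(_ e e0) Hn; apply: filterS Hn => n h.
apply: le_trans (E n) _; apply: le_trans h; exact: ler_norm.
Qed.

End Evaluation.

(** * Central binomial coefficients *)

Section Wallis.
Variable R : realType.
Local Notation mu := (@lebesgue_measure R).

Lemma Rintegral_is_derive (f F : R -> R) (a b : R) : a < b -> continuous f ->
  (forall x : R, is_derive x (1 : R) F (f x)) -> (\int[mu]_(x in `[a, b]) f x)%R = F b - F a.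
Proof.
move=> ab cf dF.
have dF' (x : R) : derivable F x (1 : R) by case: (dF x).
have cF : continuous F by move=> x; apply/differentiable_continuous/derivable1_diffP.
rewrite /Rintegral (@continuous_FTC2 R f F) //.
- exact: continuous_subspaceT.
- split; first by move=> x _; apply: dF'.
    exact/cvg_at_right_filter/cF.
  exact/cvg_at_left_filter/cF.
by move=> x _; rewrite derive1E; case: (dF x).
Qed.

Definition wallis n := (\int[mu]_(x in `[0%R, (pi / 2 : R)%R]) (cos x ^+ n))%R.

Let pihalf_gt0 : 0 < pi / 2 :> R.
Proof. by rewrite divr_gt0 // pi_gt0. Qed.

Lemma continuous_cosX n : continuous (fun x : R => cos x ^+ n).
Proof.
move=> x; apply: (@continuous_comp _ _ _ (@cos R) (fun y => y ^+ n)).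
  exact: continuous_cos.
exact: exprn_continuous.
Qed.

Lemma integrable_cosX n :
  mu.-integrable `[0%R, (pi / 2)%R] (EFin \o (fun x : R => cos x ^+ n)).
Proof.
apply: continuous_compact_integrable; first exact: segment_compact.
exact/continuous_subspaceT/continuous_cosX.
Qed.

Lemma wallis0 : wallis 0 = pi / 2.
Proof.
rewrite /wallis (@Rintegral_is_derive _ id) ?subr0 //; first exact: continuous_cosX.
Qed.

Lemma wallis1 : wallis 1 = 1.
Proof.
rewrite /wallis (@Rintegral_is_derive _ (@sin R)) ?sin_pihalf ?sin0 ?subr0 //.
exact: continuous_cosX.
Qed.

(** The difference of the two integrands is the derivative of [sin x * cos x ^+ n.+1], which
    vanishes at both ends. *)
Lemma wallisSS n : n.+2%:R * wallis n.+2 = n.+1%:R * wallis n.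
Proof.
have dF (x : R) : is_derive x (1 : R) (fun x : R => sin x * cos x ^+ n.+1)
    (n.+2%:R * cos x ^+ n.+2 - n.+1%:R * cos x ^+ n).
  have -> : (fun x : R => sin x * cos x ^+ n.+1) = (@sin R) * (@cos R) ^+ n.+1.
    by apply/funext => y; rewrite /= !fctE.
  have d2 := is_deriveX n.+1 (is_derive_cos x).
  apply: (is_derive_eq (is_deriveM (is_derive_sin x) d2)).
  have s2 : sin x ^+ 2 = 1 - cos x ^+ 2 by rewrite -(cos2Dsin2 x) addrC addKr.
  rewrite /GRing.scale /= fctE [cos x ^+ n.+2]exprS [cos x ^+ n.+1]exprS.
  have -> : sin x * (n.+1%:R * cos x ^+ n * - sin x) = - (n.+1%:R * cos x ^+ n * sin x ^+ 2).
    by ring.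
  by rewrite s2 -[n.+2]addn1 natrD; ring.
have int_eq : (\int[mu]_(x in `[0%R, (pi / 2 : R)%R])
    (n.+2%:R * cos x ^+ n.+2 - n.+1%:R * cos x ^+ n))%R = 0.
  rewrite (Rintegral_is_derive _ _ dF) ?cos_pihalf ?sin0 ?expr0n ?mulr0 ?mul0r ?subrr //.
  by move=> x; apply: cvgB; apply: cvgMr; apply: continuous_cosX.
move: int_eq; rewrite RintegralB //.
- rewrite !RintegralZl //; try exact: integrable_cosX.
  by move/eqP; rewrite subr_eq0 => /eqP.
- exact: (integrableZl _ _ (integrable_cosX _)).
- exact: (integrableZl _ _ (integrable_cosX _)).
Qed.

Lemma wallis_le n : wallis n.+1 <= wallis n.
Proof.
apply: le_Rintegral => //; try exact: integrable_cosX.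
move=> x /=; rewrite in_itv /= => /andP[x0 xp]; rewrite exprS.
have c0 : 0 <= cos x by apply: cos_ge0_pihalf; rewrite xp (le_trans _ x0) // oppr_le0 ltW.
by rewrite ler_piMl ?exprn_ge0 // cos_le1.
Qed.

(* The central binomial coefficient 'C(2n, n) divided by 4 ^ n. *)
Fixpoint cbin n : R := if n is m.+1 then cbin m * (m.*2.+1%:R / m.*2.+2%:R) else 1.

Lemma cbin_gt0 n : 0 < cbin n.
Proof. by elim: n => //= n IH; rewrite mulr_gt0 // divr_gt0 // ltr0n. Qed.

Lemma wallis_even n : wallis n.*2 = pi / 2 * cbin n.
Proof.
elim: n => [|n IH]; first by rewrite wallis0 mulr1.
have := wallisSS n.*2; rewrite doubleS IH => E.
have h : (n.*2.+2%:R : R) != 0 by rewrite pnatr_eq0.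
apply: (mulfI h); rewrite E /=; move: h; move: (n.*2.+2%:R) (n.*2.+1%:R) => c d h.
by field.
Qed.

Lemma wallis_odd n : wallis n.*2.+1 = (n.*2.+1%:R * cbin n)^-1.
Proof.
elim: n => [|n IH]; first by rewrite wallis1 mulr1 invr1.
have := wallisSS n.*2.+1; rewrite doubleS IH => E.
have h0 : (n.*2.+1%:R : R) != 0 by rewrite pnatr_eq0.
have h1 : (n.*2.+2%:R : R) != 0 by rewrite pnatr_eq0.
have h : (n.*2.+3%:R : R) != 0 by rewrite pnatr_eq0.
have hb : cbin n != 0 by rewrite gt_eqF ?cbin_gt0.
apply: (mulfI h); rewrite E /=; move: h h0 h1 hb.
move: (cbin n) (n.*2.+3%:R) (n.*2.+2%:R) (n.*2.+1%:R) => c d e f h h0 h1 hb.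
by field; rewrite h h0 h1 hb.
Qed.

(** The two inequalities express that the Wallis integrals of indices [2n], [2n + 1] and [2n + 2]
    decrease. *)
Lemma cbin_sqr_bounds n :
  2 / pi <= n.*2.+1%:R * cbin n ^+ 2 <= 2 / pi * (n.*2.+2%:R / n.*2.+1%:R).
Proof.
have b0 := cbin_gt0 n; have p0 := @pi_gt0 R.
have k0 : (0 : R) < n.*2.+1%:R by rewrite ltr0n.
have k1 : (0 : R) < n.*2.+2%:R by rewrite ltr0n.
have u0 : 0 < n.*2.+1%:R * cbin n by rewrite mulr_gt0.
have h1 := wallis_le n.*2; have h2 := wallis_le n.*2.+1.
rewrite -doubleS wallis_even wallis_odd /= in h2.
rewrite wallis_even wallis_odd in h1.
move: (@pi R) (cbin n) (n.*2.+1%:R) (n.*2.+2%:R) p0 b0 k0 k1 u0 h1 h2.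
move=> p b c d p0 b0 k0 k1 u0 h1 h2.
apply/andP; split.
  rewrite ler_pdivrMr //.
  have := ler_wpM2r (ltW u0) h1; rewrite mulVf ?gt_eqF // => h.
  have -> : c * b ^+ 2 * p = 2 * (p / 2 * b * (c * b)) by field.
  by rewrite -[leLHS]mulr1 ler_wpM2l.
have := ler_wpM2r (ltW u0) h2; rewrite mulVf ?gt_eqF // => h.
have -> : c * b ^+ 2 = (p / 2 * (b * (c / d)) * (c * b)) * (2 / p * (d / c)).
  by field; rewrite !gt_eqF.
by rewrite -[leRHS]mul1r ler_wpM2r // mulr_ge0 // divr_ge0 // ltW.
Qed.

Lemma cvg_natr_ratio (a b c d : nat) : (0 < c)%N ->
  (fun n => (a * n + b)%:R / (c * n + d).+1%:R : R) @ \oo --> (a%:R / c%:R : R).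
Proof.
move=> c0; have c0' : (c%:R : R) != 0 by rewrite pnatr_eq0 -lt0n.
have E n : (a * n + b)%:R / (c * n + d).+1%:R =
    a%:R / c%:R + (b%:R - a%:R * d.+1%:R / c%:R) * (c * n + d).+1%:R^-1 :> R.
  have h : ((c * n + d).+1%:R : R) != 0 by rewrite pnatr_eq0.
  move: h; rewrite -addnS !natrD !natrM.
  move: c0' {c0}; move: (c%:R) (n%:R) (d.+1%:R) (a%:R) (b%:R) => x y z t u c0' h.
  by field; rewrite c0' h.
set e := b%:R - a%:R * d.+1%:R / c%:R in E.
suff : (fun n => a%:R / c%:R + e * (c * n + d).+1%:R^-1) @ \oo --> a%:R / c%:R + e * 0.
  by rewrite mulr0 addr0 (funext E).
apply: cvgD; first exact: cvg_cst.
apply: cvgMr; apply: (squeeze_cvgr _ (cvg_cst 0) (@cvg_harmonic R)).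
near=> n; rewrite invr_ge0 ler0n /= lef_pV2 ?posrE ?ltr0n // ler_nat ltnS.
by rewrite (leq_trans (leq_pmull n c0)) // leq_addr.
Unshelve. all: end_near. Qed.

Lemma cvg_cbin_sqrt : (fun n => cbin n * Num.sqrt n.+1%:R) @ \oo --> (Num.sqrt pi)^-1.
Proof.
have p0 := @pi_gt0 R.
have -> : (fun n => cbin n * Num.sqrt n.+1%:R) = (fun n => Num.sqrt (cbin n ^+ 2 * n.+1%:R)).
  apply/funext => n; rewrite sqrtrM ?exprn_ge0 ?(ltW (cbin_gt0 n)) // sqrtr_sqr ger0_norm //.
  exact: ltW (cbin_gt0 n).
rewrite -sqrtrV ?(ltW p0) //.
suff H : (fun n => cbin n ^+ 2 * n.+1%:R) @ \oo --> pi^-1.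
  by apply: (cvg_comp _ _ H); apply: sqrt_continuous.
have e1 : 2 / pi * (1%:R / 2%:R) = pi^-1 :> R.
  by move: (@pi R) p0 => p p0; field; rewrite gt_eqF.
have e2 : 2 / pi * (2%:R / 2%:R) * (1%:R / 2%:R) = pi^-1 :> R.
  by move: (@pi R) p0 => p p0; field; rewrite gt_eqF.
have h1 : (fun n => 2 / pi * ((1 * n + 1)%:R / (2 * n + 0).+1%:R)) @ \oo --> (pi^-1 : R).
  by rewrite -[X in _ --> X]e1; apply: cvgMr; apply: cvg_natr_ratio.
have h2 : (fun n => 2 / pi * ((2 * n + 2)%:R / (2 * n + 0).+1%:R) *
     ((1 * n + 1)%:R / (2 * n + 0).+1%:R)) @ \oo --> (pi^-1 : R).
  by rewrite -[X in _ --> X]e2; apply: cvgM; [apply: cvgMr|]; apply: cvg_natr_ratio.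
apply: (squeeze_cvgr _ h1 h2); near=> n.
have /andP[l u] := cbin_sqr_bounds n.
have k0 : (0 : R) < n.*2.+1%:R by rewrite ltr0n.
rewrite mul1n addn0 addn1 mul2n (_ : (n.*2 + 2 = n.*2.+2)%N); last by lia.
have -> : cbin n ^+ 2 * n.+1%:R = (n.*2.+1%:R * cbin n ^+ 2) * (n.+1%:R / n.*2.+1%:R).
  by move: k0; move: (n.*2.+1%:R) (n.+1%:R) => c d k0; field; rewrite gt_eqF.
by rewrite !ler_wpM2r // divr_ge0 // ltW.
Unshelve. all: end_near. Qed.

End Wallis.

(** * The square root singularity *)

Lemma cvg_eq_from (R : realType) N (u v : nat -> R) (l : R) :
  (forall n, (N <= n)%N -> u n = v n) -> u @ \oo --> l -> v @ \oo --> l.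
Proof.
move=> E; rewrite -(cvg_shiftn N u) -(cvg_shiftn N v).
have -> // : [sequence u (n + N)%N]_n = [sequence v (n + N)%N]_n.
by apply/funext => n /=; rewrite E // leq_addl.
Qed.

Section SqrtSeries.
Variable R : realType.

(* The coefficients of the square root of [1 - X]. *)
Definition sqrt_coef : fps R := fun n => cbin R n / (1 - 2 * n%:R).
Local Notation p := sqrt_coef.

Lemma odd_natr_neq0 (n : nat) : (1 - 2 * n%:R : R) != 0.
Proof.
rewrite subr_eq0 eq_sym -natrM -[1]/(1%:R) eqr_nat; apply/eqP => /(congr1 odd).
by rewrite mul2n odd_double.
Qed.

(** The differential equation [(1 - X) p' = - p / 2], coefficient by coefficient. *)
Lemma sqrt_coefS n : n.+1%:R * p n.+1 = (n%:R - 1 / 2) * p n.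
Proof.
have h1 := odd_natr_neq0 n; have h2 := odd_natr_neq0 n.+1.
have h3 : (n.+1%:R : R) != 0 by rewrite pnatr_eq0.
rewrite /p [cbin _ n.+1]/=; have -> : (n.*2.+2%:R : R) = 2 * n.+1%:R by rewrite -natrM; congr (_ *+ _); lia.
have -> : (n.*2.+1%:R : R) = - (1 - 2 * n.+1%:R).
  by rewrite -addn1 natrD -mul2n natrM -[n.+1]addn1 natrD; ring.
have -> : (n%:R - 1 / 2 : R) = - (1 / 2) * (1 - 2 * n%:R) by field.
move: h1 h2 h3; set x : R := 1 - 2 * n%:R; set y : R := 1 - 2 * _; set z : R := n.+1%:R.
move: (cbin R n) x y z => b x y z h1 h2 h3.
by field; rewrite h1 h2 h3.
Qed.

Lemma sqrt_coef0 : p 0%N = 1.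
Proof. by rewrite /p /= mulr0 subr0 divr1. Qed.

(** The derivation [th], which is [X d/dX], turns the recurrence for [p] into [th q = X (th q - q)]
    for [q = p * p]. This is a recurrence of order one, whose factor [n - 1] kills all coefficients
    from index [2] on. *)
Lemma sqrt_coef_sqr : p * p = 1 - fpsX R.
Proof.
pose th (f : fps R) : fps R := fun n => n%:R * f n.
have thM f g : th (f * g) = th f * g + f * th g.
  apply/funext => n; rewrite /th fpsD !fpsM mulr_sumr -big_split /=.
  apply: eq_bigr => i _; have -> : (n%:R : R) = i%:R + (n - i)%:R.
    by rewrite -natrD subnKC // -ltnS.
  ring.
have thp : th p = fpsX R * (th p - fpsC (1 / 2) * p).
  apply/funext => -[|n]; first by rewrite fpsXM0 /th mul0r.
  by rewrite fpsXMS fpsB fpsCM /th sqrt_coefS; ring.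
have two_half : fpsC (1 / 2) * 2 = 1 :> fps R.
  rewrite -(rmorph_nat (@fpsC R) 2) -rmorphM -[RHS](rmorph1 (@fpsC R)).
  by congr fpsC; lra.
have thq : th (p * p) = fpsX R * (th (p * p) - p * p).
  have E : th (p * p) = 2 * p * th p by rewrite thM; ring.
  have {1}-> : th (p * p) = fpsX R * (2 * p * th p - (fpsC (1 / 2) * 2) * (p * p)).
    by rewrite E {1}thp; ring.
  by rewrite two_half mul1r E.
have rec n : n.+1%:R * (p * p) n.+1 = (n%:R - 1) * (p * p) n.
  have := congr1 (fun f : fps R => f n.+1) thq; rewrite fpsXMS fpsB /th => ->.
  by rewrite mulrBl mul1r.
have q0 : (p * p) 0%N = 1 by rewrite fpsM0 sqrt_coef0 mulr1.
have q1 : (p * p) 1%N = -1.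
  by have := rec 0%N; rewrite q0 mul1r mulr1 sub0r.
have q2 n : (p * p) n.+2 = 0.
  elim: n => [|n IH].
    by have /eqP := rec 1%N; rewrite subrr mul0r mulf_eq0 pnatr_eq0 /= => /eqP.
  by have /eqP := rec n.+2; rewrite IH mulr0 mulf_eq0 pnatr_eq0 /= => /eqP.
apply/funext => -[|[|n]]; rewrite fpsB fps1 /fpsX /= ?subr0 ?sub0r //.
Qed.

Definition sqrt_series (c : R) : fps R := fun n => p n * c ^+ n.

Lemma sqrt_series_sqr c : sqrt_series c ^+ 2 = 1 - fpsC c * fpsX R.
Proof.
apply/funext => n; rewrite expr2.
have -> : (sqrt_series c * sqrt_series c) n = (p * p) n * c ^+ n.
  rewrite !fpsM mulr_suml; apply: eq_bigr => i _; rewrite /sqrt_series.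
  have -> : c ^+ n = c ^+ i * c ^+ (n - i) by rewrite -exprD subnKC // -ltnS.
  ring.
rewrite sqrt_coef_sqr !fpsB fps1 fpsCM /fpsX.
by case: n => [|[|n]] /=; rewrite ?mulr0 ?mulr1 ?mul1r ?subr0 ?sub0r ?mulN1r ?expr1 ?mul0r ?expr0 ?oppr0 ?mul0r.
Qed.

Lemma sqrt_coef_lt0 n : (0 < n)%N -> p n < 0.
Proof.
move=> n0; rewrite /p pmulr_rlt0 ?cbin_gt0 // invr_lt0 subr_lt0.
have : (1 : R) <= n%:R by rewrite ler1n.
by lra.
Qed.

(** A step from [j] to [j + 1] multiplies the left side by [1 + (j - 1) / (2 j^2)]. This
    monotonicity makes the ratio bound below polynomial in [k], uniformly in [n]. *)
Lemma sqrt_coef_mono m n : (0 < m)%N -> (m <= n)%N ->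
  `|p m| * m%:R ^+ 2 <= `|p n| * n%:R ^+ 2.
Proof.
move=> m0 mn; rewrite -(subnKC mn); elim: (n - m)%N => [|k IH]; first by rewrite addn0.
apply: le_trans IH _; rewrite addnS; set j := (m + k)%N.
have j0 : (0 < j)%N by rewrite /j; lia.
have j1 : (1 : R) <= j%:R by rewrite ler1n.
rewrite !ltr0_norm ?sqrt_coef_lt0 //.
have E := sqrt_coefS j; have pj := sqrt_coef_lt0 j0.
have -> : - p j.+1 * j.+1%:R ^+ 2 = - (j.+1%:R * p j.+1) * j.+1%:R by ring.
rewrite E -[j.+1]addn1 natrD.
have -> : - ((j%:R - 1 / 2) * p j) * (j%:R + 1%:R) = - p j * ((j%:R - 1 / 2) * (j%:R + 1%:R)) by ring.
apply: ler_wpM2l; first by rewrite oppr_ge0 ltW.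
move: (j%:R : R) j1 => x x1.
have -> : (x - 1 / 2) * (x + 1%:R) = x ^+ 2 + (x - 1) / 2 by field.
by lra.
Qed.

(** For [k < n] use [n <= (n - k) * k.+1] and monotonicity; the factor [2] pays for [k = n], where
    [p 0 = 1] is compared with [p 1 = - 1 / 2]. *)
Lemma sqrt_coef_ratio n k : (0 < n)%N -> (k <= n)%N ->
  `|p (n - k)%N / p n| <= 2 * k.+1%:R ^+ 2.
Proof.
move=> n0 kn; have pn := sqrt_coef_lt0 n0.
have pn' : 0 < `|p n| by rewrite normr_gt0 lt_eqF.
rewrite normrM normfV ler_pdivrMr //.
case: (posnP (n - k)) => [nk|nk].
  have -> : k = n by lia.
  rewrite subnn sqrt_coef0 normr1.
  have h := @sqrt_coef_mono 1 n isT n0.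
  have p1 : p 1%N = - (1 / 2).
    by have := sqrt_coefS 0; rewrite sqrt_coef0; lra.
  rewrite p1 normrN ger0_norm in h; last by lra.
  have : (n%:R : R) ^+ 2 <= n.+1%:R ^+ 2 by rewrite lerXn2r ?nnegrE // ler_nat.
  move=> /(ler_wpM2l (ltW pn')) h'; have := le_trans h h'.
  by rewrite expr1n; lra.
have h := sqrt_coef_mono nk (leq_subr k n).
have nk2 : (n%:R : R) ^+ 2 <= ((n - k)%:R * k.+1%:R) ^+ 2.
  by rewrite lerXn2r ?nnegrE ?mulr_ge0 // -natrM ler_nat; nia.
have nk0 : 0 < ((n - k)%:R : R) ^+ 2 by rewrite exprn_gt0 // ltr0n.
rewrite -(ler_pM2r nk0); apply: le_trans h _.
have := ler_wpM2l (ltW pn') nk2; rewrite exprMn => h2; apply: le_trans h2 _.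
have -> : 2 * k.+1%:R ^+ 2 * `|p n| * (n - k)%:R ^+ 2 =
  2 * (`|p n| * ((n - k)%:R ^+ 2 * k.+1%:R ^+ 2)) by ring.
by rewrite ler_peMl ?mulr_ge0 ?exprn_ge0 // ler1n.
Qed.

Lemma cvg_sqrt_coef_ratio k : (fun n => p (n - k)%N / p n) @ \oo --> (1 : R).
Proof.
suff H : (fun n => p n / p (n + k)%N) @ \oo --> (1 : R).
  rewrite -(cvg_shiftn k) (_ : [sequence _]_n = fun n => p n / p (n + k)%N) //.
  by apply/funext => n /=; rewrite addnK.
elim: k => [|k IH].
  apply: cvg_near_cst; exists 1%N => // n n0; rewrite addn0 divff // lt_eqF //.
  exact: sqrt_coef_lt0.
have step : (fun n => p (n + k)%N / p (n + k).+1) @ \oo --> (1 : R).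
  rewrite -cvg_shiftS (_ : [sequence _]_n =
    fun n => (2 * n + (2 * k + 4))%:R / (2 * n + 2 * k).+1%:R).
    by have := @cvg_natr_ratio R 2 (2 * k + 4)%N 2 (2 * k)%N isT; rewrite divff.
  apply/funext => n /=; set j := (n.+1 + k)%N.
  have E := sqrt_coefS j.
  have pj : p j.+1 != 0 by rewrite lt_eqF ?sqrt_coef_lt0.
  have h1 : ((2 * n + 2 * k).+1%:R : R) != 0 by rewrite pnatr_eq0.
  have e1 : ((2 * n + 2 * k).+1%:R : R) = 2 * (j%:R - 1 / 2).
    rewrite (_ : j%:R = n%:R + k%:R + 1); last by rewrite -natrD natr1.
    by rewrite -[LHS]natr1 natrD !natrM; field.
  have e2 : ((2 * n + (2 * k + 4))%:R : R) = 2 * j.+1%:R.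
    by rewrite -natrM; congr (_ *+ _); rewrite /j; lia.
  apply/eqP; rewrite eqr_div // e1 e2; apply/eqP.
  have -> : p j * (2 * (j%:R - 1 / 2)) = 2 * ((j%:R - 1 / 2) * p j) by ring.
  by rewrite -E; ring.
have h : (fun n => p n / p (n + k)%N * (p (n + k)%N / p (n + k).+1)) @ \oo --> (1 : R).
  by rewrite -[X in _ --> X]mulr1; exact: cvgM IH step.
apply: (@cvg_eq_from R 1 _ _ 1 _ h) => n n0; rewrite addnS.
have pj : p (n + k)%N != 0 by rewrite lt_eqF ?sqrt_coef_lt0 ?addn_gt0 ?n0.
by rewrite mulrA divfK.
Qed.

(** * Transfer of asymptotics to products with the square root *)

Section Transfer.
Variables (r rho B : R) (H : fps R).
Hypotheses (rho0 : 0 < rho) (rhor : rho / r * (121 / 100) < 1) (rho_lt : rho < r).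
Hypothesis HB : wbounded r B H.

Let S : fps R := sqrt_series rho^-1.
Let t := rho / r * (121 / 100).

Let t01 : 0 <= t < 1.
Proof.
rewrite rhor andbT; apply: mulr_ge0; last by lra.
by apply: divr_ge0; apply: ltW; rewrite // (lt_trans rho0 rho_lt).
Qed.

(** The square of Bernoulli's inequality for [11 / 10]. The polynomial factor is thus absorbed by a
    geometric one, small enough that [t] stays below [1]. *)
Lemma sqr_succ_le (k : nat) : (k.+1%:R : R) ^+ 2 <= 100 * (121 / 100) ^+ k.
Proof.
have h : 1 + k%:R / 10 <= (11 / 10 : R) ^+ k.
  elim: k => [|k IH]; first by rewrite expr0; lra.
  rewrite exprS -[k.+1]addn1 natrD.
  have k0 : 0 <= (k%:R : R) by [].
  apply: le_trans (ler_wpM2l _ IH); last by lra.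
  by lra.
have -> : (121 / 100 : R) ^+ k = ((11 / 10) ^+ k) ^+ 2.
  by rewrite exprAC; congr (_ ^+ _); field.
have k0 : 0 <= (k%:R : R) by [].
have h2 : (1 + k%:R / 10) ^+ 2 <= ((11 / 10 : R) ^+ k) ^+ 2.
  by rewrite lerXn2r ?nnegrE // ?exprn_ge0 //; lra.
rewrite -[k.+1]addn1 natrD; nra.
Qed.

Lemma transfer_term n k : (0 < n)%N -> (k <= n)%N ->
  `|H k * rho ^+ k * (p (n - k)%N / p n)| <= 200 * B * t ^+ k.
Proof.
move=> n0 kn; rewrite normrM.
have h1 := wbounded_term (ltW rho0) rho_lt k HB.
have h2 := le_trans (sqrt_coef_ratio n0 kn) (ler_wpM2l (ler0n R 2) (sqr_succ_le k)).
apply: le_trans (ler_pM (normr_ge0 _) (normr_ge0 _) h1 h2) _.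
have -> : t ^+ k = (rho / r) ^+ k * (121 / 100) ^+ k by rewrite -exprMn.
move: ((rho / r) ^+ k) ((121 / 100) ^+ k) => x y.
by rewrite le_eqVlt; apply/orP; left; apply/eqP; ring.
Qed.

Lemma sqrt_series_neq0 n : (0 < n)%N -> S n != 0.
Proof.
move=> n0; rewrite /S /sqrt_series; apply: mulf_neq0.
  by rewrite lt_eqF ?sqrt_coef_lt0.
by rewrite expf_neq0 // invr_eq0 gt_eqF.
Qed.

(** The quotient is the sum of [H k * rho ^+ k * (p (n - k) / p n)], whose last factor tends to [1]
    for fixed [k]. *)
Lemma cvg_mul_sqrt_series h : evals rho H h -> (fun n => (H * S) n / S n) @ \oo --> h.
Proof.
move=> Hh; have B0 := wbounded_ge0 HB.
have key : (fun n => \sum_(k < n.+1) H k * rho ^+ k * (p (n - k)%N / p n)) @ \oo --> h.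
  apply: (tannery (u := fun n k => H k * rho ^+ k * (p (n - k)%N / p n))
    (v := fun k => H k * rho ^+ k) t01 _ transfer_term) => //.
    by rewrite mulr_ge0.
  move=> k; rewrite -[X in _ --> X]mulr1.
  by apply: cvgMr; apply: cvg_sqrt_coef_ratio.
apply: (cvg_eq_from (N := 1) _ key) => n n0; apply/esym.
rewrite fpsM mulr_suml; apply: eq_bigr => k _; rewrite /S /sqrt_series.
have -> : rho^-1 ^+ n = rho^-1 ^+ (n - k) * rho^-1 ^+ k by rewrite -exprD subnK // -ltnS.
have pn : p n != 0 by rewrite lt_eqF ?sqrt_coef_lt0.
have rk : rho ^+ k != 0 by rewrite expf_neq0 // gt_eqF.
have rnk : rho ^+ (n - k) != 0 by rewrite expf_neq0 // gt_eqF.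
rewrite !exprVn; move: pn rk rnk; move: (p n) (rho ^+ k) (rho ^+ (n - k)) (H k) (p (n - k)%N).
by move=> x y z u v x0 y0 z0; field; rewrite x0 y0 z0.
Qed.

Lemma cvg_wbounded_div_sqrt_series : (fun n => H n / S n) @ \oo --> (0 : R).
Proof.
have B0 := wbounded_ge0 HB.
have tn : (fun n => 200 * B * t ^+ n) @ \oo --> (0 : R).
  rewrite -[X in _ --> X](mulr0 (200 * B)); apply: cvgMr; apply: cvg_expr.
  by case/andP: t01 => t0 t1; rewrite ger0_norm.
apply/cvgr0Pnorm_le => e e0; have /cvgr0Pnorm_le/(_ e e0) Hn := tn.
have n1 : \forall n \near \oo, (0 < n)%N by exists 1%N.
apply: filterS (filterI Hn n1) => n [h n0]; apply: le_trans h.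
have -> : H n / S n = H n * rho ^+ n * (p (n - n)%N / p n).
  rewrite subnn sqrt_coef0 /S /sqrt_series exprVn.
  have pn : p n != 0 by rewrite lt_eqF ?sqrt_coef_lt0.
  have rk : rho ^+ n != 0 by rewrite expf_neq0 // gt_eqF.
  by move: pn rk; move: (p n) (rho ^+ n) (H n) => x y z x0 y0; field; rewrite x0 y0.
by apply: le_trans (transfer_term n0 (leqnn n)) _; apply: ler_norm.
Qed.

End Transfer.

End SqrtSeries.

(** * Asymptotics *)

Section Tame.
Variables (R : realType) (rho : R).
Hypotheses (rho0 : 0 < rho) (rho_le : rho <= 1 / 5).
Implicit Types (f g : fps R) (v w : R).

(* The radius 1 / 4 exceeds both singularities, 1 / 8 and 3 sqrt 3 - 5. *)
Definition tame f v := (exists B, wbounded (1 / 4) B f) /\ evals rho f v.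

Let r0 : 0 < 1 / 4 :> R. Proof. by lra. Qed.
Let rho_lt : rho < 1 / 4. Proof. by apply: le_lt_trans rho_le _; lra. Qed.
(** At the extreme value [rho = 1 / 5] the left side is [0.968]. *)
Let rhor : rho / (1 / 4) * (121 / 100) < 1.
Proof.
have -> : rho / (1 / 4) * (121 / 100) = rho * (484 / 100) by field.
by move: rho_le; lra.
Qed.

Lemma tameD f g v w : tame f v -> tame g w -> tame (f + g) (v + w).
Proof.
move=> [[B fB] fv] [[C gC] gw]; split; last exact: evalsD.
by exists (B + C); apply: wboundedD.
Qed.

Lemma tameM f g v w : tame f v -> tame g w -> tame (f * g) (v * w).
Proof.
move=> [[B fB] fv] [[C gC] gw]; split; first by exists (B * C); apply: wboundedM.
exact: (evalsM (ltW rho0) rho_lt fB gC).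
Qed.

Lemma tameC c : tame (fpsC c) c.
Proof. by split; [exists `|c|; apply: wboundedC|apply: evalsC]. Qed.

Lemma tameX : tame (fpsX R) rho.
Proof. by split; [exists (1 / 4); apply: wboundedX|apply: evalsX]. Qed.

Lemma tame_nat n : tame n%:R n%:R.
Proof. by rewrite -(rmorph_nat (@fpsC R)); apply: tameC. Qed.

Lemma tame1 : tame 1 1.
Proof. exact: tame_nat 1%N. Qed.

Lemma tameN f v : tame f v -> tame (- f) (- v).
Proof.
move=> h; have := tameM (tameC (-1)) h; rewrite rmorphN rmorph1 !mulN1r.
by [].
Qed.

Lemma tameB f g v w : tame f v -> tame g w -> tame (f - g) (v - w).
Proof. by move=> h1 h2; apply: tameD h1 (tameN h2). Qed.

Lemma tame_unique f v w : tame f v -> tame f w -> v = w.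
Proof. by move=> [_ h1] [_ h2]; apply: evals_unique h1 h2. Qed.

Lemma wbounded_tame B f : wbounded (1 / 4) B f -> exists2 v, tame f v & `|v| <= B.
Proof.
move=> fB; have [v fv vB] := evals_exists (ltW rho0) rho_lt fB.
by exists v => //; split=> //; exists B.
Qed.

Lemma tame_inv_exists (x : fps R) (v : R) : x 0%N = 0 -> wbounded (1 / 4) (1 / 2) x -> tame x v ->
  exists (y : fps R) w, [/\ (1 + x) * y = 1, tame y w & (1 + v) * w = 1].
Proof.
move=> x0 xB xv; have [y [y0 yB E]] := fps_inv_exists r0 x0 xB.
have [w yw _] := wbounded_tame yB.
exists (1 + y), (1 + w); split=> //; first exact: tameD tame1 yw.
apply: (tame_unique (f := (1 + x) * (1 + y))); last by rewrite E; apply: tame1.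
exact: tameM (tameD tame1 xv) (tameD tame1 yw).
Qed.

Lemma tame_sqrt_exists (x : fps R) (v : R) : x 0%N = 0 -> wbounded (1 / 4) (3 / 4) x -> tame x v ->
  exists (y : fps R) w, [/\ y ^+ 2 = 1 + x, y 0%N = 1, tame y w & 0 < w].
Proof.
move=> x0 xB xv; have [y [y0 yB E]] := fps_sqrt_exists r0 x0 xB.
have [w yw wB] := wbounded_tame yB.
exists (1 + y), (1 + w); split=> //; first by rewrite fpsD y0 addr0.
  exact: tameD tame1 yw.
by move: wB; rewrite ler_norml; lra.
Qed.

(** The scaling is by [(n + 1)^(3/2)] because coefficient [n] counts maps with [n + 1] vertices. *)
Lemma cvg_sqrt_series_scaled :
  (fun n => sqrt_series rho^-1 n * rho ^+ n * (n.+1%:R * Num.sqrt n.+1%:R)) @ \oo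
    --> - (1 / (2 * Num.sqrt pi)).
Proof.
have sp0 : Num.sqrt pi != 0 :> R by rewrite gt_eqF // sqrtr_gt0 pi_gt0.
have h : (fun n => (n.+1%:R / (1 - 2 * n%:R) : R)) @ \oo --> (- (1 / 2) : R).
  have h1 : (fun n => - ((1 * n + 2)%:R / (2 * n + 0).+1%:R) : R) @ \oo --> (- (1%:R / 2%:R) : R).
    by apply: cvgN; apply: cvg_natr_ratio.
  rewrite -cvg_shiftS; move: h1; rewrite (_ : - (1%:R / 2%:R) = - (1 / 2) :> R) //.
  apply: (cvg_eq_from (N := 0)) => n _ /=.
  have h2 := odd_natr_neq0 R n.+1.
  have -> : ((2 * n + 0).+1%:R : R) = - (1 - 2 * n.+1%:R).
    by rewrite addn0 -[LHS]natr1 natrM -[in RHS]natr1; ring.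
  have -> : ((1 * n + 2)%:R : R) = n.+2%:R by congr (_ *+ _); lia.
  move: h2; move: (n.+2%:R : R) => a; set b : R := 1 - _; move: b => b b0.
  by field.
have h2 := cvgM (@cvg_cbin_sqrt R) h.
have E : (Num.sqrt pi)^-1 * - (1 / 2) = - (1 / (2 * Num.sqrt pi)) :> R by field.
rewrite E in h2.
apply: (cvg_eq_from (N := 0) _ (h2 _)) => n _ /=.
rewrite /sqrt_series /sqrt_coef exprVn.
have rn : rho ^+ n != 0 by rewrite expf_neq0 // gt_eqF.
have := odd_natr_neq0 R n; move: rn.
move: (cbin R n) (rho ^+ n) (n.+1%:R : R) (Num.sqrt n.+1%:R) => a d c b d0.
set x : R := 1 - _; move: x => x x0.
by field; rewrite d0 x0.
Qed.

Lemma powR_three_halves n : n.+1%:R `^ (- (3%:R / 2%:R)) = (n.+1%:R * Num.sqrt n.+1%:R)^-1 :> R.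
Proof.
have n0 : (0 : R) < n.+1%:R by rewrite ltr0n.
rewrite powRN; congr (_^-1).
have -> : (3%:R / 2%:R : R) = 1 + 2^-1 by field.
rewrite powRD; last by apply/implyP => _; rewrite gt_eqF.
by rewrite powRr1 ?ltW // powR12_sqrt ?ltW.
Qed.

(* The dominant singularity of [G - H * sqrt (1 - X / rho)] is the one of the
   square root, the other coefficients being smaller by an exponential factor. *)
Lemma sqrt_singularity_asymptotic (a : nat -> nat) (b : nat -> R) (F G H : fps R) (g h K : R) :
    (forall n, (0 < n)%N -> (a n.+1)%:R = F n) ->
    F = G - H * sqrt_series rho^-1 -> tame G g -> tame H h ->
    K != 0 -> K * (2 * Num.sqrt pi) = h * rho ->
    (forall n, b n.+1 = K * rho ^- n.+1 * n.+1%:R `^ (- (3%:R / 2%:R))) ->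
  asymptotic_to (fun n => (a n)%:R) b.
Proof.
move=> aF FE [[B GB] _] [[C HC] Hh] K0 Kh bE.
rewrite /asymptotic_to -cvg_shiftS.
set S := sqrt_series _ in FE.
have cF : (fun n => F n / S n) @ \oo --> (- h : R).
  have h1 := cvg_wbounded_div_sqrt_series rho0 rhor rho_lt GB.
  have h2 := cvg_mul_sqrt_series rho0 rhor rho_lt HC Hh.
  have h3 := cvgB h1 h2; rewrite sub0r in h3; apply: (cvg_eq_from (N := 0) _ (h3 _)) => n _ /=.
  by rewrite FE fpsB mulrBl.
have sp0 : Num.sqrt pi != 0 :> R by rewrite gt_eqF // sqrtr_gt0 pi_gt0.
(* The factors [S n] cancel; [rho / K] brings in the constant and the extra power of [rho] due to
   the shift of the index. *)
have h3 := cvgM cF (cvgM (cvg_cst (rho / K)) cvg_sqrt_series_scaled).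
have E1 : - h * (rho / K * - (1 / (2 * Num.sqrt pi))) = 1.
  have -> : - h * (rho / K * - (1 / (2 * Num.sqrt pi))) = h * rho / (K * (2 * Num.sqrt pi)).
    by field; rewrite K0 sp0.
  by rewrite -Kh divff // mulf_neq0 // mulf_neq0.
rewrite E1 in h3.
apply: (cvg_eq_from (N := 1) _ (h3 _ _ _)) => n n0 /=.
rewrite -/S (aF _ n0) bE powR_three_halves.
have s0 : S n != 0 by apply: (sqrt_series_neq0 rho0 n0).
have n1 : (n.+1%:R : R) != 0 by rewrite pnatr_eq0.
have n2 : Num.sqrt n.+1%:R != 0 :> R by rewrite gt_eqF // sqrtr_gt0 ltr0n.
have rn : rho ^+ n != 0 by rewrite expf_neq0 // gt_eqF.
have r1 : rho != 0 by rewrite gt_eqF.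
rewrite exprS; move: s0 n1 n2 rn.
move: (S n) (F n) (rho ^+ n) (n.+1%:R : R) (Num.sqrt _) => x y w z u x0 z0 u0 w0.
by field; rewrite x0 z0 u0 w0 K0 r1.
Qed.

End Tame.

(** * Outerplanar maps: explicit generating function *)

Section Outerplanar.
Variable R : realType.

Lemma fpsC_natE n : fpsC n%:R = n%:R :> fps R.
Proof. exact: (rmorph_nat (@fpsC R) n). Qed.

Theorem outerplanar_asymptotic :
  asymptotic_to (fun n : nat => (num_outerplanar n)%:R : R)
    (fun n : nat => (8%:R ^+ n * n%:R `^ (- (3%:R / 2%:R))) / (36%:R * Num.sqrt pi)).
Proof.
pose rho : R := 1 / 8; have rho0 : 0 < rho by rewrite /rho; lra.
have rho_le : rho <= 1 / 5 by rewrite /rho; lra.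
pose S : fps R := sqrt_series rho^-1; pose X := fpsX R.
have SS : S ^+ 2 = 1 - 8 * X.
  by rewrite sqrt_series_sqr; congr (_ - _ * _); rewrite -fpsC_natE; congr fpsC; rewrite /rho; field.
(* With [8 * c = 1] as the only relation, the fractions are handled by [ring]; [D] is
   [(1 - S) / 4]. *)
pose c : fps R := fpsC (1 / 8).
have c8 : 8 * c = 1 by rewrite -fpsC_natE -rmorphM -[RHS](rmorph1 (@fpsC R)); congr fpsC; field.
have S0 : S 0%N = 1 by rewrite /S /sqrt_series sqrt_coef0 mul1r.
pose D := 2 * c * (1 - S).
have D0 : D 0%N = 0 by rewrite /D fpsM0 fpsB fps1 S0 subrr mulr0.
have DE : D * (1 - 2 * D) = X.
  have -> : D * (1 - 2 * D) = 2 * c * (1 - S) * (1 - 8 * c) + 8 * c ^+ 2 * (1 - S ^+ 2).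
    by rewrite /D; ring.
  rewrite SS; have -> : 8 * c ^+ 2 * (1 - (1 - 8 * X)) = (8 * c) ^+ 2 * X by ring.
  by rewrite c8; ring.
have F1 := walk_series_outerplanar D0 DE; set F := walk_series _ _ _ in F1.
have [I [i [IE Ii iE]]] : exists (y : fps R) w, [/\ (1 + X) * y = 1, tame rho y w & (1 + rho) * w = 1].
  apply: tame_inv_exists => //; last exact: tameX.
  by apply: (wbounded_le _ (wboundedX _)); lra.
(* [1 / (1 - D) = 4 / (3 + S)], and [9 - S^2 = 8 (1 + X)] makes the denominator rational. *)
have FE : F = 3 * (4 * c) * I - (4 * c * I) * S.
  have u0 : (1 - D) 0%N != 0 by rewrite fpsB D0 fps1 subr0 oner_neq0.
  apply: (fps_mulI u0); rewrite [LHS]mulrC F1.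
  have -> : (1 - D) * (3 * (4 * c) * I - (4 * c * I) * S) =
      (1 - 8 * c) * (4 * c * I) * (3 - S) + (8 * c) * c * I * (9 - S ^+ 2) by rewrite /D; ring.
  rewrite SS c8; have -> : 9 - (1 - 8 * X) = 8 * (1 + X) by ring.
  have -> : (1 - 1) * (4 * c * I) * (3 - S) + 1 * c * I * (8 * (1 + X)) =
     (8 * c) * ((1 + X) * I) by ring.
  by rewrite IE c8 mulr1.
have tH := tameM rho0 rho_le (tameM rho0 rho_le (tame_nat rho 4) (tameC rho (1 / 8))) Ii.
have tG := tameM rho0 rho_le (tameM rho0 rho_le (tame_nat rho 3)
  (tameM rho0 rho_le (tame_nat rho 4) (tameC rho (1 / 8)))) Ii.
have sp0 : Num.sqrt pi != 0 :> R by rewrite gt_eqF // sqrtr_gt0 pi_gt0.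
apply: (@sqrt_singularity_asymptotic R rho rho0 rho_le _ _ F _ _ _ _ (1 / (36 * Num.sqrt pi)) _ FE tG tH).
- by move=> n n0; rewrite num_outerplanarE.
- by rewrite mulf_neq0 ?oner_neq0 // invr_neq0 // mulf_neq0.
- have -> : i = 8 / 9 by move: iE; rewrite /rho; lra.
  by rewrite /rho; field.
move=> n; have -> : rho ^- n.+1 = 8 ^+ n.+1 by rewrite /rho expr_div_n expr1n invf_div divr1.
move: (8 ^+ n.+1) (_ `^ _) => x y; by field.
Qed.

End Outerplanar.

(** * Bipartite maps: a regular root of the cubic *)

Section Bipartite.
Variable R : realType.
Implicit Types (d e : fps R).

Let s : R := Num.sqrt 3.
Let w : R := Num.sqrt 2 / 2.
(** The maximum of [(y - 2 y^3) / (1 + y)] over positive [y], attained at [y = (s - 1) / 2], the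
    value of [D] at its singularity. *)
Let rho : R := 3 * s - 5.
Let X : fps R := fpsX R.
Let sC : fps R := fpsC s.
Let wC : fps R := fpsC w.

Let ss : s ^+ 2 = 3. Proof. by rewrite sqr_sqrtr. Qed.
Let ww : 2 * w ^+ 2 = 1. Proof. by rewrite expr_div_n sqr_sqrtr //; field. Qed.
Let s_bound : 173 / 100 < s < 1733 / 1000.
Proof. by have := ss; have : 0 <= s := sqrtr_ge0 _; move: s => x; nra. Qed.
Let w_bound : 7 / 10 < w < 71 / 100.
Proof.
have : 0 <= w by rewrite divr_ge0 ?sqrtr_ge0.
by have := ww; move: w => x; nra.
Qed.
Let rho0 : 0 < rho. Proof. by rewrite /rho; have := s_bound; lra. Qed.
Let rho_le : rho <= 1 / 5. Proof. by rewrite /rho; have := s_bound; lra. Qed.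
Let r0 : 0 < 1 / 4 :> R. Proof. by lra. Qed.

(** Identities involving the square roots are proved by displaying multiples of [sC ^+ 2 - 3] and
    [2 * wC ^+ 2 - 1], which then vanish. *)
Let ssC : sC ^+ 2 = 3. Proof. by rewrite -rmorphXn /= ss fpsC_natE. Qed.
Let wwC : 2 * wC ^+ 2 = 1.
Proof. by rewrite -rmorphXn /= -fpsC_natE -rmorphM /= ww rmorph1. Qed.
Let rhoC : fpsC rho = 3 * sC - 5.
Proof. by rewrite rmorphB rmorphM /= !fpsC_natE. Qed.

(** The substitution [e = - w (1 + d)] in the cubic of [e], where [1 / w = 2 w]. Solved for the term
    [2 d], the equation maps the ball of radius [1 / 10] to norm at most [0.081]. *)
Lemma bipartite_branch_exists : exists d,
  [/\ d 0%N = 0, wbounded (1 / 4) (1 / 10) d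
    & 2 * d + 3 * d ^+ 2 + d ^+ 3 = X * (2 * wC - 1 - d)].
Proof.
have half : fpsC (1 / 2) * 2 = 1 :> fps R.
  by rewrite -fpsC_natE -rmorphM -[RHS](rmorph1 (@fpsC R)); congr fpsC; field.
pose c := 2 * wC - 1; pose sq (f : fps R) : fps R := fps_tail f * fps_tail f.
pose Phi (f : fps R) : fps R := fpsC (1 / 2) * (X * c - X * f - 3 * sq f - fps_tail f * fps_tail (sq f)).
have cE : c = fpsC (2 * w - 1) by rewrite rmorphB rmorphM rmorph1 /= fpsC_natE.
have [|||d Ed dB] := @contractive_fixpoint R (1 / 4) r0 Phi (1 / 10).
- move=> f g n fg; rewrite /Phi !fpsCM !fpsB -!fpsC_natE !fpsCM.
  have sqE i : (i <= n)%N -> sq f i = sq g i.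
    move=> lein; apply: contractive_tail_mul => j ji; apply: fg; exact: leq_trans ji lein.
  rewrite (contractive_mul (c := X) _ fg) // sqE //.
  by rewrite (contractive_tail_mul fg (fun i ltin => sqE i (ltnW ltin))).
- by lra.
- move=> f fB; have tB := wbounded_tail r0 fB; have sB := wboundedM r0 tB tB.
  have cB := wboundedC (1 / 4) (2 * w - 1); have XB := wboundedX r0.
  have B3 := wboundedM r0 (wboundedC (1 / 4) 3%:R) sB; rewrite fpsC_natE in B3.
  rewrite /Phi cE.
  have := wboundedM r0 (wboundedC (1 / 4) (1 / 2)) (wboundedB r0 (wboundedB r0 (wboundedB r0
    (wboundedM r0 XB cB) (wboundedM r0 XB fB)) B3) (wboundedM r0 tB (wbounded_tail r0 sB))).
  by apply: wbounded_le; case/andP: w_bound; move: w => x x1 x2; rewrite !ger0_norm; lra.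
have d0 : d 0%N = 0.
  have sq0 : sq d 0%N = 0 by rewrite /sq fpsM0 /fps_tail mul0r.
  by rewrite -Ed /Phi !fpsM0 !fpsB !fpsM0 sq0 /fps_tail !mul0r mulr0 !subr0 mulr0.
exists d; split=> //.
have sqd : sq d = d ^+ 2 by rewrite /sq !fps_tail_id // expr2.
rewrite /Phi sqd !fps_tail_id ?expr2 ?fpsM0 ?d0 ?mul0r // in Ed.
have E2 : 2 * d = X * c - X * d - 3 * (d * d) - d * (d * d).
  move: Ed; set y : fps R := _ - d * (d ^+ 2); move=> Ed.
  have -> : 2 * d = (fpsC (1 / 2) * 2) * y by rewrite -{1}Ed; ring.
  by rewrite half mul1r /y; ring.
by rewrite E2 /c; ring.
Qed.

Lemma fpsC0 (c : R) : (fpsC c : fps R) 0%N = c. Proof. by rewrite /fpsC mulr1n. Qed.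

(** Normalises an affine expression in [d] to constant term [1], the form in which square roots and
    inverses are available. *)
Lemma fps_affine_tame (a b : R) (x : fps R) (v : R) : 0 <= b <= a -> 0 < a ->
    x 0%N = 0 -> wbounded (1 / 4) (1 / 10) x -> tame rho x v -> exists (y : fps R) z,
  [/\ y 0%N = 0, wbounded (1 / 4) (1 / 10) y, tame rho y z, fpsC a + fpsC b * x = fpsC a * (1 + y)
    & 0 < 1 + z].
Proof.
move=> /andP[b0 ba] a0 x0 xB xv; have a0' : a != 0 by rewrite gt_eqF.
have k0 : 0 <= b / a by rewrite divr_ge0 // ltW.
have k1 : b / a <= 1 by rewrite ler_pdivrMr // mul1r.
have yB : wbounded (1 / 4) (1 / 10) (fpsC (b / a) * x).
  apply: wbounded_le (wboundedM r0 (wboundedC _ _) xB).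
  by rewrite ger0_norm; lra.
have yz := tameM rho0 rho_le (tameC rho (b / a)) xv.
exists (fpsC (b / a) * x), (b / a * v); split=> //.
- by rewrite fpsM0 x0 mulr0.
- by rewrite mulrDr mulr1 mulrA -rmorphM /= mulrCA divff // mulr1.
have [z zv zB] := wbounded_tame rho0 rho_le yB.
have E := tame_unique yz zv; rewrite E in yz *.
by move: zB; rewrite ler_norml; lra.
Qed.

(* [e] and [D] are roots of the same cubic [2 Y^3 + (X - 1) Y + X].  The root [e],
   with constant term [- sqrt 2 / 2], is analytic beyond [rho], whereas [D] is the
   small root of the remaining quadratic factor, whose discriminant [U ^+ 2] has
   a simple zero at [rho]: [U = T * sqrt (1 - X / rho)]. *)
Record bipartite_branch (e T I : fps R) (ev tv iv : R) : Prop := BipartiteBranch {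
  branch_e0 : e 0%N = - w;
  branch_eq : 2 * e ^+ 3 - e + X * (1 + e) = 0;
  branch_T0 : T 0%N = w;
  branch_T : T ^+ 2 * (sC - 1 - 2 * e) ^+ 2 = 2 * fpsC rho * (1 - e) * (1 + sC - e);
  branch_I : (1 + 2 * X) * I = 1;
  branch_ev : tame rho e ev;
  branch_tv : tame rho T tv;
  branch_iv : tame rho I iv;
  branch_ev_lt0 : ev < 0;
  branch_tv_gt0 : 0 < tv }.

(** [1 - e], [1 + sC - e] and [sC - 1 - 2 * e] are affine in [d] with dominant constant terms, so
    [T] is built from square roots of the first two and an inverse of the third. Its constant term
    [w = - e 0] makes [D] vanish at the origin. *)
Lemma bipartite_tame_branch : exists e T I ev tv iv, bipartite_branch e T I ev tv iv.
Proof.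
have [d [d0 dB dE]] := bipartite_branch_exists.
have [v dv vB] := wbounded_tame rho0 rho_le dB.
have [w1 w2] := andP w_bound; have [s1 s2] := andP s_bound.
pose e := - (wC * (1 + d)).
have [y1 [z1 [y10 y1B y1z E1 z1p]]] : exists (y : fps R) z, [/\ y 0%N = 0, wbounded (1 / 4) (1 / 10) y,
    tame rho y z, fpsC (1 + w) + fpsC w * d = fpsC (1 + w) * (1 + y) & 0 < 1 + z].
  by apply: (fps_affine_tame _ _ d0 dB dv); move: w1 w2; move: w => x ? ?; lra.
have [y2 [z2 [y20 y2B y2z E2 z2p]]] : exists (y : fps R) z, [/\ y 0%N = 0, wbounded (1 / 4) (1 / 10) y,
    tame rho y z, fpsC (1 + s + w) + fpsC w * d = fpsC (1 + s + w) * (1 + y) & 0 < 1 + z].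
  by apply: (fps_affine_tame _ _ d0 dB dv); move: w1 w2 s1 s2; move: w s => x y ? ? ? ?; lra.
have [y3 [z3 [y30 y3B y3z E3 z3p]]] : exists (y : fps R) z, [/\ y 0%N = 0, wbounded (1 / 4) (1 / 10) y,
    tame rho y z, fpsC (s - 1 + 2 * w) + fpsC (2 * w) * d = fpsC (s - 1 + 2 * w) * (1 + y) & 0 < 1 + z].
  by apply: (fps_affine_tame _ _ d0 dB dv); move: w1 w2 s1 s2; move: w s => x y ? ? ? ?; lra.
have up (y : fps R) : wbounded (1 / 4) (1 / 10) y -> wbounded (1 / 4) (3 / 4) y.
  by apply: wbounded_le; lra.
have [q1 [u1 [q1E q10 q1u u1p]]] := tame_sqrt_exists rho0 rho_le y10 (up _ y1B) y1z.
have [q2 [u2 [q2E q20 q2u u2p]]] := tame_sqrt_exists rho0 rho_le y20 (up _ y2B) y2z.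
have y3B' : wbounded (1 / 4) (1 / 2) y3 by apply: wbounded_le y3B; lra.
have [j [u3 [jE ju u3E]]] := tame_inv_exists rho0 rho_le y30 y3B' y3z.
have u3p : 0 < u3 by rewrite -(pmulr_rgt0 _ z3p) u3E.
have j0 : j 0%N = 1 by have := congr1 (fun f : fps R => f 0%N) jE; rewrite fpsM0 fpsD y30 fps1 addr0 mul1r.
have [I [iv [IE Iiv _]]] : exists (y : fps R) z,
    [/\ (1 + 2 * X) * y = 1, tame rho y z & (1 + 2 * rho) * z = 1].
  apply: tame_inv_exists => //.
  - by rewrite -fpsC_natE fpsM0 /X /fpsX mulr0.
  - rewrite -fpsC_natE; apply: wbounded_le (wboundedM r0 (wboundedC _ _) (wboundedX r0)).
    by rewrite ger0_norm; lra.
  - exact: (tameM rho0 rho_le (tame_nat rho 2) (@tameX R rho)).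
exists e, (wC * (q1 * q2) * j), I, (- (w * (1 + v))), (w * (u1 * u2) * u3), iv; split=> //.
- by rewrite /e fpsN fpsM0 fpsD d0 fps1 addr0 mulr1 [wC _]fpsC0.
- have -> : 2 * e ^+ 3 - e + X * (1 + e) =
      - wC * (2 * d + 3 * d ^+ 2 + d ^+ 3 - X * (2 * wC - 1 - d))
      - (2 * wC ^+ 2 - 1) * (wC * (1 + d) ^+ 3 + X) by rewrite /e; ring.
  by rewrite dE wwC !subrr; ring.
- by rewrite !fpsM0 [wC _]fpsC0 q10 q20 j0 !mulr1.
- have A1C : fpsC (1 + w) = 1 + wC by rewrite rmorphD rmorph1.
  have A2C : fpsC (1 + s + w) = 1 + sC + wC by rewrite !rmorphD rmorph1.
  have A3D : fpsC (2 * w) = 2 * wC by rewrite (rmorphM _ 2 w) /= fpsC_natE.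
  have A3C : fpsC (s - 1 + 2 * w) = sC - 1 + 2 * wC by rewrite -A3D rmorphD rmorphB rmorph1.
  have V : sC - 1 - 2 * e = fpsC (s - 1 + 2 * w) * (1 + y3).
    by rewrite -E3 A3C A3D /e; ring.
  have -> : 1 - e = fpsC (1 + w) * q1 ^+ 2.
    by rewrite q1E -E1 A1C /e; ring.
  have -> : 1 + sC - e = fpsC (1 + s + w) * q2 ^+ 2.
    by rewrite q2E -E2 A2C /e; ring.
  rewrite V; have -> : (wC * (q1 * q2) * j) ^+ 2 * (fpsC (s - 1 + 2 * w) * (1 + y3)) ^+ 2 =
    (wC * fpsC (s - 1 + 2 * w)) ^+ 2 * ((1 + y3) * j) ^+ 2 * (q1 * q2) ^+ 2 by ring.
  rewrite jE expr1n mulr1.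
  have -> : 2 * fpsC rho * (fpsC (1 + w) * q1 ^+ 2) * (fpsC (1 + s + w) * q2 ^+ 2) =
    fpsC (2 * rho * (1 + w) * (1 + s + w)) * (q1 * q2) ^+ 2.
    by rewrite (rmorphM _ _ (1 + s + w)) (rmorphM _ _ (1 + w)) (rmorphM _ 2 rho) /= fpsC_natE; ring.
  rewrite -rmorphM -rmorphXn /=; congr (fpsC _ * _).
  have -> : 2 * rho * (1 + w) * (1 + s + w) = (w * (s - 1 + 2 * w)) ^+ 2 +
     (s ^+ 2 - 3) * (11 / 2 + 6 * w) + (2 * w ^+ 2 - 1) * (3 * s - 6 - (s - 1 + 2 * w) ^+ 2 / 2).
    by rewrite /rho; move: s w => x y; field.
  by rewrite ss ww !subrr !mul0r !addr0.
- apply: tameN => //; apply: tameM => //; first exact: tameC.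
  by apply: tameD => //; apply: tame1.
- by apply: tameM => //; apply: tameM => //; [exact: tameC|apply: tameM].
- rewrite oppr_lt0 pmulr_rgt0; last by move: w1; move: w => x ?; lra.
  by move: vB; rewrite ler_norml; lra.
- have w0 : 0 < w by move: w1; move: w => x ?; lra.
  by rewrite !mulr_gt0.
Qed.

Section FromBranch.
Variables (e T I : fps R) (ev tv iv : R).
Hypothesis br : bipartite_branch e T I ev tv iv.

Let S : fps R := sqrt_series rho^-1.
Let U : fps R := S * T.
Let D : fps R := fpsC (1 / 2) * (- e - U).

Let half : 2 * fpsC (1 / 2) = 1 :> fps R.
Proof. by rewrite -fpsC_natE -rmorphM -[RHS](rmorph1 (@fpsC R)); congr fpsC; field. Qed.

Let w_neq0 : w != 0. Proof. by case/andP: w_bound; move: w => x ? ?; lra. Qed.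

Let e_neq0 : e 0%N != 0. Proof. by rewrite (branch_e0 br) oppr_eq0. Qed.

Let rhoSS : fpsC rho * S ^+ 2 = 3 * sC - 5 - X.
Proof.
rewrite sqrt_series_sqr mulrBr mulr1 mulrA -rmorphM /= divff ?gt_eqF //.
by rewrite rmorph1 mul1r rhoC.
Qed.

(** Origin of the equation for [T]: eliminating [X = (e - 2 e^3) / (1 + e)] gives [e^2 + 2 X / e =
    (e - 1) (e - 1 - s) (e - 1 + s) / (1 + e)] and [rho - X = 2 (e - 1 + s) (e - (s - 1) / 2)^2 / (1
    + e)]. The common factor [e - 1 + s] is the zero at [rho], and the quotient of the two is
    [T^2 / rho]. *)
Lemma branch_U : e * U ^+ 2 = e ^+ 3 + 2 * X.
Proof.
set V := sC - 1 - 2 * e; set C := 2 * e ^+ 3 - e + X * (1 + e).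
have V0 : (V ^+ 2) 0%N != 0.
  have -> : (V ^+ 2) 0%N = (s - 1 + 2 * w) ^+ 2.
    rewrite expr2 fpsM0 -expr2; congr (_ ^+ 2).
    by rewrite /V -fpsC_natE !fpsB fpsM0 [sC _]fpsC0 fpsC0 fps1 (branch_e0 br) mulrN opprK.
  rewrite expf_neq0 // gt_eqF //.
  by case/andP: w_bound; case/andP: s_bound; move: w s => x y ? ? ? ?; lra.
apply: (fps_mulI V0); apply/eqP; rewrite -subr_eq0; apply/eqP.
have -> : V ^+ 2 * (e * U ^+ 2) = 2 * e * (3 * sC - 5 - X) * (1 - e) * (1 + sC - e).
  have -> : V ^+ 2 * (e * U ^+ 2) = e * S ^+ 2 * (T ^+ 2 * V ^+ 2) by rewrite /U; ring.
  rewrite (branch_T br) -rhoSS; ring.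
have -> : 2 * e * (3 * sC - 5 - X) * (1 - e) * (1 + sC - e) - V ^+ 2 * (e ^+ 3 + 2 * X) =
  2 * C * (- e ^+ 2 + (sC - 1) * e + 2 * sC - 4) +
  (sC ^+ 2 - 3) * (6 * e - 6 * e ^+ 2 - e ^+ 3 - 2 * X) by rewrite /V /C; ring.
by rewrite /C (branch_eq br) ssC; ring.
Qed.

Lemma branch_D0 : D 0%N = 0.
Proof.
rewrite /D fpsM0 fpsB fpsN /U fpsM0 (branch_e0 br) (branch_T0 br).
by rewrite /S /sqrt_series sqrt_coef0 expr0 !mul1r opprK subrr mulr0.
Qed.

(** [P = 0] is the quadratic factor of the cubic, multiplied by [e]; [D] solves it by the choice of
    [U]. *)
Lemma branch_D : D - 2 * D ^+ 3 = X * (1 + D).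
Proof.
set P := 2 * e * D * (D + e) - X.
have P0 : P = 0.
  have -> : P = (2 * fpsC (1 / 2)) * (fpsC (1 / 2) * (e * U ^+ 2 - e ^+ 3 - 2 * X)) +
     (1 - 2 * fpsC (1 / 2)) * (2 * fpsC (1 / 2) * e ^+ 2 * (- e - U) - (1 + 2 * fpsC (1 / 2)) * X) by rewrite /P /D; ring.
  by rewrite branch_U half; ring.
apply: (fps_mulI e_neq0); apply/eqP; rewrite eq_sym -subr_eq0; apply/eqP.
have -> : e * (X * (1 + D)) - e * (D - 2 * D ^+ 3) =
  (D - e) * P + D * (2 * e ^+ 3 - e + X * (1 + e)) by rewrite /P; ring.
by rewrite P0 (branch_eq br); ring.
Qed.

(** [1 / (1 - D) = 2 / (2 + e + U)] is made rational by [2 + e - U]; the cubic turns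
    [(2 + e)^2 - U^2] into [2 (1 + 2 X) / (1 - e)]. *)
Lemma branch_walk_series :
  walk_series R (weight true) 1 = (1 - e) * I * (2 + e) - (1 - e) * I * T * S :> fps R.
Proof.
have D1 : (1 - D) 0%N != 0 by rewrite fpsB branch_D0 fps1 subr0 oner_neq0.
apply: (fps_mulI D1); rewrite mulrC (walk_series_bipartite branch_D0 branch_D).
apply: (fps_mulI e_neq0).
have -> : e * ((1 - D) * ((1 - e) * I * (2 + e) - (1 - e) * I * T * S)) =
   fpsC (1 / 2) * (1 - e) * I * (e * (2 + e) ^+ 2 - e * U ^+ 2)
   + (1 - 2 * fpsC (1 / 2)) * (e * (1 - e) * I * (2 + e - U)) by rewrite /D /U; ring.
rewrite branch_U half.
have -> : fpsC (1 / 2) * (1 - e) * I * (e * (2 + e) ^+ 2 - (e ^+ 3 + 2 * X)) =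
   (2 * fpsC (1 / 2)) * e * ((1 + 2 * X) * I) - (2 * fpsC (1 / 2)) * I * (2 * e ^+ 3 - e + X * (1 + e)) by ring.
by rewrite (branch_eq br) (branch_I br) half; ring.
Qed.

(** At [X = rho] the cubic has the simple root [1 - s] and the double root [(s - 1) / 2]; the sign
    of [ev] selects the former. *)
Lemma branch_ev_val : ev = 1 - s.
Proof.
have He := branch_ev br; have tX := @tameX R rho.
have h : tame rho (2 * e ^+ 3 - e + X * (1 + e)) (2 * ev ^+ 3 - ev + rho * (1 + ev)).
  have h3 := tameM rho0 rho_le (tame_nat rho 2) (tameM rho0 rho_le He (tameM rho0 rho_le He He)).
  exact: (tameD (tameB rho0 rho_le h3 He) (tameM rho0 rho_le tX (tameD (tame1 rho) He))).
rewrite (branch_eq br) in h; have E := tame_unique h (tame_nat rho 0).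
have E2 : 2 * (ev - (s - 1) / 2) ^+ 2 * (ev - (1 - s)) = 0.
  transitivity (2 * ev ^+ 3 - ev + rho * (1 + ev) + (s ^+ 2 - 3) * ((s - 3) / 2 - 3 / 2 * ev)).
    by rewrite /rho; move: s => x; field.
  by rewrite E ss subrr mul0r addr0.
move/eqP: E2; rewrite mulf_eq0 subr_eq0 => /orP[/eqP E2|/eqP //].
suff : 0 < (ev - (s - 1) / 2) ^+ 2 by move: E2; move: (_ ^+ 2) => z; lra.
rewrite exprn_even_gt0 //= lt_eqF //.
by have := branch_ev_lt0 br; case/andP: s_bound; move: s => x x1 x2 e0; lra.
Qed.

Lemma branch_tv_val : tv ^+ 2 = 2 * (s - 1) / 3.
Proof.
have He := branch_ev br; have Ht := branch_tv br.
have h1 : tame rho (T ^+ 2 * (sC - 1 - 2 * e) ^+ 2) (tv ^+ 2 * (s - 1 - 2 * ev) ^+ 2).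
  have hV := tameB rho0 rho_le (tameB rho0 rho_le (tameC rho s) (tame1 rho))
    (tameM rho0 rho_le (tame_nat rho 2) He).
  rewrite !expr2; exact: (tameM rho0 rho_le (tameM rho0 rho_le Ht Ht) (tameM rho0 rho_le hV hV)).
have h2 : tame rho (2 * fpsC rho * (1 - e) * (1 + sC - e)) (2 * rho * (1 - ev) * (1 + s - ev)).
  exact: (tameM rho0 rho_le (tameM rho0 rho_le (tameM rho0 rho_le (tame_nat rho 2) (tameC rho rho))
    (tameB rho0 rho_le (tame1 rho) He)) (tameB rho0 rho_le (tameD (tame1 rho) (tameC rho s)) He)).
rewrite (branch_T br) in h1; have := tame_unique h1 h2; rewrite branch_ev_val /rho.
have alg (x y : R) : x ^+ 2 = 3 -> 6 - 3 * x != 0 ->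
    y * (x - 1 - 2 * (1 - x)) ^+ 2 = 2 * (3 * x - 5) * (1 - (1 - x)) * (1 + x - (1 - x)) ->
    y = 2 * (x - 1) / 3.
  move=> xx x0; have -> : (x - 1 - 2 * (1 - x)) ^+ 2 = 6 * (6 - 3 * x) + 9 * (x ^+ 2 - 3) by ring.
  have -> : 2 * (3 * x - 5) * (1 - (1 - x)) * (1 + x - (1 - x)) =
    6 * (6 - 3 * x) * (2 * (x - 1) / 3) + (x ^+ 2 - 3) * (12 * x - 8) by field.
  rewrite xx subrr mulr0 mul0r !addr0 mulrC; apply: mulfI.
  by rewrite mulf_neq0 ?pnatr_eq0.
apply: alg ss _; case/andP: s_bound; move: s => x x1 x2; lra.
Qed.

Lemma branch_iv_val : (6 * s - 9) * iv = 1.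
Proof.
have h : tame rho ((1 + 2 * X) * I) ((1 + 2 * rho) * iv).
  exact: (tameM rho0 rho_le (tameD (tame1 rho) (tameM rho0 rho_le (tame_nat rho 2) (@tameX R rho)))
    (branch_iv br)).
rewrite (branch_I br) in h; have := tame_unique h (tame1 rho); rewrite /rho.
by move=> E; rewrite -[RHS]E; ring.
Qed.

End FromBranch.

Theorem bipartite_outerplanar_asymptotic :
  asymptotic_to (fun n : nat => (num_bipartite_outerplanar n)%:R : R)
    (fun n : nat =>
       ((2%:R * Num.sqrt 3%:R - 3%:R) * Num.sqrt 2%:R)
         / (9%:R * Num.sqrt (pi * (Num.sqrt 3%:R - 1)))
       * (3%:R * Num.sqrt 3%:R - 5%:R) ^- n
       * n%:R `^ (- (3%:R / 2%:R))).
Proof.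
have [e [T [I [ev [tv [iv br]]]]]] := bipartite_tame_branch.
have t1 := tame1 rho; have He := branch_ev br.
have h1 := tameM rho0 rho_le (tameB rho0 rho_le t1 He) (branch_iv br).
have h2 := tameM rho0 rho_le h1 (branch_tv br).
have h3 := tameM rho0 rho_le h1 (tameD (tame_nat rho 2) He).
have s0 : 0 < s - 1 by case/andP: s_bound; move: s => x ? ?; lra.
have sp0 : 0 < Num.sqrt pi :> R by rewrite sqrtr_gt0 pi_gt0.
have u0 : 0 < Num.sqrt (s - 1) by rewrite sqrtr_gt0.
have q0 : 0 < Num.sqrt 2 :> R by rewrite sqrtr_gt0.
have sE : Num.sqrt (pi * (s - 1)) = Num.sqrt pi * Num.sqrt (s - 1) by rewrite sqrtrM // pi_ge0.
have tE : s * tv = Num.sqrt 2 * Num.sqrt (s - 1).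
  have sgt0 : 0 < s by lra.
  apply/eqP; rewrite -(@eqrXn2 _ 2) ?mulr_ge0 ?(ltW sgt0) ?(ltW (branch_tv_gt0 br)) ?sqrtr_ge0 //.
  rewrite !exprMn ss (branch_tv_val br) !sqr_sqrtr ?(ltW s0) //.
  by apply/eqP; field.
have i0 := branch_iv_val br.
apply: (@sqrt_singularity_asymptotic R rho rho0 rho_le _ _ _ _ _ _ _
  ((2 * s - 3) * Num.sqrt 2 / (9 * Num.sqrt (pi * (s - 1)))) _ (branch_walk_series br) h3 h2).
- by move=> n n0; rewrite num_bipartite_outerplanarE.
- have k0 : 2 * s - 3 != 0 by case/andP: s_bound; move: s => x ? ?; lra.
  by rewrite sE !(mulf_eq0, invr_eq0) !negb_or k0 ?gt_eqF.
- rewrite (branch_ev_val br) sE.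
  have -> : (1 - (1 - s)) * iv * tv * rho = s * tv * (iv * rho) by ring.
  rewrite tE.
  have uu : Num.sqrt (s - 1) ^+ 2 = s - 1 by rewrite sqr_sqrtr // ltW.
  have k0 : 6 * s - 9 != 0 by case/andP: s_bound; move: s => x ? ?; lra.
  apply: (mulfI k0); rewrite [RHS]mulrCA [_ * (iv * rho)]mulrA i0 mul1r.
  move: ss uu u0 sp0; rewrite /rho; move: (Num.sqrt (s - 1)) (Num.sqrt pi) (Num.sqrt 2) => u p q.
  move: s => x xx uu u0 p0.
  (* The constants match because [2 (2 x - 3)^2 / 3 = (x - 1) (3 x - 5)] when [x^2 = 3]. *)
  have -> : (6 * x - 9) * ((2 * x - 3) * q / (9 * (p * u)) * (2 * p)) =
    q / u * ((x - 1) * (3 * x - 5) - (x ^+ 2 - 3) / 3) by field; rewrite !gt_eqF.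
  rewrite xx subrr mul0r subr0 -uu; field.
  by rewrite gt_eqF.
by [].
Qed.

End Bipartite.

Theorem corollary1p5 (R : realType) :
  asymptotic_to (fun n : nat => (num_outerplanar n)%:R : R)
    (fun n : nat => (8%:R ^+ n * n%:R `^ (- (3%:R / 2%:R)))
                    / (36%:R * Num.sqrt pi))
  /\
  asymptotic_to (fun n : nat => (num_bipartite_outerplanar n)%:R : R)
    (fun n : nat =>
       ((2%:R * Num.sqrt 3%:R - 3%:R) * Num.sqrt 2%:R)
         / (9%:R * Num.sqrt (pi * (Num.sqrt 3%:R - 1)))
       * (3%:R * Num.sqrt 3%:R - 5%:R) ^- n
       * n%:R `^ (- (3%:R / 2%:R))).
Proof. by split; [exact: outerplanar_asymptotic|exact: bipartite_outerplanar_asymptotic]. Qed.
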